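(* Let $G$ be a finite-dimensional, semisimple and simply connected (in particular connected) Lie group. Then every central extension $1\to \mathrm{U}(1)\to\widetilde{LG}\to LG\to 1$ of the smooth loop group $LG$ is disjoint commutative.
   Context: $S^1=\mathbb{R}/2\pi\mathbb{Z}$, and $LG=C^\infty(S^1,G)$ is the smooth loop group, a Fréchet Lie group under pointwise multiplication; $e\in G$ is the identity. For a subset $I\subset S^1$, $L_IG=\{\gamma\in LG\mid \gamma(t)=e \text{ whenever } t\notin I\}$. A central extension of a (possibly infinite-dimensional, Fréchet) Lie group $H$ is a sequence $1\to \mathrm{U}(1)\to\widetilde H\xrightarrow{\pi}H\to 1$ of Lie groups and Lie group homomorphisms that is exact as a sequence of groups, with $\mathrm{U}(1)$ mapping into the center of $\widetilde H$, and such that $\widetilde H$ is a (smooth, locally trivial) principal $\mathrm{U}(1)$-bundle over $H$. For a subgroup $K\subset H$, $\widetilde K:=\pi^{-1}(K)$. A central extension $\widetilde{LG}$ of $LG$ is called disjoint commutative if for all subsets $I,J\subset S^1$ with $I\cap J=\emptyset$, the subgroups $\widetilde{L_IG}$ and $\widetilde{L_JG}$ of $\widetilde{LG}$ commute with each other elementwise. *)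

(* Defs.v *)
From HB Require Import structures.
From mathcomp Require Import all_boot all_order all_algebra.
From mathcomp Require Import generic_quotient complex.
From mathcomp Require Import all_classical all_reals all_analysis.
Set Implicit Arguments.
Unset Strict Implicit.
Unset Printing Implicit Defensive.
Import Order.TTheory GRing.Theory Num.Theory.
Import numFieldNormedType.Exports.
Local Open Scope quotient_scope.
Local Open Scope classical_set_scope.
Local Open Scope ring_scope.

(* Calculus on locally convex spaces (Bastiani, Michal, Hamilton): f is C^(k+1)
   on U when its directional derivatives df (x, v) exist for x in U and df is
   C^k on U x E. [U] is meant to be open. *)
Fixpoint Ck (R : realType) (k : nat) (E F : tvsType R) (U : set E) (f : E -> F)
    {struct k} : Prop :=
  (forall x, U x -> {for x, continuous f}) /\
  if k is k'.+1 then
    exists df : E * E -> F,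
      (forall x v, U x ->
        h^-1 *: (f (h *: v + x) - f x) @[h --> (0 : R)^'] --> df (x, v)) /\
      Ck k' (U `*` setT) df
  else True.

Definition Cinfty (R : realType) (E F : tvsType R) (U : set E) (f : E -> F) :=
  forall k, Ck k U f.

(* Completeness is that of the translation-invariant uniform structure: the one
   carried by a [tvsType] is only required to induce its topology. *)
Definition frechet_space (R : realType) (E : tvsType R) : Prop :=
  [/\ hausdorff_space E,
      exists B : nat -> set E, forall U, nbhs 0 U <-> exists k, B k `<=` U &
      forall D : set_system E, ProperFilter D ->
        (forall U, nbhs 0 U ->
          exists A, D A /\ forall x y, A x -> A y -> U (x - y)) ->
        exists l : E, D --> l].

(* A chart is recorded by its inverse, the parametrization [chart_map] of its
   domain by the open subset [chart_dom] of the model space. *)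
Record chart (R : realType) (E : tvsType R) (M : Type) := Chart {
  chart_dom : set E;
  chart_map :> E -> M }.

Section Charts.
Context {R : realType} {E : tvsType R}.

Definition chart_cod {M : Type} (c : chart E M) : set M := c @` chart_dom c.

Definition chart_coord {M : choiceType} (c : chart E M) : M -> E :=
  'pinv_(fun=> 0) (chart_dom c) c.

Definition atlas (M : Type) := set (chart E M).

(* M with the topology determined by the atlas A *)
Definition mfd {M : choiceType} (A : atlas M) : Type := M.

Section AtlasTopology.
Variables (M : choiceType) (A : atlas M).

HB.instance Definition _ := Choice.on (mfd A).

Definition atlas_open (W : set (mfd A)) : Prop :=
  forall c, A c -> forall x, chart_dom c x -> W (c x) ->
    \forall y \near x, chart_dom c y -> W (c y).

Lemma atlas_openT : atlas_open setT.
Proof. by move=> c _ x _ _; exact: nearW. Qed.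

Lemma atlas_openI : setI_closed atlas_open.
Proof.
move=> W W' oW oW' c Ac x cx [Wx W'x]; have := oW _ Ac _ cx Wx.
have := oW' _ Ac _ cx W'x; apply: filterS2 => y W'y Wy cy.
by split; [exact: Wy|exact: W'y].
Qed.

Lemma atlas_open_bigcup (I : Type) (f : I -> set (mfd A)) :
  (forall i, atlas_open (f i)) -> atlas_open (\bigcup_i f i).
Proof.
move=> of_ c Ac x cx [i _ fx]; have := of_ i _ Ac _ cx fx.
by apply: filterS => y fy cy; exists i => //; exact: fy.
Qed.

HB.instance Definition _ := isOpenTopological.Build (mfd A)
  atlas_openT atlas_openI atlas_open_bigcup.

Lemma open_mfdE (W : set (mfd A)) : open W = atlas_open W.
Proof. by []. Qed.

End AtlasTopology.
End Charts.
Arguments atlas {R} E M.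

(* [W] is meant to be open. *)
Definition smooth_on (R : realType) (E F : tvsType R) (M N : choiceType)
    (A : atlas E M) (B : atlas F N) (W : set M) (f : M -> N) : Prop :=
  (forall x : mfd A, W x -> {for x, continuous (f : mfd A -> mfd B)}) /\
  forall c d, A c -> B d ->
    Cinfty [set x | [/\ chart_dom c x, W (c x) & chart_cod d (f (c x))]]
           (chart_coord d \o f \o c).

Definition smooth_map (R : realType) (E F : tvsType R) (M N : choiceType)
    (A : atlas E M) (B : atlas F N) (f : M -> N) : Prop :=
  smooth_on A B setT f.

Record is_manifold (R : realType) (E : tvsType R) (M : choiceType)
    (A : atlas E M) : Prop := IsManifold {
  chart_open : forall c, A c -> open (chart_dom c);
  chart_inj : forall c, A c -> {in chart_dom c &, injective c};
  chart_cover : forall p : M, exists2 c, A c & chart_cod c p;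
  chart_overlap : forall c d, A c -> A d ->
    open (chart_dom c `&` c @^-1` chart_cod d);
  chart_transition : forall c d, A c -> A d ->
    Cinfty (chart_dom c `&` c @^-1` chart_cod d) (chart_coord d \o c);
  manifold_hausdorff : hausdorff_space (mfd A) }.

Definition prod_chart (R : realType) (E F : tvsType R) (M N : Type)
    (c : chart E M) (d : chart F N) : chart (E * F)%type (M * N) :=
  Chart (chart_dom c `*` chart_dom d) (fun x => (c x.1, d x.2)).

Definition prod_atlas (R : realType) (E F : tvsType R) (M N : Type)
    (A : atlas E M) (B : atlas F N) : atlas (E * F)%type (M * N) :=
  [set prod_chart c d | c in A & d in B].

Definition line_atlas (R : realType) : atlas R^o R^o := [set Chart setT idfun].
Arguments line_atlas R : clear implicits.

Record lieGroup (R : realType) (E : tvsType R) := LieGroup {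
  lie_sort :> groupType;
  lie_atlas : atlas E lie_sort;
  lie_manifold : is_manifold lie_atlas;
  lie_mul_smooth : smooth_map (prod_atlas lie_atlas lie_atlas) lie_atlas
    (fun x : lie_sort * lie_sort => x.1 * x.2)%g;
  lie_inv_smooth : smooth_map lie_atlas lie_atlas (fun x : lie_sort => x^-1)%g }.
Arguments lie_atlas {R E} l.

Section LieAlgebra.
Variables (R : realType) (n : nat).
Implicit Types (br : 'rV[R]_n -> 'rV[R]_n -> 'rV[R]_n) (I : {vspace 'rV[R]_n}).

Definition lie_ideal br I : Prop := forall x y, y \in I -> br x y \in I.

(* The span of the brackets of elements of I; [br] being bilinear, those of the
   elements of a basis suffice. *)
Definition derived_space br I : {vspace 'rV[R]_n} :=
  <<[seq br x y | x <- vbasis I, y <- vbasis I]>>%VS.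

Definition solvable_ideal br I : Prop :=
  lie_ideal br I /\ exists k, iter k (derived_space br) I = 0%VS.

Definition semisimple_bracket br : Prop :=
  forall I, solvable_ideal br I -> I = 0%VS.

Variable G : lieGroup 'rV[R]_n.

(* T_eG is read as R^n in a chart c with c x0 = e; then Ad g is the derivative
   at e of the conjugation by g and [X, Y] = ad X Y, with ad the derivative of
   Ad at e. *)
Definition lie_Ad (c : chart 'rV[R]_n G) (x0 : 'rV[R]_n) (g : G)
    (Y : 'rV[R]_n) : 'rV[R]_n :=
  'D_Y (fun x => chart_coord c (g * c x * g^-1)%g) x0.

Definition lie_bracket (c : chart 'rV[R]_n G) (x0 X Y : 'rV[R]_n) : 'rV[R]_n :=
  'D_X (fun x => lie_Ad c x0 (c x) Y) x0.

(* The choice of chart changes the Lie algebra only by an isomorphism. *)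
Definition semisimple : Prop :=
  forall c x0, lie_atlas G c -> chart_dom c x0 -> c x0 = 1%g ->
    semisimple_bracket (lie_bracket c x0).

End LieAlgebra.

Definition path_connected (R : realType) (T : topologicalType) : Prop :=
  forall x y : T, exists f : R -> T,
    [/\ {within `[0, 1], continuous f}, f 0 = x & f 1 = y].

Definition null_homotopic (R : realType) (T : topologicalType)
    (f : R -> T) : Prop :=
  exists K : R * R -> T,
    [/\ {within `[0, 1] `*` `[0, 1], continuous K},
        forall t, t \in `[0, 1] -> K (0, t) = f t,
        forall t, t \in `[0, 1] -> K (1, t) = f 0 &
        forall s, s \in `[0, 1] -> K (s, 0) = f 0 /\ K (s, 1) = f 0].

Definition simply_connected (R : realType) (T : topologicalType) : Prop :=
  path_connected R T /\
  forall f : R -> T, {within `[0, 1], continuous f} -> f 0 = f 1 ->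
    null_homotopic f.

Section UnitaryGroup.
Variable R : realType.
Local Open Scope complex_scope.

Record U1 := MkU1 { U1_val :> R[i]; U1_norm : `|U1_val| == 1 }.

HB.instance Definition _ := [isSub for U1_val].
HB.instance Definition _ := [Choice of U1 by <:].

Lemma U1_one_norm : `|1 : R[i]| == 1. Proof. by rewrite normr1. Qed.

Lemma U1_mul_norm (z w : U1) : `|U1_val z * U1_val w| == 1.
Proof. by rewrite normrM (eqP (U1_norm z)) (eqP (U1_norm w)) mulr1. Qed.

Lemma U1_inv_norm (z : U1) : `|(U1_val z)^-1| == 1.
Proof. by rewrite normfV (eqP (U1_norm z)) invr1. Qed.

Definition U1_one := MkU1 U1_one_norm.
Definition U1_mul z w := MkU1 (U1_mul_norm z w).
Definition U1_inv z := MkU1 (U1_inv_norm z).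

Lemma U1_mulA : associative U1_mul.
Proof. by move=> x y z; apply/val_inj/mulrA. Qed.

Lemma U1_mul1 : left_id U1_one U1_mul.
Proof. by move=> x; apply/val_inj/mul1r. Qed.

Lemma U1_mulr1 : right_id U1_one U1_mul.
Proof. by move=> x; apply/val_inj/mulr1. Qed.

Lemma U1_unit (z : U1) : U1_val z != 0.
Proof. by rewrite -normr_eq0 (eqP (U1_norm z)) oner_eq0. Qed.

Lemma U1_mulV : left_inverse U1_one U1_inv U1_mul.
Proof. by move=> x; apply/val_inj/mulVf/U1_unit. Qed.

Lemma U1_mulrV : right_inverse U1_one U1_inv U1_mul.
Proof. by move=> x; apply/val_inj/divff/U1_unit. Qed.

HB.instance Definition _ := isGroup.Build U1
  U1_mulA U1_mul1 U1_mulr1 U1_mulV U1_mulrV.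

Lemma U1_exp_norm (t : R) : `|cos t +i* sin t| == 1.
Proof. by rewrite normc_def/= cos2Dsin2 sqrtr1. Qed.

Definition U1_exp (t : R) : U1 := MkU1 (U1_exp_norm t).

Definition U1_atlas : atlas R^o U1 :=
  [set Chart `]t - pi, t + pi[ U1_exp | t in setT].

End UnitaryGroup.
Arguments U1_atlas R : clear implicits.

Definition fun_group (S : Type) (G : groupType) : Type := S -> G.

Section FunGroup.
Variables (S : Type) (G : groupType).
Implicit Types f g : fun_group S G.

HB.instance Definition _ := Choice.copy (fun_group S G) (S -> G).

Definition fun_one : fun_group S G := fun=> 1%g.
Definition fun_inv f : fun_group S G := fun s => (f s)^-1%g.
Definition fun_mul f g : fun_group S G := fun s => (f s * g s)%g.

Lemma fun_mulA : associative fun_mul.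
Proof. by move=> f g h; apply/funext => s; exact: mulgA. Qed.

Lemma fun_mul1 : left_id fun_one fun_mul.
Proof. by move=> f; apply/funext => s; exact: mul1g. Qed.

Lemma fun_mulr1 : right_id fun_one fun_mul.
Proof. by move=> f; apply/funext => s; exact: mulg1. Qed.

Lemma fun_mulV : left_inverse fun_one fun_inv fun_mul.
Proof. by move=> f; apply/funext => s; exact: mulVg. Qed.

Lemma fun_mulrV : right_inverse fun_one fun_inv fun_mul.
Proof. by move=> f; apply/funext => s; exact: mulgV. Qed.

HB.instance Definition _ := isGroup.Build (fun_group S G)
  fun_mulA fun_mul1 fun_mulr1 fun_mulV fun_mulrV.

End FunGroup.

Section Circle.
Variable R : realType.

Definition circle_rel (x y : R) : bool := (x - y) / (2 * pi) \is a Num.int.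

Lemma circle_rel_equiv : equiv_class_of circle_rel.
Proof.
split=> [x|x y|y x z]; rewrite /circle_rel ?subrr ?mul0r ?rpred0//.
  by rewrite -opprB mulNr rpredN.
by move=> xy yz; rewrite -(subrK y x) -addrA mulrDl rpredD.
Qed.

Canonical circle_equiv := EquivRelPack circle_rel_equiv.

Definition circle := {eq_quot circle_equiv}.
HB.instance Definition _ := Quotient.on circle.
HB.instance Definition _ := Choice.on circle.

Definition circle_proj (t : R) : circle := \pi_circle t.

Lemma circle_projE (x y : R) :
  circle_proj x = circle_proj y <-> (x - y) / (2 * pi) \is a Num.int.
Proof. by split=> [/eqP|h]; [|apply/eqP]; rewrite /circle_proj eqmodE. Qed.

Lemma circle_proj_surj (z : circle) : exists t, circle_proj t = z.
Proof. by exists (repr z); rewrite /circle_proj reprK. Qed.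

End Circle.

(* C^oo(S^1, V), with the topology of uniform convergence of all derivatives. *)
Section SmoothFunctionSpace.
Variables (R : realType) (V : normedModType R).
Implicit Types f g : circle R -> V.

Definition circle_deriv (k : nat) f : R -> V :=
  derive1n k (f \o @circle_proj R).

Definition circle_smooth : {pred circle R -> V} :=
  fun f => `[< forall k t, derivable (circle_deriv k f) t 1 >].

Lemma circle_smoothP f :
  reflect (forall k t, derivable (circle_deriv k f) t 1) (f \in circle_smooth).
Proof. exact: asboolP. Qed.

Lemma circle_derivS k f t : circle_deriv k.+1 f t = 'D_1 (circle_deriv k f) t.
Proof. by rewrite /circle_deriv derive1nS derive1E. Qed.

Lemma circle_deriv0 k : circle_deriv k 0 = 0.
Proof.
elim: k => [//|k ih]; apply/funext => t.
by rewrite circle_derivS ih (_ : 0 = cst 0)// derive_cst.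
Qed.

Lemma circle_derivP (a : R) f g : f \in circle_smooth -> g \in circle_smooth ->
  forall k, circle_deriv k (a *: f + g) = a *: circle_deriv k f + circle_deriv k g.
Proof.
move=> /circle_smoothP sf /circle_smoothP sg; elim=> [//|k ih].
apply/funext => t; rewrite circle_derivS ih.
rewrite deriveD ?deriveZ//; last exact/derivableZ/sf.
by rewrite fctE -!circle_derivS.
Qed.

Lemma circle_smooth_submod : submod_closed circle_smooth.
Proof.
split=> [|a f g sf sg]; apply/circle_smoothP => k t.
  by rewrite circle_deriv0; exact: derivable_cst.
rewrite circle_derivP//; apply: derivableD; last exact/circle_smoothP.
exact/derivableZ/circle_smoothP.
Qed.

HB.instance Definition _ :=
  GRing.isSubmodClosed.Build R (circle R -> V) circle_smooth circle_smooth_submod.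

Record smooth_space := SmoothSpace {
  smooth_fun :> circle R -> V;
  smooth_funP : smooth_fun \in circle_smooth }.

HB.instance Definition _ := [isSub for smooth_fun].
HB.instance Definition _ := [Choice of smooth_space by <:].
HB.instance Definition _ := [SubChoice_isSubLmodule of smooth_space by <:].

Implicit Types u v w : smooth_space.

Definition smooth_ball u (k : nat) (e : R) : set smooth_space :=
  [set v | forall j t, (j <= k)%N ->
    `|circle_deriv j v t - circle_deriv j u t| < e].

Definition smooth_nbhs u : set_system smooth_space :=
  [set A | exists k e, 0 < e /\ smooth_ball u k e `<=` A].

HB.instance Definition _ := hasNbhs.Build smooth_space smooth_nbhs.

Lemma smooth_ball_center u k e : 0 < e -> smooth_ball u k e u.
Proof. by move=> e0 j t _; rewrite subrr normr0. Qed.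

Lemma smooth_nbhs_filter u : ProperFilter (nbhs u).
Proof.
split.
  by move=> [k [e [e0 /(_ u)]]]; apply; exact: smooth_ball_center.
split.
- by exists 0%N, 1; split.
- move=> A B [k [e [e0 sA]]] [l [d [d0 sB]]].
  exists (maxn k l), (Num.min e d); rewrite lt_min e0; split=> // v uv.
  split; [apply: sA|apply: sB] => j t jk.
    by have := uv j t; rewrite leq_max jk lt_min => /(_ isT)/andP[].
  by have := uv j t; rewrite leq_max jk orbT lt_min => /(_ isT)/andP[].
- by move=> A B AB [k [e [e0 sA]]]; exists k, e; split=> // v /sA/AB.
Qed.

Lemma smooth_nbhs_singleton u (A : set smooth_space) : nbhs u A -> A u.
Proof. by move=> [k [e [e0]]]; apply; exact: smooth_ball_center. Qed.

Lemma smooth_nbhs_nbhs u (A : set smooth_space) :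
  nbhs u A -> nbhs u (nbhs^~ A).
Proof.
move=> [k [e [e0 sA]]]; exists k, (e / 2); split; first by rewrite divr_gt0.
move=> v uv; exists k, (e / 2); split; first by rewrite divr_gt0.
move=> w vw; apply: sA => j t jk; rewrite (splitr e).
rewrite -(subrK (circle_deriv j v t) (circle_deriv j w t)) -addrA.
by rewrite (le_lt_trans (ler_normD _ _))// ltrD ?uv ?vw.
Qed.

HB.instance Definition _ := Nbhs_isNbhsTopological.Build smooth_space
  smooth_nbhs_filter smooth_nbhs_singleton smooth_nbhs_nbhs.

Lemma smooth_derivP (a : R) u v k t : circle_deriv k (a *: u + v) t =
  a *: circle_deriv k u t + circle_deriv k v t.
Proof. by rewrite [circle_deriv _ _]circle_derivP//; exact: smooth_funP. Qed.

Lemma smooth_derivD u v k t :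
  circle_deriv k (u + v) t = circle_deriv k u t + circle_deriv k v t.
Proof. by rewrite -[u]scale1r smooth_derivP !scale1r. Qed.

Lemma smooth_derivZ (a : R) u k t :
  circle_deriv k (a *: u) t = a *: circle_deriv k u t.
Proof. by rewrite -[a *: u]addr0 smooth_derivP circle_deriv0 addr0. Qed.

Lemma smooth_add_continuous :
  continuous (fun x : smooth_space * smooth_space => x.1 + x.2).
Proof.
move=> [u v] A [k [e [e0 sA]]].
exists (smooth_ball u k (e / 2), smooth_ball v k (e / 2)).
  by split; exists k, (e / 2); split=> //; rewrite divr_gt0.
move=> [u' v'] [/= uu vv]; apply: sA => j t jk.
rewrite !smooth_derivD opprD addrACA (splitr e).
by rewrite (le_lt_trans (ler_normD _ _))// ltrD ?uu ?vv.
Qed.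

Lemma circle_deriv_periodic f k (t : R) (m : int) :
  circle_deriv k f (t + m%:~R * (2 * pi)) = circle_deriv k f t.
Proof.
elim: k t => [|k ih] t.
  have -> : circle_deriv 0 f = f \o @circle_proj R by [].
  rewrite /= (_ : circle_proj _ = circle_proj t)//; apply/circle_projE.
  by rewrite addrC addrA addNr add0r mulfK// mulf_neq0// gt_eqF// pi_gt0.
rewrite !circle_derivS /derive (_ : (fun h => _) =
  fun h => h^-1 *: ((circle_deriv k f \o shift t) (h *: 1) - circle_deriv k f t))//.
by apply/funext => h; rewrite ih /= addrA ih.
Qed.

Lemma smooth_deriv_bounded u k :
  exists2 M : R, 0 <= M & forall j t, (j <= k)%N -> `|circle_deriv j u t| <= M.
Proof.
have bj j : exists2 M : R, 0 <= M & forall t, `|circle_deriv j u t| <= M.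
  have p0 : 0 < 2 * pi :> R by rewrite mulr_gt0// pi_gt0.
  have cu : {within `[0, 2 * pi], continuous (fun t => `|circle_deriv j u t|)}.
    apply: continuous_subspaceT => t; apply: continuous_comp; last first.
      exact: norm_continuous.
    apply/differentiable_continuous/derivable1_diffP.
    exact/circle_smoothP/smooth_funP.
  have [c _ cM] := EVT_max (ltW p0) cu.
  exists `|circle_deriv j u c|; first exact: normr_ge0.
  move=> t; pose m := Num.floor (t / (2 * pi)).
  rewrite -(circle_deriv_periodic _ _ _ (- m)); apply: cM.
  rewrite in_itv/= mulrNz mulNr subr_ge0 -ler_pdivlMr// ge_floor/=.
  rewrite lerBlDr -[X in X + _]mul1r -mulrDl -ler_pdivrMr// addrC.
  by rewrite -[1]/(1%:~R) -intrD ltW// floorD1_gt.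
elim: k => [|k [M M0 hM]].
  by have [M M0 hM] := bj 0%N; exists M => // -[|j] t.
have [N N0 hN] := bj k.+1; exists (Num.max M N); first by rewrite le_max M0.
move=> j t; rewrite leq_eqVlt ltnS => /orP[/eqP ->|jk].
  by rewrite le_max hN orbT.
by rewrite le_max hM.
Qed.

Lemma smooth_scale_continuous :
  continuous (fun z : R^o * smooth_space => z.1 *: z.2).
Proof.
move=> [a u] A [k [e [e0 sA]]].
have [M M0 hM] := smooth_deriv_bounded u k.
pose d := Num.min 1 (e / 2 / (M + 1)).
have d0 : 0 < d by rewrite lt_min ltr01/= !divr_gt0// ltr_wpDl.
have b0 : 0 < `|a| + 1 by rewrite ltr_wpDl.
exists (ball (a : R^o) d, smooth_ball u k (e / 2 / (`|a| + 1))).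
  split; first exact: nbhsx_ballx.
  by exists k, (e / 2 / (`|a| + 1)); split=> //; rewrite !divr_gt0.
move=> [b v] [/= ab uv]; apply: sA => j t jk; rewrite !smooth_derivZ.
have {}ab : `|b - a| < d by rewrite distrC.
have b1 : `|b| < `|a| + 1.
  rewrite -(subrK a b) (le_lt_trans (ler_normD _ _))// addrC ltrD2l.
  by rewrite (lt_le_trans ab)// ge_min lexx.
rewrite (_ : _ - _ = b *: (circle_deriv j v t - circle_deriv j u t) +
    (b - a) *: circle_deriv j u t); last first.
  by rewrite scalerBr scalerBl addrA subrK.
rewrite (le_lt_trans (ler_normD _ _))// (splitr e) !normrZ ltr_leD//.
  rewrite (@le_lt_trans _ _ ((`|a| + 1) *
    `|circle_deriv j v t - circle_deriv j u t|))//.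
    by rewrite ler_wpM2r// ltW.
  by rewrite mulrC -ltr_pdivlMr// uv.
rewrite (@le_trans _ _ (d * M))//.
  by rewrite ler_pM// ?hM// ltW.
rewrite (@le_trans _ _ (d * (M + 1)))//.
  by apply: ler_wpM2l; [exact: ltW|rewrite lerDl].
by rewrite -ler_pdivlMr ?ltr_wpDl// ge_min lexx orbT.
Qed.

Lemma smooth_locally_convex : exists2 B : set_system smooth_space,
  (forall b, b \in B -> convex_set b) & basis B.
Proof.
exists [set b | open b /\ convex_set b].
  by move=> b /[!inE] -[].
split=> [b []//|u A [k [e [e0 sA]]]].
pose b := [set v : smooth_space | exists2 d, d < e & forall j t, (j <= k)%N ->
    `|circle_deriv j v t - circle_deriv j u t| <= d].
exists b; last first.
  by move=> v [d de vd]; apply: sA => j t jk; rewrite (le_lt_trans (vd _ _ _)).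
split; last by exists 0 => // j t _; rewrite subrr normr0.
split.
  rewrite openE => v [d de vd]; exists k, ((e - d) / 2).
  split; first by rewrite divr_gt0// subr_gt0.
  move=> w vw; exists (d + (e - d) / 2).
    by rewrite -ltrBrDl ltr_pdivrMr// mulr2n mulrDr mulr1 ltrDl subr_gt0.
  move=> j t jk; rewrite -(subrK (circle_deriv j v t) (circle_deriv j w t)).
  rewrite -addrA (le_trans (ler_normD _ _))// [leRHS]addrC.
  by apply: lerD; [exact/ltW/vw|exact: vd].
move=> v w l /[!inE] -[d de vd] [c ce wc].
exists (Num.max d c); first by rewrite gt_max de.
move=> j t jk; rewrite [circle_deriv j _ t](_ : _ =
  circle_deriv j (l%:num *: v + (1 - l%:num) *: w : smooth_space) t)//.
rewrite smooth_derivP smooth_derivZ.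
set x := circle_deriv j v t; set y := circle_deriv j w t.
set z := circle_deriv j u t.
rewrite (_ : _ - z = l%:num *: (x - z) + (1 - l%:num) *: (y - z)); last first.
  rewrite !scalerBr addrACA -opprD -scalerDl.
  by rewrite addrCA subrr addr0 scale1r.
rewrite (le_trans (ler_normD _ _))// !normrZ.
have l1 : 0 <= 1 - l%:num by rewrite subr_ge0.
rewrite (ger0_norm l1) (@ger0_norm _ l%:num)//.
have -> : Num.max d c = l%:num * Num.max d c + (1 - l%:num) * Num.max d c.
  by rewrite -mulrDl addrCA subrr addr0 mul1r.
by apply: lerD; apply: ler_wpM2l; rewrite // le_max ?vd ?wc ?orbT.
Qed.

(* provides only the uniform structure *)
HB.instance Definition _ := PreTopologicalLmod_isTvs.Build R smooth_space
  smooth_add_continuous smooth_scale_continuous smooth_locally_convex.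
HB.instance Definition _ := PreTopologicalNmodule_isTopologicalNmodule.Build
  smooth_space smooth_add_continuous.
HB.instance Definition _ := TopologicalNmodule_isTopologicalLmodule.Build
  R smooth_space smooth_scale_continuous.
HB.instance Definition _ :=
  Uniform_isTvs.Build R smooth_space smooth_locally_convex.

End SmoothFunctionSpace.
Arguments smooth_space {R} V.

(* LG is the subgroup [loops] of the group of all maps S^1 -> G, with the atlas
   [loop_atlas] modelled on C^oo(S^1, R^n): a chart c of G at e gives around the
   loop g0 the chart whose inverse sends f to the loop t |-> g0 t * c (f t). *)
Section LoopGroup.
Variables (R : realType) (n : nat) (G : lieGroup 'rV[R]_n).

Definition loops : set (fun_group (circle R) G) :=
  [set g : circle R -> G |
    smooth_map (line_atlas R) (lie_atlas G) (g \o @circle_proj R)].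

Definition loop_chart (g0 : fun_group (circle R) G) (c : chart 'rV[R]_n G) :
    chart (smooth_space 'rV[R]_n) (fun_group (circle R) G) :=
  Chart [set f : smooth_space 'rV[R]_n | forall t, chart_dom c (f t)]
        (fun f t => g0 t * c (f t))%g.

Definition loop_atlas :
    atlas (smooth_space 'rV[R]_n) (fun_group (circle R) G) :=
  [set loop_chart g0 c | g0 in loops &
                         c in lie_atlas G `&` [set c | chart_cod c 1%g]].

Definition loops_in (I : set (circle R)) : set (fun_group (circle R) G) :=
  loops `&` [set g : circle R -> G | forall t, ~ I t -> g t = 1%g].

End LoopGroup.
Arguments loops {R n} G.
Arguments loop_atlas {R n} G.
Arguments loops_in {R n} G I.

(* Central extension 1 -> U(1) -> H -> X -> 1 of the Lie group X, given as a
   subgroup of an ambient group K together with an atlas B. *)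
Record central_extension (R : realType) (E F : tvsType R) (K : groupType)
    (X : set K) (B : atlas E K) (H : lieGroup F)
    (i : {multiplicative U1 R -> H}) (p : {multiplicative H -> K}) : Prop :=
  CentralExtension {
  ext_incl_smooth : smooth_map (U1_atlas R) (lie_atlas H) i;
  ext_proj_smooth : smooth_map (lie_atlas H) B p;
  ext_incl_inj : injective i;
  ext_exact : [set h | p h = 1%g] = range i;
  ext_proj_range : range p = X;
  ext_central : forall z h, (i z * h = h * i z)%g;
  ext_loc_trivial : forall q, X q -> exists W : set (mfd B),
    [/\ open W, W q, W `<=` X &
        exists (s : K * U1 R -> H) (r : H -> K * U1 R),
          [/\ smooth_on (prod_atlas B (U1_atlas R)) (lie_atlas H)
                (W `*` setT) s,
              smooth_on (lie_atlas H) (prod_atlas B (U1_atlas R))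
                (p @^-1` W) r,
              forall x z, W x -> r (s (x, z)) = (x, z) /\ p (s (x, z)) = x,
              forall h, W (p h) -> s (r h) = h &
              forall x z w, W x -> s (x, z * w)%g = (s (x, z) * i w)%g]] }.

Definition disjoint_commutative (R : realType) (n : nat) (G : lieGroup 'rV[R]_n)
    (H : groupType) (p : H -> fun_group (circle R) G) : Prop :=
  forall I J : set (circle R), I `&` J = set0 ->
    forall h k, (p @^-1` loops_in G I) h -> (p @^-1` loops_in G J) k ->
      (h * k = k * h)%g.

(* Main.v *)
(** Let g and q be loops with disjoint supports, V the open set of parameters t
    with q t <> 1 and k a lift of q; we may assume that V is not empty. Call a loop
    good when its lifts commute with k. As U(1) is central, good loops form a group,
    which contains the commutators of any two loops commuting with q, in particular
    of any two loops that are trivial on V. By local triviality and the Hausdorff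
    property the good loops are closed under smooth limits in a chart.

    A semisimple Lie algebra is perfect, so every tangent vector at 1 is a sum of
    vectors Ad(a) Y - Y, with a as close to 1 as desired. By the inverse function
    theorem the elements x near 1 are products of commutators [a_j, y_j(x)] with
    constant a_j and with y_j smooth and y_j(1) = 1. Hence a loop with values near 1
    that is supported in an interval disjoint from V is good: after an approximation
    its support is compact in that interval, and there each a_j is the value of a
    loop with support in the interval. A null homotopy, cut into thin strips, removes
    the restriction to values near 1. Finally g, being trivial on V, is the limit of
    its restrictions to finitely many components of the complement of V. *)
Require Import Defs.
From HB Require Import structures.
From mathcomp Require Import all_boot all_order all_algebra.
From mathcomp Require Import complex ring lra.
From mathcomp Require Import all_classical all_reals all_analysis.
Set Implicit Arguments.
Unset Strict Implicit.
Unset Printing Implicit Defensive.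
Import Order.TTheory GRing.Theory Num.Theory.
Import numFieldNormedType.Exports.
Local Open Scope classical_set_scope.
Local Open Scope ring_scope.

(** * Semisimple Lie algebras are perfect *)

(** Why commutators: if g commutes with q, the commutator of a lift of g with a lift of q is an
    element of U(1) that does not depend on the lifts and is multiplicative in g. It is therefore 1
    on every product of commutators taken in the centralizer of q, and g has to be reached by such
    products and by limits. Two obstacles shape the proof. The supports are arbitrary disjoint sets:
    their closures may meet, and the complement of V may have infinitely many components. What helps
    is that V is open and g = 1 on it, so that g, read in a chart at 1, vanishes to infinite order
    on the closure of V; this makes it smooth to replace g by 1 on some components. Secondly, a
    factorization of group elements has to become one of loops that are trivial on V. This is why
    one entry of each commutator is constant: a cutoff that equals 1 on the support of the other
    entry changes nothing. Semisimplicity is given as the absence of nonzero solvable ideals;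
    perfectness is extracted from it by the trace argument of Cartan's criterion. *)

Section ConjugatePolynomial.
Variable C : numClosedFieldType.

Lemma trig_mulmx n (A B : 'M[C]_n) : is_trig_mx A -> is_trig_mx B ->
  is_trig_mx (A *m B) /\ forall i, (A *m B) i i = A i i * B i i.
Proof.
move=> /is_trig_mxP tA /is_trig_mxP tB; split.
  apply/is_trig_mxP => i j ij; rewrite mxE big1// => k _.
  have [ik|ki] := ltnP i k; first by rewrite tA ?mul0r.
  by rewrite tB ?mulr0// (leq_ltn_trans ki).
move=> i; rewrite mxE (bigD1 i)//= big1 ?addr0// => k ki.
have [ik|ki'] := ltnP i k; first by rewrite tA ?mul0r.
by rewrite tB ?mulr0// ltn_neqAle ki.
Qed.

Lemma trig_horner_mx n (A : 'M[C]_n.+1) (p : {poly C}) : is_trig_mx A ->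
  is_trig_mx (horner_mx A p) /\ forall i, horner_mx A p i i = p.[A i i].
Proof.
move=> tA; elim/poly_ind: p => [|p c [tp dp]].
  rewrite rmorph0; split=> [|i]; last by rewrite mxE horner0.
  by apply/is_trig_mxP => i j _; rewrite mxE.
have [tm dm] := trig_mulmx tp tA.
rewrite rmorphD rmorphM/= horner_mx_X horner_mx_C; split=> [|i]; last first.
  by rewrite mxE -[_ * A]/(_ *m A) dm dp hornerMXaddC mxE eqxx.
apply/is_trig_mxP => i j ij; rewrite mxE [X in _ + X]mxE.
move/is_trig_mxP : tm => /(_ _ _ ij) ->.
by rewrite -val_eqE/= ltn_eqF// mulr0n addr0.
Qed.

(** Evaluated at a matrix with eigenvalues in [L] and multiplicities at most [N], such a [p] acts on
    the generalized eigenspace of a as the scalar conjugate to a. It is the Chinese remainder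
    theorem, by induction on [L]. *)
Lemma crt_conj (N : nat) (L : seq C) : exists p : {poly C},
  forall a, a \in L -> ('X - a%:P) ^+ N %| p - (a^*)%:P.
Proof.
elim: L => [|b L [p hp]]; first by exists 0.
have [bL|bL] := boolP (b \in L).
  by exists p => a; rewrite inE => /predU1P[->|]; exact: hp.
pose q := \prod_(a <- L) ('X - a%:P) ^+ N.
have cop : coprimep (('X - b%:P) ^+ N) q.
  rewrite coprimep_expl// /q big_seq.
  elim/big_ind : _ => [|u v hu hv|a aL]; first exact: coprimep1.
    by rewrite coprimepMr hu.
  rewrite coprimep_expr// coprimep_XsubC root_XsubC.
  by apply: contraNneq bL => <-.
have [[u v] /= uv] := Bezout_eq1_coprimepP _ _ cop.
have {uv} uv : u * ('X - b%:P) ^+ N + v * q = 1 by [].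
(* The multiplier of [p] is 1 modulo [q] and 0 modulo the power of 'X - b; the other multiplier
   behaves the opposite way. *)
exists (p * (u * ('X - b%:P) ^+ N) + (b^*)%:P * (v * q)) => a.
rewrite inE => /predU1P[->|aL].
  rewrite (_ : _ - (b^*)%:P = (p - (b^*)%:P) * (u * ('X - b%:P) ^+ N)).
    by rewrite mulrA dvdp_mulIr.
  have -> : v * q = 1 - u * ('X - b%:P) ^+ N by rewrite -uv addrAC subrr add0r.
  by rewrite mulrBr mulr1 mulrBl; ring.
rewrite (_ : _ - (a^*)%:P = (p - (a^*)%:P) + ((b^*)%:P - p) * (v * q)).
  rewrite dvdp_add ?hp//; apply/dvdp_mull/dvdp_mull.
  by rewrite /q (big_rem a)//= dvdp_mulIl.
have -> : u * ('X - b%:P) ^+ N = 1 - v * q by rewrite -uv addrK.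
by rewrite mulrBr mulr1; ring.
Qed.

(** After a Schur triangularization the trace of A p(A) is the sum of the squared moduli of the
    eigenvalues. If it is 0, all eigenvalues vanish and the Cayley-Hamilton theorem gives
    nilpotency. *)
Lemma schur_conj n (A : 'M[C]_n.+1) : exists L : seq C,
  horner_mx A (\prod_(a <- L) ('X - a%:P)) = 0 /\
  forall p : {poly C}, (forall a, a \in L -> p.[a] = a^*) ->
    \tr (A *m horner_mx A p) = 0 -> horner_mx A ('X ^+ n.+1) = 0.
Proof.
have [P Pu tP] := Schur A (ltn0Sn n).
have uP : P \in unitmx by exact: unitarymx_unit.
have {tP} tT : is_trig_mx (P *m A *m invmx P).
  by move: tP; rewrite /similar_to /= conjumx.
set T := P *m A *m invmx P in tT.
have hA q : horner_mx A q = invmx P *m horner_mx T q *m P.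
  by rewrite horner_mx_uconj// !mulmxA mulVmx// mul1mx mulmxKV.
have cT := char_poly_trig tT.
have hT0 : horner_mx T (\prod_(i < n.+1) ('X - (T i i)%:P)) = 0.
  by rewrite -cT; exact: Cayley_Hamilton.
exists [seq T i i | i <- enum 'I_n.+1]; split.
  by rewrite big_map big_enum/= hA hT0 mulmx0 mul0mx.
move=> p hp.
have -> : A *m horner_mx A p = horner_mx A ('X * p).
  by rewrite rmorphM/= horner_mx_X.
rewrite hA -mulmxA mxtrace_mulC mulmxK// => tr0.
have z i : T i i = 0.
  have [_ dT] := trig_horner_mx ('X * p) tT.
  move: tr0; rewrite /mxtrace (eq_bigr (fun j => T j j * (T j j)^*)); last first.
    by move=> j _; rewrite dT hornerM hornerX hp// (map_f (fun i => T i i)) ?mem_enum.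
  move=> /eqP; rewrite psumr_eq0; last by move=> j _; exact: mul_conjC_ge0.
  by move=> /allP/(_ i); rewrite mem_index_enum => /(_ isT); rewrite mul_conjC_eq0 => /eqP.
rewrite hA (_ : 'X ^+ n.+1 = \prod_(i < n.+1) ('X - (T i i)%:P)).
  by rewrite hT0 mulmx0 mul0mx.
under eq_bigr do rewrite z subr0.
by rewrite prodr_const card_ord.
Qed.

End ConjugatePolynomial.

Lemma mulmx_rVP (K : nzRingType) (m k : nat) (X Y : 'M[K]_(m, k)) :
  (forall v : 'rV_m, v *m X = v *m Y) -> X = Y.
Proof.
by move=> XY; apply/row_matrixP => i; rewrite -[X]mul1mx -[Y]mul1mx !row_mul XY.
Qed.

Section SemisimplePart.
Variables (C : numClosedFieldType) (n : nat) (A : 'M[C]_n.+1).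

(** The primary decomposition in the form of an induction principle: a Bezout identity splits [u]
    into a part killed by the first factor and a part killed by the product of the others. *)
Lemma generalized_eigenvector_ind (Q : 'rV[C]_n.+1 -> Prop) (s : seq C) (e : C -> nat) :
  Q 0 -> (forall u v, Q u -> Q v -> Q (u + v)) ->
  (forall a u, a \in s -> u *m horner_mx A (('X - a%:P) ^+ e a) = 0 -> Q u) ->
  uniq s ->
  forall u, u *m horner_mx A (\prod_(a <- s) ('X - a%:P) ^+ e a) = 0 -> Q u.
Proof.
move=> Q0 QD; elim: s => [|b s ih] Qs.
  by move=> _ u; rewrite big_nil rmorph1 mulmx1 => ->.
move=> /= /andP[bs us] u; rewrite big_cons => u0.
have [] : exists w, w.1 * ('X - b%:P) ^+ e b +
    w.2 * (\prod_(a <- s) ('X - a%:P) ^+ e a) = 1 :> {poly C}.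
  apply/Bezout_eq1_coprimepP/coprimep_expl; rewrite big_seq.
  elim/big_ind : _ => [|x y hx hy|a aL]; first exact: coprimep1.
    by rewrite coprimepMr hx.
  rewrite coprimep_expr// coprimep_XsubC root_XsubC.
  by apply: contraNneq bs => <-.
move=> -[x y] /=; set f := (_ ^+ _); set g := \prod_(_ <- _) _ => xy.
have <- : u *m horner_mx A (x * f) + u *m horner_mx A (y * g) = u.
  by rewrite -mulmxDr -rmorphD/= xy rmorph1 mulmx1.
have km (p q r : {poly C}) : p * q = f * g * r ->
    u *m horner_mx A p *m horner_mx A q = 0.
  move=> pq; rewrite -mulmxA -[_ *m horner_mx A q]/(_ * _) -rmorphM/= pq rmorphM/=.
  by rewrite -[_ * _]/(_ *m _) mulmxA u0 mul0mx.
apply: QD.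
  have u1 : u *m horner_mx A (x * f) *m horner_mx A g = 0.
    apply: (km _ _ x). by rewrite [RHS]mulrC mulrA.
  apply: (ih _ us _ u1).
  by move=> a v as_; apply: Qs; rewrite inE as_ orbT.
by apply: (Qs b); [rewrite inE eqxx|apply: (km _ _ y); rewrite [RHS]mulrC [f * g]mulrC mulrA].
Qed.

Variable ad : {linear 'rV[C]_n.+1 -> 'M[C]_n.+1}.
Hypothesis adA : forall u, ad (u *m A) = ad u *m A - A *m ad u.

(** Weights of a derivation add under the bracket: A - (a + b) turns the bracket of u and v into
    that of (A - a) u and v plus that of u and (A - b) v, and both summands have a smaller exponent
    sum. *)
Lemma ad_generalized_eigenvector a b i j (u v : 'rV[C]_n.+1) :
  u *m horner_mx A (('X - a%:P) ^+ i) = 0 ->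
  v *m horner_mx A (('X - b%:P) ^+ j) = 0 ->
  v *m ad u *m horner_mx A (('X - (a + b)%:P) ^+ (i + j)) = 0.
Proof.
have hX (c : C) : horner_mx A ('X - c%:P) = A - c%:M.
  by rewrite rmorphB/= horner_mx_X horner_mx_C.
have hS (c : C) k (w : 'rV[C]_n.+1) : w *m horner_mx A (('X - c%:P) ^+ k.+1) =
    (w *m (A - c%:M)) *m horner_mx A (('X - c%:P) ^+ k).
  by rewrite exprS rmorphM/= hX mulmxA.
have [m] := ubnP (i + j); elim: m i j u v => // m ih [|i] j u v; rewrite ltnS => ijm.
  by rewrite expr0 rmorph1 mulmx1 => -> _; rewrite linear0 mulmx0 mul0mx.
case: j ijm => [|j] ijm hu.
  by rewrite expr0 rmorph1 mulmx1 => ->; rewrite !mul0mx.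
move=> hv.
have ih1 := ih i j.+1 (u *m (A - a%:M)) v ijm.
have {}ih1 := ih1 (etrans (esym (hS _ _ _)) hu) hv.
have ijm' : (i.+1 + j < m)%N by rewrite addSn -addnS.
have {ih} := ih i.+1 j u (v *m (A - b%:M)) ijm'.
move=> /(_ hu (etrans (esym (hS _ _ _)) hv)) ih2.
rewrite addSn hS; move: ih1 ih2; rewrite addSn -addnS => ih1 ih2.
rewrite (_ : v *m _ *m _ = v *m ad (u *m (A - a%:M)) + v *m (A - b%:M) *m ad u).
  by rewrite mulmxDl ih1 ih2 addr0.
rewrite !mulmxBr !mulmxBl !mul_mx_scalar linearB linearZ/= adA !mulmxBr.
rewrite !linearZ/= -scalemxAl scalerN scalerDl !mulmxA opprD.
by rewrite scalerN [RHS]addrACA subrK.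
Qed.

(* [E] is the complex conjugate of the semisimple part of the derivation [A]. *)
Lemma conj_semisimple_part : exists E : 'M[C]_n.+1,
  [/\ forall u, ad (u *m E) = ad u *m E - E *m ad u,
      exists r, E = r *m A &
      \tr (A *m E) = 0 -> horner_mx A ('X ^+ n.+1) = 0].
Proof.
have [L [hL hLp]] := schur_conj A.
(* Brackets of generalized eigenvectors have weights a + b and exponents up to twice [size L]. The
   weight 0 is added to the list to make [p] divisible by 'X, hence [E] a multiple of [A]; the
   successor keeps [N] positive. *)
pose N := (size L + size L).+1.
have [p hp] := crt_conj N (0 :: [seq a + b | a <- L, b <- L] ++ L).
have L1 : {subset L <= 0 :: [seq a + b | a <- L, b <- L] ++ L}.
  by move=> a aL; rewrite inE mem_cat aL !orbT.
have L2 a b : a \in L -> b \in L ->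
    a + b \in 0 :: [seq a + b | a <- L, b <- L] ++ L.
  by move=> aL bL; rewrite inE mem_cat allpairs_f ?orbT.
pose E := horner_mx A p; exists E.
have eigE (a : C) k (w : 'rV[C]_n.+1) : a \in 0 :: [seq a + b | a <- L, b <- L] ++ L -> (k <= N)%N ->
    w *m horner_mx A (('X - a%:P) ^+ k) = 0 -> w *m E = a^* *: w.
  move=> aL kN w0; have /dvdpP[q pq] := hp _ aL.
  rewrite /E (_ : p = ('X - a%:P) ^+ k * (('X - a%:P) ^+ (N - k) * q) + (a^*)%:P).
    by rewrite rmorphD rmorphM/= mulmxDr mulmxA w0 mul0mx add0r horner_mx_C mul_mx_scalar.
  by rewrite mulrA -exprD subnKC// mulrC -pq subrK.
have ind (Q : 'rV[C]_n.+1 -> Prop) : Q 0 -> (forall u v, Q u -> Q v -> Q (u + v)) ->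
    (forall (a : C) k u, a \in L -> (k <= size L)%N ->
      u *m horner_mx A (('X - a%:P) ^+ k) = 0 -> Q u) -> forall u, Q u.
  move=> Q0 QD Qe u.
  apply: (@generalized_eigenvector_ind Q (undup L) (fun a => count_mem a L)) => //.
  - by move=> a {}u; rewrite mem_undup => aL; apply: Qe => //; exact: count_size.
  - exact: undup_uniq.
  - by rewrite prodr_undup_exp_count hL mulmx0.
split.
- move=> u; apply: mulmx_rVP => v; move: v u.
  apply: (ind _) => [u|v w hv hw u|b j v bL jL hv]; first by rewrite !mul0mx.
    by rewrite !mulmxDl hv hw.
  apply: (ind _) => [|u w hu hw|a i u aL iL hu].
  + by rewrite !(mul0mx, linear0, mulmx0, subr0).
  + rewrite [LHS](_ : _ = v *m ad (u *m E) + v *m ad (w *m E)); last first.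
      by rewrite -mulmxDr -(linearD ad) -mulmxDl.
    rewrite hu hw -mulmxDr; congr (_ *m _).
    by rewrite (linearD ad u w) [(_ + _) *m E]mulmxDl [E *m (_ + _)]mulmxDr opprD addrACA.
  + rewrite (eigE a i u) ?L1// 1?(leq_trans iL) ?leqW ?leq_addr//.
    rewrite mulmxBr [v *m (E *m _)]mulmxA (eigE b j v) ?L1//; last first.
      by rewrite (leq_trans jL) ?leqW ?leq_addr.
    rewrite mulmxA (eigE (a + b) (i + j)%N) ?L2//; last first.
    * exact: ad_generalized_eigenvector.
    * by rewrite leqW// leq_add.
    by rewrite linearZ/= -scalemxAl -scalemxAr -scalerBl rmorphD/= addrK.
- have /dvdpP[q pq] := hp 0 (mem_head _ _).
  move: pq; rewrite !rmorph0 !subr0 => pq.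
  exists (horner_mx A (q * 'X ^+ (size L + size L))).
  by rewrite /E pq -[_ *m A]/(_ * A) -{3}(horner_mx_X A) -rmorphM/= -mulrA -exprSr.
- apply: hLp => a aL; have /dvdpP[q pq] := hp a (L1 _ aL).
  have := congr1 (fun f => f.[a]) pq; rewrite hornerM horner_exp !hornerE subrr.
  by rewrite expr0n/= mulr0 => /eqP; rewrite subr_eq0 => /eqP.
Qed.

End SemisimplePart.

(** The ideals below are described by logical conditions rather than by generators. A subspace of
    maximal dimension among those contained in [P] must absorb every vector that satisfies [P]. *)
Lemma exists_vspace (K : fieldType) (V : vectType K) (P : V -> Prop) :
  P 0 -> (forall a u v, P u -> P v -> P (a *: u + v)) ->
  exists U : {vspace V}, forall v, v \in U <-> P v.
Proof.
move=> P0 PD.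
pose Q (k : nat) : bool := `[< exists U : {vspace V}, \dim U = k /\ forall v, v \in U -> P v >].
have Q0 : Q 0%N.
  by apply/asboolP; exists 0%VS; rewrite dimv0; split=> // v; rewrite memv0 => /eqP ->.
have exQ : exists k, Q k by exists 0%N.
have Qb (k : nat) : Q k -> (k <= \dim {:V})%N.
  by move=> /asboolP[U [<- _]]; exact/dimvS/subvf.
case: (ex_maxnP exQ Qb) => k /asboolP[U [dU UP]] maxk.
exists U => v; split; first exact: UP.
move=> Pv; apply/negPn/negP => vU.
suff /maxk : Q (\dim (U + <[v]>)%VS).
  rewrite leqNgt -dU => /negP; apply.
  rewrite ltnNge; apply: contra vU => le.
  have /eqP -> : (U == U + <[v]>)%VS by rewrite eqEdim addvSl.
  by rewrite (subvP (addvSr _ _))// memv_line.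
apply/asboolP; exists (U + <[v]>)%VS; split=> // w /memv_addP[u uU [_ /vlineP[a ->] ->]].
by rewrite addrC; apply: PD => //; exact: UP.
Qed.

(** * Engel's theorem and Cartan's criterion *)

Section LeibnizAlgebra.
Variables (R : realType) (n : nat) (ad : {linear 'rV[R]_n.+1 -> 'M[R]_n.+1}).
Local Notation V := 'rV[R]_n.+1.
Implicit Types (x y z u v w : V) (U W I : {vspace V}).
(** Matrices act on row vectors from the right: [y *m ad x] stands for the bracket [x, y], and the
    identity says that [ad x] is a derivation. *)
Hypothesis leibniz : forall x y, ad (y *m ad x) = ad y *m ad x - ad x *m ad y.

Hypothesis alternating : forall x, x *m ad x = 0.

Lemma anticomm x y : y *m ad x = - (x *m ad y).
Proof.
apply/eqP; rewrite -addr_eq0; apply/eqP; have := alternating (x + y).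
by rewrite linearD mulmxDl !mulmxDr !alternating add0r addr0 addrC.
Qed.

(* Engel's theorem for the adjoint representation: a maximal subalgebra with the
   fixed-vector property cannot be proper. *)
Lemma engel I : (forall u v, u \in I -> v \in I -> v *m ad u \in I) ->
  (forall u, u \in I -> ad u ^+ n.+1 = 0) ->
  forall U W, (U <= W)%VS -> U != W ->
  (forall u v, u \in I -> v \in U -> v *m ad u \in U) ->
  (forall u v, u \in I -> v \in W -> v *m ad u \in W) ->
  exists w, [/\ w \in W, w \notin U & forall u, u \in I -> w *m ad u \in U].
Proof.
move=> subI nilI.
pose F (M : {vspace V}) := forall U W, (U <= W)%VS -> U != W ->
  (forall u v, u \in M -> v \in U -> v *m ad u \in U) ->
  (forall u v, u \in M -> v \in W -> v *m ad u \in W) ->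
  exists w, [/\ w \in W, w \notin U & forall u, u \in M -> w *m ad u \in U].
pose Q (k : nat) : bool := `[< exists M : {vspace V}, [/\ \dim M = k, (M <= I)%VS,
  forall u v, u \in M -> v \in M -> v *m ad u \in M & F M] >].
have Q0 : Q 0%N.
  apply/asboolP; exists 0%VS; split; rewrite ?dimv0 ?sub0v//.
    by move=> u v _; rewrite !memv0 => /eqP ->; rewrite mul0mx.
  move=> U W UW nUW _ _; have /subvPn[w wW wU] : ~~ (W <= U)%VS.
    by apply: contra nUW => WU; rewrite eqEsubv UW.
  exists w; split=> // u; rewrite memv0 => /eqP ->.
  by rewrite linear0 mulmx0 mem0v.
have exQ : exists k, Q k by exists 0%N.
have Qb (k : nat) : Q k -> (k <= \dim {:V})%N.
  by move=> /asboolP[U [<- _ _ _]]; exact/dimvS/subvf.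
case: (ex_maxnP exQ Qb) => k /asboolP[M [dM MI subM FM]] maxk.
have [<-//|nMI] := eqVneq M I.
have MIs u v : u \in M -> v \in I -> v *m ad u \in I.
  by move=> /(subvP MI); exact: subI.
(* The property of [M], applied to its own action on I / M, gives a vector outside [M] that
   normalizes [M]. *)
have [y [yI yM My]] := FM M I MI nMI subM MIs.
have nil := nilI y yI.
suff /maxk : Q (\dim (M + <[y]>)%VS).
  rewrite leqNgt -dM => /negP; case.
  rewrite ltnNge; apply: contra yM => le.
  have /eqP -> : (M == M + <[y]>)%VS by rewrite eqEdim addvSl.
  by rewrite (subvP (addvSr _ _))// memv_line.
have MyP u : u \in (M + <[y]>)%VS -> exists m a, m \in M /\ u = m + a *: y.
  by move=> /memv_addP[m mM [_ /vlineP[a ->] ->]]; exists m, a.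
have MMy : (M <= M + <[y]>)%VS by exact: addvSl.
have yMy : y \in (M + <[y]>)%VS by rewrite (subvP (addvSr _ _))// memv_line.
apply/asboolP; exists (M + <[y]>)%VS; split=> //.
- by rewrite subv_add MI -memvE.
- move=> _ _ /MyP[m [a [mM ->]]] /MyP[m' [a' [mM' ->]]].
  rewrite linearD linearZ/= mulmxDl !mulmxDr -!scalemxAl -!scalemxAr alternating.
  rewrite !scaler0 addr0 (anticomm y m') scalerN.
  apply: (subvP MMy); apply: rpredD; first apply: rpredB; rewrite ?rpredZ// ?My// ?subM//.
- move=> U W UW nUW Us Ws.
  have Us' u v : u \in M -> v \in U -> v *m ad u \in U.
    by move=> uM; apply: Us; exact: (subvP MMy).
  have Ws' u v : u \in M -> v \in W -> v *m ad u \in W.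
    by move=> uM; apply: Ws; exact: (subvP MMy).
  have [w0 [w0W w0U hw0]] := FM U W UW nUW Us' Ws'.
  (* Since [y] normalizes [M], every [w k] is sent into [U] by [M]. As [ad y] is nilpotent there is
     a last [w k] outside [U], and that one is also sent into [U] by [y]. *)
  pose w k := w0 *m ad y ^+ k.
  have wS j : w j.+1 = w j *m ad y by rewrite /w exprSr -[_ * _]/(_ *m _) mulmxA.
  have wW j : w j \in W.
    by elim: j => [|j ih]; rewrite ?wS; [rewrite /w mulmx1|exact: Ws].
  have wM j u : u \in M -> w j *m ad u \in U.
    elim: j u => [|j ih] u uM; first by rewrite /w mulmx1; exact: hw0.
    have -> : w j.+1 *m ad u = w j *m ad u *m ad y + w j *m ad (y *m ad u).
      by rewrite leibniz mulmxBr !mulmxA wS addrC subrK.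
    by rewrite memvD ?ih ?My// Us// ih.
  have wn : w n.+1 \in U by rewrite /w nil mulmx0 mem0v.
  have w00 : w 0%N \notin U by rewrite /w mulmx1.
  have step m : w m \in U -> exists j, w j \notin U /\ w j.+1 \in U.
    elim: m => [w0U'|j ih wj]; first by rewrite w0U' in w00.
    by have [wj'|wj'] := boolP (w j \in U); [exact: ih|exists j].
  have := step _ wn.
  move=> [j [wj wj1]]; exists (w j); split=> // _ /MyP[m [a [mM ->]]].
  by rewrite linearD linearZ/= mulmxDr memvD ?wM// -scalemxAr memvZ// -wS.
Qed.

Local Notation K := (R[i])%C.
Local Notation cplx := (map_mx (real_complex R)).

(** The complex linear extension of [ad]: the eigenvalue argument of [conj_semisimple_part] needs an
    algebraically closed field. *)
Definition ad_complex (w : 'rV[K]_n.+1) : 'M[K]_n.+1 :=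
  \sum_i w 0 i *: cplx (ad (delta_mx 0 i)).

Lemma ad_complex_is_linear : linear ad_complex.
Proof.
move=> a u v; rewrite /ad_complex scaler_sumr -big_split/=; apply: eq_bigr => i _.
by rewrite !mxE scalerDl scalerA.
Qed.

HB.instance Definition _ := GRing.isLinear.Build K 'rV[K]_n.+1 'M[K]_n.+1 *:%R
  ad_complex ad_complex_is_linear.

Lemma ad_complexE u : ad_complex (cplx u) = cplx (ad u).
Proof.
rewrite {2}[u]row_sum_delta linear_sum raddf_sum; apply: eq_bigr => i _.
by rewrite linearZ/= map_mxZ mxE.
Qed.

Lemma complex_row_ind (Q : 'rV[K]_n.+1 -> Prop) : Q 0 ->
  (forall (a : K) (u v : 'rV[K]_n.+1), Q u -> Q v -> Q (a *: u + v)) ->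
  (forall u, Q (cplx u)) -> forall w : 'rV[K]_n.+1, Q w.
Proof.
move=> Q0 QD Qr w; rewrite [w]row_sum_delta.
elim/big_rec : _ => // i x _ Qx; apply: QD => //.
by rewrite -(map_delta_mx (real_complex R)).
Qed.

Definition killing x y : R := \tr (ad x *m ad y).

Lemma killing_invariant x y z : killing (y *m ad x) z = - killing y (z *m ad x).
Proof.
rewrite /killing !leibniz mulmxBl mulmxBr [in LHS]raddfB [in RHS]raddfB/= opprB !mulmxA.
congr (_ - _).
by rewrite -[in LHS]mulmxA mxtrace_mulC.
Qed.

(** The core of Cartan's criterion, for [x] in the span of the brackets [y, z] with z in [S]. The
    trace of ad [y, z] times [E] equals that of ad z times ad (y E). As [E] is a left multiple of ad
    x, the vector y E is a complex bracket with x, hence Killing-orthogonal to z. So ad x times [E]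
    has trace 0. *)
Lemma nilpotent_of_killing x (S : V -> Prop) :
  (forall z, S z -> forall u v, killing z (v *m ad u) = 0) ->
  (forall W, (forall y z, S z -> z *m ad y \in W) -> x \in W) ->
  ad x ^+ n.+1 = 0.
Proof.
move=> killS xW.
pose A := cplx (ad x).
have adA (u : 'rV[K]_n.+1) : ad_complex (u *m A) = ad_complex u *m A - A *m ad_complex u.
  elim/complex_row_ind: u => [|a v w hv hw|v].
  - by rewrite !(mul0mx, linear0, mulmx0, subr0).
  - rewrite [_ *m A]mulmxDl -scalemxAl !ad_complex_is_linear hv hw mulmxDl mulmxDr.
    by rewrite -scalemxAl -scalemxAr scalerBr opprD addrACA.
  - by rewrite -map_mxM !ad_complexE leibniz map_mxB !map_mxM.
have [E [adE [r Er] trE]] := conj_semisimple_part adA.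
have {}adE (u : 'rV[K]_n.+1) : ad_complex (u *m E) = ad_complex u *m E - E *m ad_complex u.
  exact: adE.
have trxE z (w : 'rV[K]_n.+1) : S z -> \tr (cplx (ad z) *m ad_complex (w *m A)) = 0.
  move=> Sz; elim/complex_row_ind: w => [|a u v hu hv|u].
  - by rewrite !(mul0mx, linear0, mulmx0).
  - rewrite [_ *m A]mulmxDl -scalemxAl ad_complex_is_linear mulmxDr -scalemxAr.
    by rewrite linearP/= hu hv mulr0 addr0.
  - rewrite -map_mxM ad_complexE -map_mxM -[\tr _]/(\tr (map_mx _ _)).
    by rewrite trace_map_mx; have := killS _ Sz x u; rewrite /killing => ->; rewrite rmorph0.
suff : cplx (ad x ^+ n.+1) = 0.
  by move=> /eqP; rewrite map_mx_eq0 => /eqP.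
have -> : cplx (ad x ^+ n.+1) = horner_mx A ('X ^+ n.+1).
  by rewrite [RHS]rmorphXn/= horner_mx_X [LHS]rmorphXn.
apply: trE.
pose P u := \tr (cplx (ad u) *m E) = 0.
have [W hW] : exists W : {vspace V}, forall v, v \in W <-> P v.
  apply: exists_vspace; first by rewrite /P linear0 map_mx0 mul0mx linear0.
  move=> a u v hu hv; rewrite /P linearP/= map_mxD map_mxZ mulmxDl -scalemxAl.
  by rewrite linearP/= hu hv mulr0 addr0.
apply/hW/xW => y z Sz; apply/hW; rewrite /P leibniz map_mxB !map_mxM mulmxBl.
rewrite linearB/= -(mulmxA (cplx (ad z))) -(mulmxA (cplx (ad y))).
rewrite (mxtrace_mulC (cplx (ad y))) -(mulmxA (cplx (ad z))).
rewrite -raddfB/= -mulmxBr; have := adE (cplx y); rewrite ad_complexE => <-.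
by rewrite Er mulmxA trxE.
Qed.

End LeibnizAlgebra.

Section PerfectSemisimple.
Variables (R : realType) (n : nat) (br : 'rV[R]_n -> 'rV[R]_n -> 'rV[R]_n).
Hypothesis br_linearl : forall y, linear (br^~ y).
Hypothesis br_linearr : forall x, linear (br x).
Hypothesis br_semisimple : semisimple_bracket br.

Lemma mem_derived_space (I : {vspace 'rV[R]_n}) x y :
  x \in I -> y \in I -> br x y \in derived_space br I.
Proof.
have l0 z : br 0 z = 0.
  by have := br_linearl z 1 0 0; rewrite /= !scale1r addr0 => /esym/eqP; rewrite -subr_eq0 addrK => /eqP.
have r0 z : br z 0 = 0.
  by have := br_linearr z 1 0 0; rewrite /= !scale1r addr0 => /esym/eqP; rewrite -subr_eq0 addrK => /eqP.
have [W hW] : exists W : {vspace 'rV[R]_n}, forall v, v \in W <->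
    forall u, u \in vbasis I -> br v u \in derived_space br I.
  apply: exists_vspace => [u _|a u v hu hv w wI]; first by rewrite l0 mem0v.
  by rewrite br_linearl memvD ?memvZ ?hu ?hv.
have {}hW v u : v \in I -> u \in vbasis I -> br v u \in derived_space br I.
  move=> vI uI; suff /hW : v \in W by apply.
  suff /subvP : (I <= W)%VS by apply.
  rewrite -(span_basis (vbasisP I)); apply/span_subvP => w wI; apply/hW => z zI.
  by apply: memv_span; apply/allpairsP; exists (w, z).
move=> xI yI; have [W' hW'] : exists W : {vspace 'rV[R]_n}, forall v, v \in W <->
    br x v \in derived_space br I.
  apply: exists_vspace => [|a u v hu hv]; first by rewrite r0 mem0v.
  by rewrite br_linearr memvD ?memvZ ?hu ?hv.
apply/hW'; suff /subvP : (I <= W')%VS by apply.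
rewrite -(span_basis (vbasisP I)); apply/span_subvP => w wI; apply/hW'.
exact: hW.
Qed.

Lemma abelian_ideal0 (I : {vspace 'rV[R]_n}) : lie_ideal br I ->
  (forall x y, x \in I -> y \in I -> br x y = 0) -> I = 0%VS.
Proof.
move=> idI abI; apply: br_semisimple; split=> //; exists 1%N => /=.
apply/eqP; rewrite -subv0; apply/span_subvP => _ /allpairsP[[x y] [/= xI yI ->]].
by rewrite abI ?mem0v// vbasis_mem.
Qed.

End PerfectSemisimple.

(** If the derived algebra were proper, a dimension count would give a nonzero vector in its
    Killing-orthogonal [S]. But the ideal [I] generated by the brackets with [S] consists of
    ad-nilpotent elements; were it nonzero, its centre would be a nonzero abelian ideal by Engel's
    theorem. So [I] = 0, [S] is central, and a semisimple algebra has no centre. *)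
Lemma semisimple_perfect (R : realType) (n : nat)
    (br : 'rV[R]_n -> 'rV[R]_n -> 'rV[R]_n) :
  (forall y, linear (br^~ y)) -> (forall x, linear (br x)) ->
  (forall x y z, br x (br y z) = br (br x y) z + br y (br x z)) ->
  semisimple_bracket br -> derived_space br fullv = fullv.
Proof.
case: n br => [|n] br lbr rbr leib ss.
  by apply/vspaceP => x; rewrite [x]thinmx0 !mem0v.
pose brx x : {linear 'rV[R]_n.+1 -> 'rV[R]_n.+1} :=
  HB.pack (br x) (GRing.isLinear.Build _ _ _ _ (br x) (rbr x)).
have adl : linear (fun x => lin1_mx (br x)).
  by move=> a x y; apply/matrixP => i j; rewrite !mxE lbr !mxE.
have [ad adE] : exists ad : {linear 'rV[R]_n.+1 -> 'M[R]_n.+1},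
    forall x y, y *m ad x = br x y.
  pose adp : {linear 'rV[R]_n.+1 -> 'M[R]_n.+1} :=
    HB.pack (fun x => lin1_mx (br x)) (GRing.isLinear.Build _ _ _ _ _ adl).
  exists adp.
  by move=> x y; exact: (mul_rV_lin1 (brx x)).
have leibniz x y : ad (y *m ad x) = ad y *m ad x - ad x *m ad y.
  apply: mulmx_rVP => z; rewrite mulmxBr !mulmxA !adE.
  by rewrite (leib x y z) addrK.
have ad0 v : ad v = 0 -> v = 0.
  have [Z hZ] : exists Z : {vspace 'rV[R]_n.+1}, forall v, v \in Z <-> ad v = 0.
    apply: exists_vspace => [|a x y hx hy]; first exact: linear0.
    by rewrite linearP/= hx hy scaler0 addr0.
  move=> /hZ; rewrite (abelian_ideal0 ss (I := Z)) ?memv0 => [/eqP//|x y /hZ h|x y /hZ h _].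
    by apply/hZ; rewrite -adE leibniz h mul0mx mulmx0 subrr.
  by rewrite -adE h mulmx0.
(* Antisymmetry comes from semisimplicity: ad [x, x] is 0 by the Leibniz identity, and the kernel of
   [ad] is an abelian ideal. *)
have alt x : x *m ad x = 0 by apply: ad0; rewrite leibniz subrr.
have killl (d : 'rV[R]_n.+1) : linear (fun x => killing ad x d).
  by move=> a x y; rewrite /killing linearP/= mulmxDl -scalemxAl linearP.
have killr x : linear (killing ad x).
  by move=> a y z; rewrite /killing linearP/= mulmxDr -scalemxAr linearP.
pose S (x : 'rV[R]_n.+1) := forall u v : 'rV[R]_n.+1, killing ad x (v *m ad u) = 0.
have Sid x y : S y -> S (y *m ad x).
  by move=> Sy u v; rewrite (killing_invariant leibniz) Sy oppr0.
have [I hI] : exists I : {vspace 'rV[R]_n.+1}, forall v, v \in I <->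
    forall W : {vspace 'rV[R]_n.+1}, (forall y z, S z -> z *m ad y \in W) -> v \in W.
  apply: exists_vspace => [W _|a u v hu hv W hW]; first exact: mem0v.
  by rewrite memvD ?memvZ ?hu ?hv.
have genI y z : S z -> z *m ad y \in I by move=> Sz; apply/hI => W; exact.
have idI x u : u \in I -> u *m ad x \in I.
  have [W hW] : exists W : {vspace 'rV[R]_n.+1}, forall v, v \in W <-> v *m ad x \in I.
    apply: exists_vspace => [|a v w hv hw]; first by rewrite mul0mx mem0v.
    by rewrite mulmxDl -scalemxAl memvD ?memvZ.
  by move=> /hI uI; apply/hW/uI => y z Sz; apply/hW/genI/Sid.
have nilI u : u \in I -> ad u ^+ n.+1 = 0.
  by move=> /hI uI; apply: (nilpotent_of_killing leibniz (S := S)).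
have I0 : I = 0%VS.
  apply: contrapT => /eqP nI0; rewrite eq_sym in nI0.
  have [|||w [wI w0 wc]] := engel leibniz alt (I := I) (U := 0%VS) (W := I) _ nilI (sub0v _) nI0.
  - by move=> u v _; exact: idI.
  - by move=> u v _; rewrite !memv0 => /eqP ->; rewrite mul0mx.
  - by move=> u v _; exact: idI.
  have [Z hZ] : exists Z : {vspace 'rV[R]_n.+1}, forall v, v \in Z <->
      v \in I /\ forall u, u \in I -> v *m ad u = 0.
    apply: exists_vspace => [|a x y [xI hx] [yI hy]].
      by split=> [|u _]; rewrite ?mem0v ?mul0mx.
    split=> [|u uI]; first by rewrite memvD ?memvZ.
    by rewrite mulmxDl -scalemxAl hx ?hy ?scaler0 ?addr0.
  have /hZ : w \in I /\ forall u, u \in I -> w *m ad u = 0.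
    by split=> // u /wc; rewrite memv0 => /eqP.
  rewrite (abelian_ideal0 ss (I := Z)) ?(negbTE w0)// => x y.
    move=> /hZ[yI hy]; apply/hZ; rewrite -adE; split=> [|u uI]; first exact: idI.
    rewrite -[LHS]mulmxA (_ : ad x *m ad u = ad u *m ad x + ad (x *m ad u)).
      rewrite mulmxDr mulmxA hy// mul0mx add0r [x *m _](anticomm alt) linearN/=.
      by rewrite mulmxN hy ?oppr0// idI.
    by rewrite leibniz addrC subrK.
  by move=> /hZ[xI _] /hZ[_ hy]; rewrite -adE hy.
have S0 x : S x -> x = 0.
  move=> Sx; apply/ad0/mulmx_rVP => y; rewrite mulmx0 (anticomm alt).
  by have := genI y x Sx; rewrite I0 memv0 => /eqP ->; rewrite oppr0.
apply/eqP; rewrite eqEsubv subvf/=; apply: contrapT => /negP nD.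
pose D := derived_space br fullv.
have dD : (\dim D < n.+1)%N.
  rewrite ltnNge; apply: contra nD => le.
  have /eqP DF : D == fullv by rewrite eqEdim subvf dimvf /dim/= mul1n.
  by rewrite -/D DF subvv.
(* This matrix has more rows than columns, so some nonzero row vector is Killing-orthogonal to a
   basis of [D]. *)
pose B := \matrix_(i < n.+1, j < \dim D) killing ad (delta_mx 0 i) (vbasis D)`_j.
have : kermx B != 0.
  by rewrite kermx_eq0 /row_free neq_ltn (leq_ltn_trans (rank_leq_col _)).
move=> /rowV0Pn[x /sub_kermxP xB x0]; move/eqP: x0; apply; apply: S0 => u v.
have [W hW] : exists W : {vspace 'rV[R]_n.+1}, forall d, d \in W <-> killing ad x d = 0.
  apply: exists_vspace => [|a y z hy hz]; last by rewrite killr hy hz scaler0 addr0.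
  by rewrite /killing linear0 mulmx0 linear0.
apply/hW; suff /subvP : (D <= W)%VS.
  by apply; rewrite adE; apply: mem_derived_space => //; exact: memvf.
rewrite -(span_basis (vbasisP D)); apply/span_subvP => d /(nthP 0)[j jD <-].
rewrite size_tuple in jD; apply/hW.
have := congr1 (fun M : 'rV_ _ => M 0 (Ordinal jD)) xB; rewrite !mxE => xj.
rewrite -[RHS]xj.
pose kl : {linear 'rV[R]_n.+1 -> R^o} :=
  HB.pack (fun x => killing ad x (vbasis D)`_j) (GRing.isLinear.Build _ _ _ _ _ (killl (vbasis D)`_j)).
rewrite -[LHS]/(kl x) {1}[x]row_sum_delta linear_sum; apply: eq_bigr => i _.
by rewrite linearZ/= mxE.
Qed.

(** * C^k maps between normed spaces *)

Section MeanValue.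
Variables (R : realType) (F : normedModType R).

(** With vector values there is no intermediate point to use. The supremum of the t with |f t - f 0|
    <= M t satisfies this bound by continuity; below 1 it could still be increased, because the
    derivative there has norm strictly less than [M]. *)
Lemma mean_value_le (f df : R -> F) (M : R) :
  (forall t : R, 0 <= t <= 1 -> is_derive t 1 f (df t)) ->
  (forall t : R, 0 <= t <= 1 -> `|df t| < M) -> `|f 1 - f 0| <= M.
Proof.
move=> fd dM; rewrite leNgt; apply/negP => Mf.
pose A := [set t : R | 0 <= t <= 1 /\ `|f t - f 0| <= M * t].
have A0 : A 0 by split; rewrite ?lexx ?ler01// subrr normr0 mulr0.
have supA : has_sup A by split; [exists 0|exists 1 => t [/andP[]]].
pose s := sup A.
have s01 : 0 <= s <= 1.
  by rewrite sup_upper_bound//= ge_sup//; [exists 0|move=> t [/andP[]]].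
have cf t : 0 <= t <= 1 -> {for t, continuous f}.
  move=> t01; have [dt _] := fd t t01.
  exact/differentiable_continuous/derivable1_diffP.
have As : A s.
  split=> //; rewrite leNgt; apply/negP => lts.
  have : \forall t \near s, M * t < `|f t - f 0|.
    have c1 : (fun t => `|f t - f 0| - M * t) @ s --> `|f s - f 0| - M * s.
      apply: cvgB; last by apply: cvgMr; exact: cvg_id.
      by apply: cvg_norm; apply: cvgB; [exact: cf|exact: cvg_cst].
    have p0 : 0 < `|f s - f 0| - M * s by rewrite subr_gt0.
    by apply: filterS (cvgr_gt _ c1 _ p0) => t; rewrite subr_gt0.
  move=> /nbhs_ballP[d /= d0 hd].
  have [t [t01 tM] st] := sup_adherent d0 supA.
  have := hd t; rewrite /ball/= ltr_distl => /(_ _)/wrap[].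
    have ts : t <= s by apply: sup_upper_bound.
    by rewrite ltrBlDr (le_lt_trans ts) ?ltrDl//= -ltrBlDr.
  by rewrite ltNge tM.
have s1 : s < 1.
  rewrite lt_neqAle; case/andP: s01 => _ ->; rewrite andbT.
  by apply: contraTneq Mf => se; have [_] := As; rewrite se mulr1 -leNgt.
have [ds dE] := fd s s01.
have : \forall h \near (0 : R)^', `|h^-1 *: (f (h *: 1 + s) - f s)| < M.
  apply: (cvgr_lt `|df s|); last exact: dM.
  by rewrite -dE; exact: cvg_norm ds.
rewrite near_withinE => /nbhs_ballP[d /= d0 hd].
pose h := Num.min (d / 2) (1 - s).
have h0 : 0 < h by rewrite lt_min divr_gt0//= subr_gt0.
have := hd h; rewrite /ball/= sub0r normrN gtr0_norm// => /(_ _ _)/wrap[].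
  by rewrite (@le_lt_trans _ _ (d / 2))// ?ge_min ?lexx// ltr_pdivrMr// mulr2n mulrDr mulr1 ltrDl.
rewrite gt_eqF// => /(_ isT).
rewrite normrZ normfV gtr0_norm// mulrC ltr_pdivrMr// => hM.
have : A (h + s).
  split.
    rewrite addr_ge0 ?(ltW h0)//=; last by case/andP: s01.
    by rewrite -lerBrDr ge_min lexx orbT.
  have [_ sM] := As.
  rewrite -(subrK (f s) (f (h + s))) -addrA (le_trans (ler_normD _ _))// mulrDr lerD//.
  by move: hM; rewrite [h *: 1]mulr1 => /ltW.
by move=> /(sup_upper_bound supA); rewrite leNgt ltrDr h0.
Qed.

End MeanValue.

Section CkBasics.
Variable R : realType.
Implicit Types E F G : normedModType R.

Lemma dquot_derivable E F (f : E -> F) x v l :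
  h^-1 *: (f (h *: v + x) - f x) @[h --> (0 : R)^'] --> l ->
  derivable f x v /\ 'D_v f x = l.
Proof. by move=> fl; split; [apply/cvg_ex; exists l|exact: cvg_lim fl]. Qed.

Lemma derivable_dquot E F (f : E -> F) x v : derivable f x v ->
  h^-1 *: (f (h *: v + x) - f x) @[h --> (0 : R)^'] --> 'D_v f x.
Proof. by []. Qed.

Lemma Ck_continuous k E F (U : set E) (f : E -> F) x :
  Ck k U f -> U x -> {for x, continuous f}.
Proof. by case: k => [|k] [cf _]; exact: cf. Qed.

Lemma Ck_sub k E F (U W : set E) (f : E -> F) : W `<=` U -> Ck k U f -> Ck k W f.
Proof.
elim: k E U W f => [|k ih] E U W f WU [cf] /=.
  by move=> _; split=> // x /WU; exact: cf.
move=> [df [fd Cdf]]; split; first by move=> x /WU; exact: cf.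
exists df; split; first by move=> x v /WU; exact: fd.
by apply: ih Cdf => p [Wp _]; split=> //; exact: WU.
Qed.

Lemma Ck_pred k E F (U : set E) (f : E -> F) : Ck k.+1 U f -> Ck k U f.
Proof.
elim: k E U f => [|k ih] E U f [cf [df [fd Cdf]]]; first by split.
by split=> //; exists df; split=> //; exact: ih.
Qed.

Lemma continuous_near_eq (T S : topologicalType) (f g : T -> S) x :
  (\forall y \near x, f y = g y) -> {for x, continuous f} -> {for x, continuous g}.
Proof.
move=> fg cf; have fgx : f x = g x := nbhs_singleton fg.
rewrite /prop_for /continuous_at -fgx.
by apply: cvg_trans cf; exact: near_eq_cvg.
Qed.

Lemma dnbhs_shift E (x v : E) : h *: v + x @[h --> (0 : R)^'] --> x.
Proof.
rewrite -[X in _ --> X]add0r -[X in _ --> X + _](scale0r v).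
apply: cvgD; last exact: cvg_cst.
by apply: cvgZr_tmp; exact: nbhs_dnbhs.
Qed.

Lemma dquot_near_eq E F (f g : E -> F) (x v : E) (l : F) : (\forall y \near x, f y = g y) ->
  h^-1 *: (f (h *: v + x) - f x) @[h --> (0 : R)^'] --> l ->
  h^-1 *: (g (h *: v + x) - g x) @[h --> (0 : R)^'] --> l.
Proof.
move=> fg; apply: cvg_trans; apply: near_eq_cvg.
have c := @dnbhs_shift E x v.
near=> h; rewrite (nbhs_singleton fg); congr (_ *: (_ - _)).
by near: h; exact: (c _ fg).
Unshelve. all: by end_near. Qed.

Lemma Ck_eq k E F (U : set E) (f g : E -> F) : open U ->
  (forall x, U x -> f x = g x) -> Ck k U f -> Ck k U g.
Proof.
move=> oU fg.
have nfg x : U x -> \forall y \near x, f y = g y.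
  by move=> Ux; apply: filterS (open_nbhs_nbhs (conj oU Ux)).
case: k => [|k] [cf] /=.
  by move=> _; split=> // x Ux; apply: continuous_near_eq (nfg x Ux) (cf x Ux).
move=> [df [fd Cdf]]; split.
  by move=> x Ux; apply: continuous_near_eq (nfg x Ux) (cf x Ux).
by exists df; split=> // x v Ux; apply: dquot_near_eq (nfg x Ux) _; exact: fd.
Qed.

Lemma openX_setT E F (U : set E) : open U -> open (U `*` [set: F]).
Proof. rewrite !openE => oU [x v] [/= Ux _]; exists (U, setT) => //=.
by split; [exact: oU|exact: filterT]. Qed.

(** On an open set the derivative whose existence [Ck] asserts can only be the directional
    derivative, up to its irrelevant values outside the set. *)
Lemma CkS k E F (U : set E) (f : E -> F) : open U ->
  Ck k.+1 U f <-> [/\ forall x, U x -> {for x, continuous f},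
    forall x v, U x -> derivable f x v &
    Ck k (U `*` setT) (fun p : E * E => 'D_p.2 f p.1)].
Proof.
move=> oU; split=> [[cf [df [fd Cdf]]]|[cf fd Cdf]].
  split=> // [x v Ux|]; first by have [] := dquot_derivable (fd x v Ux).
  apply: Ck_eq Cdf => [|[x v] [/= Ux _]]; first exact: openX_setT.
  by have [_ ->] := dquot_derivable (fd x v Ux).
split=> //; exists (fun p => 'D_p.2 f p.1); by split.
Qed.

Lemma Ck_local k E F (U : set E) (f : E -> F) : open U ->
  (forall x, U x -> exists W, [/\ open W, W x & Ck k W f]) -> Ck k U f.
Proof.
elim: k E U f => [|k ih] E U f oU loc.
  by split=> // x /loc[W [_ Wx [cf _]]]; exact: cf.
apply/CkS => //; split.
- by move=> x /loc[W [oW Wx /(CkS _ _ oW)[+ _ _]]]; apply.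
- by move=> x v /loc[W [oW Wx /(CkS _ _ oW)[_ + _]]]; apply.
- apply: ih; first exact: openX_setT.
  move=> [x v] [/= /loc[W [oW Wx /(CkS _ _ oW)[_ _ Cd]]] _].
  by exists (W `*` setT); split=> //; exact: openX_setT.
Qed.

Lemma dquot_linear E F (f : E -> F) (x v : E) : linear f ->
  h^-1 *: (f (h *: v + x) - f x) @[h --> (0 : R)^'] --> f v.
Proof.
move=> lf; apply: (@cvg_trans _ ((cst (f v)) @ (0 : R)^')); last exact: cvg_cst.
apply: near_eq_cvg; near=> h; rewrite lf addrK scalerA mulVf ?scale1r//.
by near: h; exact: nbhs_dnbhs_neq.
Unshelve. all: by end_near. Qed.

Lemma Ck_linear k E F (U : set E) (f : E -> F) : linear f -> continuous f -> Ck k U f.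
Proof.
elim: k E U f => [|k ih] E U f lf cf; first by split=> // x _; exact: cf.
split; first by move=> x _; exact: cf.
exists (f \o snd); split; first by move=> x v _; exact: dquot_linear.
apply: ih; first by move=> a u v /=; exact: lf.
by move=> x; apply: continuous_comp; [exact: cvg_snd|exact: cf].
Qed.

Lemma Ck_cst k E F (U : set E) (c : F) : Ck k U (fun=> c : F).
Proof.
case: k => [|k]; split; try by move=> x _; exact: cvg_cst.
  by [].
exists (fun=> 0); split; last first.
  by apply: Ck_linear; [move=> a u v; rewrite scaler0 addr0|exact: cst_continuous].
move=> x v _; rewrite (_ : (fun h => _) = cst 0); first exact: cvg_cst.
by apply/funext => h; rewrite subrr scaler0.
Qed.

Lemma Ck_id k E (U : set E) : Ck k U (fun x : E => x).
Proof. by apply: Ck_linear => // x; exact: cvg_id. Qed.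

Lemma Ck_fst k E F (U : set (E * F)) : Ck k U (fun x : E * F => x.1).
Proof. by apply: Ck_linear => // x; exact: cvg_fst. Qed.

Lemma Ck_snd k E F (U : set (E * F)) : Ck k U (fun x : E * F => x.2).
Proof. by apply: Ck_linear => // x; exact: cvg_snd. Qed.

Lemma Ck_pair k E F G (U : set E) (f : E -> F) (g : E -> G) :
  Ck k U f -> Ck k U g -> Ck k U (fun x => (f x, g x)).
Proof.
elim: k E U f g => [|k ih] E U f g [cf +] [cg +] /=.
  by move=> _ _; split=> // x Ux; apply: cvg_pair; [exact: cf|exact: cg].
move=> [df [fd Cdf]] [dg [gd Cdg]]; split.
  by move=> x Ux; apply: cvg_pair; [exact: cf|exact: cg].
exists (fun p => (df p, dg p)); split; last exact: ih.
move=> x v Ux.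
have c : (h^-1 *: (f (h *: v + x) - f x), h^-1 *: (g (h *: v + x) - g x))
    @[h --> (0 : R)^'] --> (df (x, v), dg (x, v)).
  exact: cvg_pair (fd x v Ux) (gd x v Ux).
exact: c.
Qed.

Lemma is_derive_dquot F (f : R -> F) (t : R) l :
  h^-1 *: (f (h + t) - f t) @[h --> (0 : R)^'] --> l -> is_derive t 1 f l.
Proof.
move=> fl; have [d e] : derivable f t 1 /\ 'D_1 f t = l.
  apply: dquot_derivable; apply: cvg_trans fl; apply: near_eq_cvg.
  by apply: nearW => h; rewrite [h *: 1]mulr1.
exact: DeriveDef.
Qed.

Lemma dquot_scale E F (f : E -> F) (x v : E) (l : F) (c : R) :
  h^-1 *: (f (h *: v + x) - f x) @[h --> (0 : R)^'] --> l ->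
  h^-1 *: (f (h *: (c *: v) + x) - f x) @[h --> (0 : R)^'] --> c *: l.
Proof.
have [->|c0] := eqVneq c 0.
  rewrite !scale0r => _; rewrite (_ : (fun h => _) = cst 0); first exact: cvg_cst.
  by apply/funext => h; rewrite scaler0 add0r subrr scaler0.
move=> fl; have cc : c * h @[h --> (0 : R)^'] --> (0 : R)^'.
  rewrite -[X in _ --> X^'](mulr0 c); apply: continuous_injective_withinNx.
    exact: mulrl_continuous.
  by move=> y /(mulfI c0).
apply: cvg_trans (cvgZl_tmp (k := c) (cvg_comp _ _ cc fl)).
by apply: near_eq_cvg; apply: nearW => h /=; rewrite scalerA [h *: _]scalerA [c * h]mulrC invfM [_ * c^-1]mulrC mulrA mulfV// mul1r.
Qed.

(** Existence of directional derivatives gives neither linearity nor a chain rule. Both follow from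
    this bound, in which base point and direction may move with [h]; it is the mean value inequality
    on the segment from y to y + h w, with [df] jointly continuous. *)
Lemma Ck1_dquot E F (U : set E) (f : E -> F) (df : E * E -> F) (x v : E) (e : R) :
  open U ->
  (forall x v, U x -> h^-1 *: (f (h *: v + x) - f x) @[h --> (0 : R)^'] --> df (x, v)) ->
  {for (x, v), continuous df} -> U x -> 0 < e ->
  exists2 d : R, 0 < d & forall (h : R) y w, h != 0 -> `|h| < d -> `|x - y| < d -> `|v - w| < d ->
    `|h^-1 *: (f (h *: w + y) - f y) - df (x, v)| <= e.
Proof.
move=> oU fd cdf Ux e0.
have [r r0 hr] : exists2 r : R, 0 < r & forall y w, `|x - y| < r -> `|v - w| < r ->
    U y /\ `|df (x, v) - df (y, w)| < e.
  have /cvgrPdist_lt/(_ _ e0)/nbhs_ballP[r /= r0 hr] := cdf.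
  have /nbhs_ballP[s /= s0 hs] : nbhs x U by exact: open_nbhs_nbhs.
  exists (Num.min r s); first by rewrite lt_min r0.
  move=> y w; rewrite !lt_min => /andP[yr ys] /andP[wr _]; split.
    by apply: hs; rewrite -ball_normE.
  by apply: hr; split; rewrite -ball_normE.
(* The first bound keeps [y] within r / 2 of [x]; the second keeps the segment of length at most |h|
   (|v| + r) within r / 2 of [y]. *)
pose d := Num.min (r / 2) (r / 2 / (`|v| + r)).
have vr0 : 0 < `|v| + r by rewrite ltr_wpDl.
have d0 : 0 < d by rewrite lt_min !divr_gt0.
exists d => // h y w h0 hd yd wd.
have rr : r / 2 < r by rewrite ltr_pdivrMr// mulr2n mulrDr mulr1 ltrDl.
have wr : `|v - w| < r.
  by rewrite (lt_trans wd)// (le_lt_trans _ rr)// ge_min lexx.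
have wn : `|w| <= `|v| + r.
  by rewrite -(subrK v w) addrC (le_trans (ler_normD _ _))// lerD2l distrC ltW.
have near t : 0 <= t <= 1 -> U (t *: (h *: w) + y) /\
    `|df (x, v) - df (t *: (h *: w) + y, w)| < e.
  move=> /andP[t0 t1]; apply: hr => //.
  rewrite opprD addrCA (le_lt_trans (ler_normD _ _))// normrN.
  rewrite [ltRHS](splitr r) ler_ltD//; last by rewrite (lt_le_trans yd)// ge_min lexx.
  rewrite !normrZ (ger0_norm t0) (@le_trans _ _ (d * (`|v| + r)))//.
    by rewrite -[leRHS]mul1r !ler_pM// ?mulr_ge0// ltW.
  by rewrite -ler_pdivlMr// ge_min lexx orbT.
pose phi (t : R) := h^-1 *: f (t *: (h *: w) + y) - t *: df (x, v).
have := @mean_value_le R F phi (fun t => df (t *: (h *: w) + y, w) - df (x, v)) e.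
move=> /(_ _ _)/wrap[].
- move=> t /near[Ut _]; apply: is_derive_dquot.
  have c1 := dquot_scale (c := h) (fd _ w Ut).
  have -> : df (t *: (h *: w) + y, w) - df (x, v) =
      h^-1 *: (h *: df (t *: (h *: w) + y, w)) - df (x, v).
    by rewrite [h^-1 *: _]scalerA mulVf// scale1r.
  apply: cvg_trans (cvgB (cvgZl_tmp (k := h^-1) c1) (cvg_cst (df (x, v)))).
  apply: near_eq_cvg.
  near=> s; rewrite /= /phi.
  have zE (a b c z : F) : a - (c + z) - (b - z) = a - b - c.
    by rewrite opprD opprB !addrA subrK addrAC.
  rewrite -[LHS]/(h^-1 *: (s^-1 *: (f (s *: (h *: w) + (t *: (h *: w) + y))
    - f (t *: (h *: w) + y))) - df (x, v)).
  rewrite [(s + t) *: df _]scalerDl zE -scalerBr [(s + t) *: (h *: w)]scalerDl -[in RHS]addrA.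
  rewrite [RHS]scalerBr [s^-1 *: (s *: _)]scalerA mulVf.
    by rewrite scale1r !scalerA mulrC.
  by near: s; exact: nbhs_dnbhs_neq.
- by move=> t /near[_]; rewrite distrC.
rewrite /phi !scale1r !scale0r add0r subr0; apply: le_trans.
by rewrite scalerBr addrAC.
Unshelve. all: by end_near. Qed.

(** With w the difference quotient of f, f (h v + x) is f x + h w. So the quotient of g o f is one
    of g at the fixed point f x in a direction w that tends to l, a case of [Ck1_dquot]. *)
Lemma Ck1_comp_dquot E F G (W : set F) (f : E -> F) (g : F -> G)
    (dg : F * F -> G) x v l : open W ->
  (forall y w, W y -> h^-1 *: (g (h *: w + y) - g y) @[h --> (0 : R)^'] --> dg (y, w)) ->
  {for (f x, l), continuous dg} -> W (f x) ->
  h^-1 *: (f (h *: v + x) - f x) @[h --> (0 : R)^'] --> l ->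
  h^-1 *: (g (f (h *: v + x)) - g (f x)) @[h --> (0 : R)^'] --> dg (f x, l).
Proof.
move=> oW gd cdg Wfx fl; apply/cvgrPdist_le => e e0.
have [d d0 hd] := Ck1_dquot oW gd cdg Wfx e0.
move/cvgrPdist_lt : fl => /(_ _ d0) fl.
near=> h.
have h0 : h != 0 by near: h; exact: nbhs_dnbhs_neq.
have -> : f (h *: v + x) = h *: (h^-1 *: (f (h *: v + x) - f x)) + f x.
  by rewrite scalerA mulfV// scale1r subrK.
rewrite distrC; apply: hd => //; last by near: h.
  by near: h; exact: dnbhs0_lt.
by rewrite subrr normr0.
Unshelve. all: by end_near. Qed.

Lemma Ck_comp k E F G (U : set E) (W : set F) (f : E -> F) (g : F -> G) :
  open U -> open W -> (forall x, U x -> W (f x)) -> Ck k U f -> Ck k W g -> Ck k U (g \o f).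
Proof.
elim: k E F G U W f g => [|k ih] E F G U W f g oU oW UW Cf Cg.
  split=> // x Ux; apply: continuous_comp; first exact: Ck_continuous Cf Ux.
  exact: Ck_continuous Cg (UW x Ux).
have Cf' := Ck_pred Cf.
case: (Cf) => cf [df [fd Cdf]]; case: (Cg) => cg [dg [gd Cdg]]; split.
  by move=> x Ux; apply: continuous_comp; [exact: cf|exact/cg/UW].
exists (dg \o (fun p => (f p.1, df p))); split.
  move=> x v Ux /=; apply: Ck1_comp_dquot (UW x Ux) (fd x v Ux) => //.
  by apply: Ck_continuous Cdg _; split=> //; exact: UW.
apply: (ih _ _ _ _ (W `*` setT)); try exact: openX_setT; last by [].
  by move=> p [Up _]; split=> //; exact: UW.
apply: Ck_pair => //; rewrite -[X in Ck _ _ X]/(f \o fst).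
by apply: (ih _ _ _ _ U) => //; [exact: openX_setT|move=> p []|exact: Ck_fst].
Qed.

Lemma Ck_add k E F (U : set E) (f g : E -> F) : open U ->
  Ck k U f -> Ck k U g -> Ck k U (fun x => f x + g x).
Proof.
move=> oU Cf Cg; rewrite -[X in Ck _ _ X]/((fun p : F * F => p.1 + p.2) \o (fun x => (f x, g x))).
apply: (@Ck_comp _ _ _ _ _ setT) => //; [exact: openT|exact: Ck_pair|].
apply: Ck_linear; last exact: add_continuous.
by move=> a p q /=; rewrite scalerDr addrACA.
Qed.

Lemma dquot_bilinear E F G (B : E -> F -> G) (x v : E) (y w : F) :
  (forall y, linear (B^~ y)) -> (forall x, linear (B x)) ->
  continuous (fun p : E * F => B p.1 p.2) ->
  h^-1 *: (B (h *: v + x) (h *: w + y) - B x y) @[h --> (0 : R)^'] --> B v y + B x w.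
Proof.
move=> lB rB cB.
have c : B v (h *: w + y) + B x w @[h --> (0 : R)^'] --> B v y + B x w.
  apply: cvgD; last exact: cvg_cst.
  have c1 : (v, h *: w + y) @[h --> (0 : R)^'] --> (v, y).
    by apply: cvg_pair; [exact: cvg_cst|exact: dnbhs_shift].
  exact: (cvg_comp _ _ c1 (cB (v, y))).
apply: cvg_trans c; apply: near_eq_cvg; near=> h => /=.
rewrite (lB (h *: w + y)) (rB x) addrA addrK -scalerDr scalerA mulVf ?scale1r//.
by near: h; exact: nbhs_dnbhs_neq.
Unshelve. all: by end_near. Qed.

Lemma Ck_bilinear k E F G (U : set (E * F)) (B : E -> F -> G) :
  (forall y, linear (B^~ y)) -> (forall x, linear (B x)) ->
  continuous (fun p : E * F => B p.1 p.2) -> Ck k U (fun p => B p.1 p.2).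
Proof.
move=> lB rB cB; apply: (@Ck_sub _ _ _ setT) => // {U}.
elim: k => [|k ih]; first by split=> // p _; exact: cB.
split; first by move=> p _; exact: cB.
exists (fun z => B z.2.1 z.1.2 + B z.1.1 z.2.2); split.
  by move=> [x y] [v w] _ /=; exact: dquot_bilinear.
apply: Ck_add; first by rewrite setXTT; exact: openT.
  rewrite -[X in Ck _ _ X]/((fun p => B p.1 p.2) \o (fun z : (E * F) * (E * F) => (z.2.1, z.1.2))).
  apply: Ck_comp ih; rewrite ?setXTT//; try exact: openT.
  apply: Ck_linear => [a p q //|p]; apply: cvg_pair => /=.
    by apply: (cvg_comp _ _ cvg_snd cvg_fst).
  by apply: (cvg_comp _ _ cvg_fst cvg_snd).
rewrite -[X in Ck _ _ X]/((fun p => B p.1 p.2) \o (fun z : (E * F) * (E * F) => (z.1.1, z.2.2))).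
apply: Ck_comp ih; rewrite ?setXTT//; try exact: openT.
apply: Ck_linear => [a p q //|p]; apply: cvg_pair => /=.
  by apply: (cvg_comp _ _ cvg_fst cvg_fst).
by apply: (cvg_comp _ _ cvg_snd cvg_snd).
Qed.

Lemma Ck_scale k E F (U : set E) (a : E -> R^o) (f : E -> F) : open U ->
  Ck k U a -> Ck k U f -> Ck k U (fun x => a x *: f x).
Proof.
move=> oU Ca Cf.
rewrite -[X in Ck _ _ X]/((fun p : R^o * F => p.1 *: p.2) \o (fun x => (a x, f x))).
apply: (@Ck_comp _ _ _ _ _ setT) => //; [exact: openT|exact: Ck_pair|].
apply: (@Ck_bilinear _ R^o F F setT (fun (c : R^o) (y : F) => c *: y)).
- by move=> y c u v; rewrite scalerDl scalerA.
- by move=> c b u v; rewrite scalerDr !scalerA mulrC.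
- exact: scale_continuous.
Qed.

Lemma inv_dquot (x v : R) : x != 0 ->
  h^-1 * ((h * v + x)^-1 - x^-1) @[h --> (0 : R)^'] --> - v * (x^-1 * x^-1).
Proof.
move=> x0.
have c0 : h * v + x @[h --> (0 : R)^'] --> x by exact: dnbhs_shift.
have c : (- v) * ((h * v + x)^-1 * x^-1) @[h --> (0 : R)^'] --> - v * (x^-1 * x^-1).
  apply: cvgM; first exact: cvg_cst.
  by apply: cvgM; [exact: cvgV|exact: cvg_cst].
apply: cvg_trans c; apply: near_eq_cvg.
have n0 : \forall h \near (0 : R)^', h * v + x != 0.
  have : \forall h \near (0 : R)^', `|x - (h * v + x)| < `|x|.
    by have /cvgrPdist_lt := c0; apply; rewrite normr_gt0.
  by apply: filterS => h; apply: contraTneq => ->; rewrite subr0 ltxx.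
near=> h => /=.
have h0 : h != 0 by near: h; exact: nbhs_dnbhs_neq.
have hvx : h * v + x != 0 by near: h.
by field; rewrite h0 hvx x0.
Unshelve. all: by end_near. Qed.

Lemma open_neq0 : open [set x : R^o | x != 0].
Proof.
rewrite openE => x /= x0; have : \forall y \near x, `|y - x| < `|x|.
  by near=> y; rewrite distrC; near: y; apply: cvgr_dist_lt; [exact: cvg_id|rewrite normr_gt0].
by apply: filterS => y; apply: contraTneq => ->; rewrite sub0r normrN ltxx.
Unshelve. all: by end_near. Qed.

Lemma Ck_inv k : Ck k [set x : R^o | x != 0] (fun x : R^o => x^-1 : R^o).
Proof.
have oN := open_neq0.
elim: k => [|k ih]; first by split=> // x x0; exact: inv_continuous.
split; first by move=> x x0; exact: inv_continuous.
exists (fun p => (- p.2) *: (p.1^-1 *: p.1^-1)); split; last first.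
  have oNT : open ([set x : R^o | x != 0] `*` [set: R^o]) by exact: openX_setT.
  have ci : Ck k ([set x : R^o | x != 0] `*` [set: R^o]) ((fun x : R^o => x^-1 : R^o) \o fst).
    by apply: Ck_comp ih => //; [move=> p []|exact: Ck_fst].
  apply: Ck_scale => //; last exact: Ck_scale.
  apply: Ck_linear => [a p q|p]; first by rewrite /= opprD scalerN.
  by apply: cvgN; exact: cvg_snd.
by move=> x v x0 /=; exact: inv_dquot.
Qed.

(** For additivity the increment h (a v + w) is made in two steps; the second one starts at the
    moving point x + h a v, which [Ck1_dquot] permits. *)
Lemma Ck1_linear E F (U : set E) (f : E -> F) x : open U -> Ck 1 U f -> U x ->
  linear (fun v => 'D_v f x).
Proof.
move=> oU Cf Ux a v w.
have /(CkS _ _ oU)[_ df [cdf _]] := Cf.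
have fd y u : U y -> h^-1 *: (f (h *: u + y) - f y) @[h --> (0 : R)^'] -->
    (fun p : E * E => 'D_p.2 f p.1) (y, u).
  by move=> Uy; exact/derivable_dquot/df.
apply: (@cvg_unique _ (@norm_hausdorff _ F) _ _ _ _ (fd x (a *: v + w) Ux)) => /=.
have c1 := dquot_scale (c := a) (fd x v Ux).
have c2 : h^-1 *: (f (h *: w + (h *: (a *: v) + x)) - f (h *: (a *: v) + x)) @[h --> (0 : R)^'] --> 'D_w f x.
  apply/cvgrPdist_le => e e0.
  have [d d0 hd] := Ck1_dquot oU fd (cdf (x, w) (conj Ux I)) Ux e0.
  have /cvgrPdist_lt/(_ _ d0) c3 := @dnbhs_shift E x (a *: v).
  near=> h; rewrite distrC; apply: hd => //.
  - by near: h; exact: nbhs_dnbhs_neq.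
  - by near: h; exact: dnbhs0_lt.
  - by near: h.
  - by rewrite subrr normr0.
apply: cvg_trans (cvgD c1 c2); apply: near_eq_cvg; apply: nearW => h /=.
change (h^-1 *: (f (h *: (a *: v) + x) - f x) + h^-1 *: (f (h *: w +
  (h *: (a *: v) + x)) - f (h *: (a *: v) + x)) = h^-1 *: (f (h *: (a *: v + w) + x) - f x)).
rewrite -scalerDr [X in _ *: X]addrC addrA subrK [h *: (_ + w)]scalerDr.
by rewrite [h *: w + _]addrCA addrA.
Unshelve. all: by end_near. Qed.

Lemma derive_near_eq E F (f g : E -> F) x v : (\forall y \near x, f y = g y) ->
  derivable f x v -> 'D_v f x = 'D_v g x.
Proof.
move=> fg df; have [_ ->] := dquot_derivable (dquot_near_eq fg (derivable_dquot df)).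
by [].
Qed.

Lemma derive_chain E F G (W : set F) (f : E -> F) (g : F -> G) x v :
  open W -> Ck 1 W g -> W (f x) -> derivable f x v ->
  derivable (g \o f) x v /\ 'D_v (g \o f) x = 'D_('D_v f x) g (f x).
Proof.
move=> oW Cg Wfx df; have /(CkS _ _ oW)[_ dg [cdg _]] := Cg.
apply: dquot_derivable; apply: (@Ck1_comp_dquot _ _ _ W f g (fun p => 'D_p.2 g p.1)) => //.
exact: (cdg (f x, 'D_v f x) (conj Wfx I)).
Qed.

Lemma derive_linear E F (f : E -> F) x v : linear f -> 'D_v f x = f v.
Proof. by move=> lf; have [] := dquot_derivable (@dquot_linear _ _ f x v lf). Qed.

Lemma Ck1_derivable E F (U : set E) (f : E -> F) x v : open U -> Ck 1 U f -> U x ->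
  derivable f x v.
Proof. by move=> oU /(CkS _ _ oU)[_ + _] Ux; exact. Qed.

Lemma Ck1_continuous E F (U : set E) (f : E -> F) (x v : E) : open U -> Ck 1 U f -> U x ->
  {for (x, v), continuous (fun p : E * E => 'D_p.2 f p.1)}.
Proof. by move=> oU /(CkS _ _ oU)[_ _ [+ _]] Ux; apply. Qed.

Lemma derive_bilinear E F G (H : normedModType R) (U : set E) (f : E -> F) (g : E -> G) (B : F -> G -> H) x v :
  (forall y, linear (B^~ y)) -> (forall x, linear (B x)) ->
  continuous (fun p : F * G => B p.1 p.2) ->
  open U -> Ck 1 U f -> Ck 1 U g -> U x ->
  'D_v (fun y => B (f y) (g y)) x = B ('D_v f x) (g x) + B (f x) ('D_v g x).
Proof.
move=> lB rB cB oU Cf Cg Ux.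
have CB : Ck 1 setT (fun p : F * G => B p.1 p.2) := Ck_bilinear 1 setT lB rB cB.
have dP : derivable (fun y => (f y, g y)) x v.
  by have /(CkS _ _ oU)[_ + _] := Ck_pair Cf Cg; apply.
have DP : 'D_v (fun y => (f y, g y)) x = ('D_v f x, 'D_v g x).
  have /(CkS _ _ oU)[_ df _] := Cf; have /(CkS _ _ oU)[_ dg _] := Cg.
  have cc : (h^-1 *: (f (h *: v + x) - f x), h^-1 *: (g (h *: v + x) - g x))
      @[h --> (0 : R)^'] --> ('D_v f x, 'D_v g x).
    exact: cvg_pair (derivable_dquot (df x v Ux)) (derivable_dquot (dg x v Ux)).
  by have [] := @dquot_derivable _ _ (fun y => (f y, g y)) x v ('D_v f x, 'D_v g x) cc.
have [_] := derive_chain openT CB I dP; rewrite DP.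
by have [_ ->] := @dquot_derivable (F * G)%type H (fun p => B p.1 p.2) (f x, g x) ('D_v f x, 'D_v g x)
  _ (@dquot_bilinear _ _ _ B (f x) ('D_v f x) (g x) ('D_v g x) lB rB cB).
Qed.

Lemma Cinfty_iter_derive1 F (U : set R) (f : R -> F) m : open (U : set R^o) ->
  Cinfty (U : set R^o) (f : R^o -> F) -> Cinfty (U : set R^o) (derive1n m f : R^o -> F).
Proof.
move=> oU Cf; elim: m => // m ih k; have /(CkS _ _ oU)[_ _ C1] := ih k.+1.
rewrite (_ : derive1n m.+1 f = (fun p : R^o * R^o => 'D_p.2 (derive1n m f : R^o -> F) p.1) \o (fun t => (t, 1))).
  have oUT : open ((U : set R^o) `*` [set: R^o]) by exact: openX_setT.
  apply: (Ck_comp oU oUT _ _ C1) => [//|].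
  by apply: Ck_pair; [exact: Ck_id|exact: Ck_cst].
by apply/funext => t; rewrite derive1nS derive1E.
Qed.

(** Links the iterated ordinary derivatives, through which [circle_smooth] is defined, with the
    calculus of [Ck]. *)
Lemma Cinfty_derive1n F (U : set R) (f : R -> F) : open (U : set R^o) ->
  (forall k t, U t -> derivable (derive1n k f) t 1) <-> Cinfty (U : set R^o) (f : R^o -> F).
Proof.
move=> oU; split=> [df k|Cf].
  suff : forall m, Ck k U (derive1n m f : R^o -> F) by move/(_ 0%N).
  elim: k => [|k ih] m.
    by split=> // t Ut; apply/differentiable_continuous/derivable1_diffP/df.
  split=> [t Ut|]; first by apply/differentiable_continuous/derivable1_diffP/df.
  exists (fun p => p.2 *: derive1n m.+1 f p.1); split.
    move=> t v Ut /=; have c := dquot_scale (c := v) (derivable_dquot (df m t Ut)).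
    have e : v *: (1 : R) = v := mulr1 v.
    by rewrite e in c; rewrite derive1E; exact: c.
  have oUT : open ((U : set R^o) `*` [set: R^o]) by exact: openX_setT.
  apply: Ck_scale => //; first exact: Ck_snd.
  rewrite -[X in Ck _ _ X]/((derive1n m.+1 f : R^o -> F) \o fst).
  by apply: (Ck_comp oUT oU _ _ (ih m.+1)) => [[] ? ? []//|]; exact: Ck_fst.
move=> k t Ut; have /(CkS _ _ oU)[_ + _] := Cinfty_iter_derive1 k oU Cf 1%N; exact.
Qed.

End CkBasics.
Arguments Ck1_derivable {R E F U f x} v.

(** * The inverse function theorem in R^n *)

Section FiniteDimensionalCalculus.
Variable R : realType.
Implicit Types E F : normedModType R.

Lemma cvg_pair_cst E F (z : E) (v : F) : (x, v) @[x --> z] --> (z, v).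
Proof. by apply: cvg_pair; [exact: cvg_id|exact: cvg_cst]. Qed.

Lemma lipschitz_within_continuous E F (B : set E) (f : E -> F) (c : R) x : open B ->
  0 < c -> (forall y y', B y -> B y' -> `|f y - f y'| <= c * `|y - y'|) -> B x ->
  {for x, continuous f}.
Proof.
move=> oB c0 lip Bx; apply/cvgrPdist_lt => r r0.
have : \forall y \near x, B y by exact: open_nbhs_nbhs.
have : \forall y \near x, `|x - y| < r / c.
  by apply: cvgr_dist_lt; [exact: cvg_id|rewrite divr_gt0].
apply: filterS2 => y yr By; rewrite (le_lt_trans (lip _ _ Bx By))//.
by rewrite mulrC -ltr_pdivlMr.
Qed.

Lemma rV_coord_norm n (v : 'rV[R]_n) i : `|v 0 i| <= `|v|.
Proof.
rewrite [leRHS]mx_normrE.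
by apply: (le_bigmax 0 (fun ij : 'I_1 * 'I_n => `|v ij.1 ij.2|) (0, i)).
Qed.

Lemma rV_linear_sum n F (f : 'rV[R]_n -> F) : linear f ->
  forall v, f v = \sum_i v 0 i *: f (delta_mx 0 i).
Proof.
move=> lf v; pose g : {linear 'rV[R]_n -> F} := HB.pack f (GRing.isLinear.Build _ _ _ _ f lf).
by rewrite -[LHS]/(g v) {1}[v]row_sum_delta linear_sum; apply: eq_bigr => i _; rewrite linearZ.
Qed.

Lemma Ck_sum k E F (I : Type) (r : seq I) (U : set E) (f : I -> E -> F) : open U ->
  (forall i, Ck k U (f i)) -> Ck k U (fun x => \sum_(i <- r) f i x).
Proof.
move=> oU Cf; elim: r => [|i r ih].
  by apply: Ck_eq (Ck_cst k U 0) => // x _; rewrite big_nil.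
by apply: Ck_eq (Ck_add oU (Cf i) ih) => // x _; rewrite big_cons.
Qed.

Lemma Ck_prod k E (I : Type) (r : seq I) (U : set E) (f : I -> E -> R^o) : open U ->
  (forall i, Ck k U (f i)) -> Ck k U (fun x => \prod_(i <- r) f i x : R^o).
Proof.
move=> oU Cf; elim: r => [|i r ih].
  by apply: Ck_eq (Ck_cst k U (1 : R^o)) => // x _; rewrite big_nil.
by apply: Ck_eq (Ck_scale oU (Cf i) ih) => // x _; rewrite big_cons.
Qed.

Lemma Ck_coord k n (U : set 'rV[R]_n) (i : 'I_n) : Ck k U (fun v : 'rV[R]_n => v 0 i : R^o).
Proof.
apply: Ck_linear => [a u v|v]; first by rewrite !mxE.
exact: coord_continuous.
Qed.

Lemma rV_linear_continuous n F (f : 'rV[R]_n -> F) : linear f -> continuous f.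
Proof.
move=> lf; suff C : Ck 0 setT f by move=> v; exact: (Ck_continuous C).
have C : Ck 0 setT (fun v : 'rV[R]_n => \sum_i v 0 i *: f (delta_mx 0 i)).
  apply: Ck_sum; first exact: openT.
  by move=> i; apply: Ck_scale; [exact: openT|exact: Ck_coord|exact: Ck_cst].
by rewrite (_ : f = (fun v => \sum_i v 0 i *: f (delta_mx 0 i)))//; apply/funext => v; exact: rV_linear_sum.
Qed.

Lemma Ck_coord_comp k n E (U : set E) (f : E -> 'rV[R]_n) (i : 'I_n) : open U ->
  Ck k U f -> Ck k U (fun x => f x 0 i : R^o).
Proof.
move=> oU Cf; rewrite -[X in Ck _ _ X]/((fun v : 'rV[R]_n => v 0 i : R^o) \o f).
by apply: (@Ck_comp _ _ _ _ _ _ setT) => //; [exact: openT|exact: Ck_coord].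
Qed.

Lemma Ck_row k n E (U : set E) (f : E -> 'rV[R]_n) : open U ->
  (forall i, Ck k U (fun x => f x 0 i : R^o)) -> Ck k U f.
Proof.
move=> oU Cf; apply: (@Ck_eq _ _ _ _ _ (fun x => \sum_i f x 0 i *: delta_mx 0 i)) => //.
  by move=> x _; rewrite -row_sum_delta.
by apply: Ck_sum => // i; apply: Ck_scale => //; exact: Ck_cst.
Qed.

Lemma Ck_det k n E (U : set E) (M : E -> 'M[R]_n) : open U ->
  (forall i j, Ck k U (fun x => M x i j : R^o)) -> Ck k U (fun x => \det (M x) : R^o).
Proof.
move=> oU CM; rewrite /determinant; apply: Ck_sum => // s.
by apply: Ck_scale => //; [exact: Ck_cst|apply: Ck_prod].
Qed.

Lemma Ck_invmx k n E (U : set E) (M : E -> 'M[R]_n) : open U ->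
  (forall x, U x -> M x \in unitmx) ->
  (forall i j, Ck k U (fun x => M x i j : R^o)) ->
  forall i j, Ck k U (fun x => invmx (M x) i j : R^o).
Proof.
move=> oU uM CM i j.
apply: (@Ck_eq _ _ _ _ _ (fun x => (\det (M x))^-1 *: (cofactor (M x) j i : R^o))) => //.
  by move=> x Ux; rewrite /invmx uM// !mxE.
have oN : open [set x : R^o | x != 0] by exact: open_neq0.
apply: Ck_scale => //.
  rewrite -[X in Ck _ _ X]/((fun x : R^o => x^-1 : R^o) \o (fun x => \det (M x))).
  refine (@Ck_comp R k E R^o R^o U _ (fun x => \det (M x)) (fun x => x^-1) oU oN _ _ (@Ck_inv R k)); last exact: Ck_det.
  by move=> x /uM; rewrite unitmxE unitfE.
rewrite /cofactor; apply: Ck_scale => //; first exact: Ck_cst.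
apply: Ck_det => // a b; apply: Ck_eq (CM (lift j a) (lift i b)) => // x _.
by rewrite !mxE.
Qed.

Lemma derive_close n F (U : set 'rV[R]_n) (f : 'rV[R]_n -> F) z (e : R) :
  open U -> Ck 1 U f -> U z -> 0 < e ->
  exists2 d : R, 0 < d & forall x, `|x - z| < d ->
    U x /\ forall v, `|'D_v f x - 'D_v f z| <= e * `|v|.
Proof.
move=> oU Cf Uz e0.
(* The n partial derivatives contribute at most [e'] |v| each; n + 1 in the denominator covers n =
   0. *)
pose e' := e / n.+1%:R.
have e'0 : 0 < e' by rewrite divr_gt0.
have : \forall x \near z, U x /\ forall i, `|'D_(delta_mx 0 i) f x - 'D_(delta_mx 0 i) f z| < e'.
  have nU : \forall x \near z, U x by exact: open_nbhs_nbhs.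
  have nD : \forall x \near z, forall i : 'I_n, `|'D_(delta_mx 0 i) f x - 'D_(delta_mx 0 i) f z| < e'.
    have H (i : 'I_n) : \forall x \near z, `|'D_(delta_mx 0 i) f x - 'D_(delta_mx 0 i) f z| < e'.
      have c1 : (fun x => 'D_(delta_mx 0 i) f x) @ z --> 'D_(delta_mx 0 i) f z.
        have c2 : (x, delta_mx 0 i) @[x --> z] --> (z, delta_mx 0 i : 'rV[R]_n).
          exact: cvg_pair_cst.
        exact: (cvg_comp _ _ c2 (@Ck1_continuous _ _ _ _ _ z (delta_mx 0 i) oU Cf Uz)).
      by have /cvgrPdist_lt/(_ _ e'0) := c1; apply: filterS => x; rewrite distrC.
    exact: (@filter_forall _ _ _ _ (nbhs_filter z) H).
  by apply: filterS2 nU nD => x Ux Dx; split.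
move=> /nbhs_ballP[d /= d0 hd]; exists d => // x xz.
have [Ux Dx] : U x /\ forall i, `|'D_(delta_mx 0 i) f x - 'D_(delta_mx 0 i) f z| < e'.
  by apply: hd; rewrite -ball_normE /= distrC.
split=> // v; rewrite (rV_linear_sum (Ck1_linear oU Cf Ux)) (rV_linear_sum (Ck1_linear oU Cf Uz)).
rewrite -sumrB (le_trans (ler_norm_sum _ _ _))//.
rewrite (@le_trans _ _ (\sum_(i < n) `|v| * e'))//.
  apply: ler_sum => i _; rewrite -scalerBr normrZ ler_pM// ?rV_coord_norm//.
  exact/ltW/Dx.
rewrite sumr_const card_ord -mulr_natr -mulrA [leRHS]mulrC ler_wpM2l//.
by rewrite /e' -mulrA ler_piMr ?ltW// mulrC ltr_pdivrMr// mul1r ltr_nat.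
Qed.

Lemma Ck1_strict n F (U : set 'rV[R]_n) (f : 'rV[R]_n -> F) z (e : R) :
  open U -> Ck 1 U f -> U z -> 0 < e ->
  exists2 d : R, 0 < d & forall x y, `|x - z| < d -> `|y - z| < d ->
    `|f x - f y - 'D_(x - y) f z| <= e * `|x - y|.
Proof.
move=> oU Cf Uz e0; have e20 : 0 < e / 2 by rewrite divr_gt0.
have [d d0 hd] := derive_close oU Cf Uz e20; exists d => // x y xz yz.
have [->|xy] := eqVneq x y.
  rewrite !subrr normr0 mulr0 (_ : 'D_0 f z = 0) ?subr0 ?normr0//.
  by have := Ck1_linear oU Cf Uz (-1) 0 0; rewrite /= scaler0 addr0 scaleN1r addNr.
have nxy : 0 < `|x - y| by rewrite normr_gt0 subr_eq0.
pose phi (t : R) := f (t *: (x - y) + y) - t *: 'D_(x - y) f z.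
have seg (t : R) : 0 <= t <= 1 -> `|t *: (x - y) + y - z| < d.
  move=> /andP[t0 t1].
  have -> : t *: (x - y) + y - z = t *: (x - z) + (1 - t) *: (y - z).
    by rewrite !scalerBr !scalerBl !scale1r; apply/matrixP => i j; rewrite !mxE; ring.
  have [->|t1'] := eqVneq t 1; first by rewrite subrr scale1r scale0r addr0.
  rewrite (le_lt_trans (ler_normD _ _))// !normrZ ger0_norm// ger0_norm ?subr_ge0//.
  have -> : d = t * d + (1 - t) * d by rewrite -mulrDl addrC subrK mul1r.
  apply: ler_ltD; first exact: (ler_wpM2l t0 (ltW xz)).
  by rewrite ltr_pM2l// subr_gt0 lt_neqAle t1'.
have := @mean_value_le R F phi (fun t => 'D_(x - y) f (t *: (x - y) + y) - 'D_(x - y) f z) (e * `|x - y|).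
move=> /(_ _ _)/wrap[t t01|t t01|].
- have [Ut _] := hd _ (seg t t01).
  have /(CkS _ _ oU)[_ df _] := Cf.
  apply: is_derive_dquot.
  apply: cvg_trans (cvgB (derivable_dquot (df _ (x - y) Ut)) (cvg_cst ('D_(x - y) f z))).
  apply: near_eq_cvg; near=> s; rewrite /phi.
  rewrite -[LHS]/(s^-1 *: (f (s *: (x - y) + (t *: (x - y) + y)) - f (t *: (x - y) + y)) - 'D_(x - y) f z).
  have zE (a b c w : F) : a - (c + w) - (b - w) = a - b - c.
    by rewrite opprD opprB !addrA subrK addrAC.
  rewrite [(s + t) *: 'D__ _ _]scalerDl zE [(s + t) *: (x - y)]scalerDl -(addrA (s *: (x - y))).
  rewrite [RHS]scalerBr [s^-1 *: (s *: _)]scalerA mulVf ?scale1r//.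
  by near: s; exact: nbhs_dnbhs_neq.
- have [_ /(_ (x - y)) le] := hd _ (seg t t01).
  by rewrite (le_lt_trans le)// ltr_pM2r// ltr_pdivrMr// mulr2n mulrDr mulr1 ltrDl.
- by rewrite /phi !scale1r scale0r add0r subrK scale0r subr0 addrAC.
Unshelve. all: by end_near. Qed.

(** Preimages are found by minimizing |f z - y| over a compact ball: if z is a minimizer, adding the
    residual y - f z to it would at least halve the distance, so the residual is 0. *)
Lemma local_inverse n (U : set 'rV[R]_n) (f : 'rV[R]_n -> 'rV[R]_n) :
  open U -> Cinfty U f -> U 0 -> (forall v, 'D_v f 0 = v) ->
  exists2 e : R, 0 < e & exists b : 'rV[R]_n -> 'rV[R]_n,
    [/\ b (f 0) = 0, forall y, `|y - f 0| < e -> U (b y) /\ f (b y) = y &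
        Cinfty [set y | `|y - f 0| < e] b].
Proof.
move=> oU Cf U0 df0; have half0 : 0 < 2^-1 :> R by rewrite invr_gt0.
have [d1 d10 hd1] := derive_close oU (Cf 1%N) U0 half0.
have [d2 d20 hd2] := Ck1_strict oU (Cf 1%N) U0 half0.
pose d := Num.min d1 d2; have d0 : 0 < d by rewrite lt_min d10.
have strict x y : `|x| < d -> `|y| < d -> `|f x - f y - (x - y)| <= 2^-1 * `|x - y|.
  rewrite !lt_min => /andP[_ xd] /andP[_ yd].
  by have := hd2 x y; rewrite df0 !subr0; apply.
have lip x y : `|x| < d -> `|y| < d -> `|x - y| <= 2 * `|f x - f y|.
  move=> xd yd; have := strict x y xd yd.
  have : `|x - y| <= `|f x - f y| + `|f x - f y - (x - y)|.
    by rewrite -[X in `|X| <= _](subKr (f x - f y)) ler_normB.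
  by lra.
have Ud x : `|x| < d -> U x.
  by rewrite lt_min => /andP[xd _]; have [] := hd1 x; rewrite ?subr0.
have inj x v : `|x| < d -> 'D_v f x = 0 -> v = 0.
  rewrite lt_min => /andP[xd _] Dv0; 
  have [|_ /(_ v)] := hd1 x; first by rewrite subr0.
  rewrite Dv0 df0 sub0r normrN => vv; apply/eqP; rewrite -normr_eq0.
  by have := normr_ge0 v; rewrite le_eqVlt => /predU1P[<-//|v0]; exfalso; lra.
(* A minimizer has residual below [e], hence norm at most 2 (2 e) = d / 4, and the corrected point
   still lies in the ball of radius d / 2. *)
pose e := d / 16; have e0 : 0 < e by rewrite divr_gt0.
have ex y : exists z, `|y - f 0| < e -> `|z| < d /\ f z = y.
  have [ye|ye] := boolP (`|y - f 0| < e); last by exists 0.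
  pose A := [set z : 'rV[R]_n | `|z| <= d / 2].
  have A0 : A !=set0 by exists 0; rewrite /A/= normr0 divr_ge0// ltW.
  have dd : d / 2 < d by rewrite ltr_pdivrMr// mulr2n mulrDr mulr1 ltrDl.
  have cA : compact A.
    apply: bounded_closed_compact.
      by exists (d / 2); split=> [|x xd z /= zd]; [exact: num_real|exact: le_trans (ltW xd)].
    apply: (@closed_comp _ _ (fun z : 'rV[R]_n => `|z|) [set x | x <= d / 2]).
      by move=> z _; exact: norm_continuous.
    exact: closed_le.
  have [|z] := @EVT_min_rV _ _ (fun z => `|f z - y|) A A0 cA.
    apply: continuous_in_subspaceT => z; rewrite inE => zA.
    apply: continuous_comp; last exact: norm_continuous.
    have c : {for z, continuous f}.
      by apply: (Ck_continuous (Cf 0%N)); apply: Ud; exact: le_lt_trans dd.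
    exact: (cvgB c (cvg_cst y)).
  rewrite inE /A/= => zd minz; exists z => _.
  have zd' : `|z| < d by exact: le_lt_trans dd.
  split=> //.
  have z0 : `|f z - y| < e.
    by rewrite (le_lt_trans (minz 0 _))// ?inE/= ?normr0 ?divr_ge0 ?ltW// distrC.
  have zs : `|z| <= d / 4.
    have := lip z 0 zd'; rewrite normr0 subr0 => /(_ d0).
    have : `|f z - f 0| <= `|f z - y| + `|y - f 0|.
      by rewrite -{1}(subrK y (f z)) -addrA ler_normD.
    by rewrite /e in z0 ye *; lra.
  pose w := z + (y - f z).
  have wd : `|w| <= d / 2.
    have := ler_normD z (y - f z); rewrite -/w distrC; rewrite distrC in z0 *.
    by rewrite /e in z0; lra.
  have := minz w; rewrite inE /A/= => /(_ wd) min.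
  have wd' : `|w| < d by exact: le_lt_trans dd.
  have := strict w z wd' zd'.
  have -> : w - z = y - f z by rewrite /w addrC addKr.
  have -> : f w - f z - (y - f z) = f w - y by rewrite opprB addrA subrK.
  rewrite [`|y - _|]distrC => st; apply/eqP; rewrite -subr_eq0 -normr_eq0.
  by have := normr_ge0 (f z - y); rewrite le_eqVlt => /predU1P[<-//|p]; exfalso; lra.
have [b hb] := choice ex.
exists e => //; exists b.
pose B := [set y : 'rV[R]_n | `|y - f 0| < e].
have oB : open B.
  rewrite (_ : B = ball (f 0) e); first exact: ball_open.
  by apply/seteqP; split=> y; rewrite /B -ball_normE/= distrC.
have b0 : b (f 0) = 0.
  have [|bd fb] := hb (f 0); first by rewrite subrr normr0.
  have := lip (b (f 0)) 0 bd; rewrite normr0 => /(_ d0).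
  by rewrite fb subrr normr0 mulr0 subr0 normr_le0 => /eqP.
have blip y y' : B y -> B y' -> `|b y - b y'| <= 2 * `|y - y'|.
  move=> /hb[bd fb] /hb[bd' fb']; rewrite -{2}fb -{2}fb'; exact: lip.
split=> //; first by move=> y /hb[bd fb]; split=> //; exact: Ud.
pose J z : 'M[R]_n := \matrix_(i, j) 'D_(delta_mx 0 i) f z 0 j.
have JE z v : U z -> v *m J z = 'D_v f z.
  move=> Uz; rewrite (rV_linear_sum (Ck1_linear oU (Cf 1%N) Uz) v) mulmx_sum_row.
  by apply: eq_bigr => i _; congr (_ *: _); apply/rowP => j; rewrite !mxE.
have uJ z : `|z| < d -> J z \in unitmx.
  move=> zd; rewrite -row_free_unit -kermx_eq0; apply/eqP/row_matrixP => i.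
  rewrite row0; apply: (inj z _ zd); rewrite -JE; last exact: Ud.
  by rewrite -row_mul mulmx_ker row0.
have cb y : B y -> {for y, continuous b}.
  by move=> By; apply: (lipschitz_within_continuous oB _ blip By).
have db y v : B y -> h^-1 *: (b (h *: v + y) - b y) @[h --> (0 : R)^'] --> v *m invmx (J (b y)).
  move=> By; have [bd fb] := hb y By; have Uby := Ud _ bd.
  suff c : (h^-1 *: (b (h *: v + y) - b y)) *m J (b y) @[h --> (0 : R)^'] --> v.
    have cl : continuous (fun w : 'rV[R]_n => w *m invmx (J (b y))).
      by apply: rV_linear_continuous => a u w; rewrite mulmxDl scalemxAl.
    apply: cvg_trans (cvg_comp _ _ c (cl v)); apply: near_eq_cvg.
    by apply: nearW => h /=; rewrite mulmxK ?uJ.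
  apply/cvgrPdist_le => r r0; pose r' := r / (2 * (`|v| + 1)).
  have v1 : 0 < 2 * (`|v| + 1) by rewrite mulr_gt0// ltr_wpDl.
  have r'0 : 0 < r' by rewrite divr_gt0.
  have [s s0 hs] := Ck1_strict oU (Cf 1%N) Uby r'0.
  have nB : \forall h \near (0 : R)^', B (h *: v + y).
    exact: (@dnbhs_shift _ _ y v _ (open_nbhs_nbhs (conj oB By))).
  have ns : \forall h \near (0 : R)^', `|b y - b (h *: v + y)| < s.
    have cc := cvg_comp _ _ (@dnbhs_shift _ _ y v) (cb y By).
    by have /cvgrPdist_lt/(_ _ s0) := cc.
  near=> h.
  have h0 : h != 0 by near: h; exact: nbhs_dnbhs_neq.
  have Bh : B (h *: v + y) by near: h.
  have [bhd fbh] := hb _ Bh.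
  have := hs (b (h *: v + y)) (b y); rewrite subrr normr0 distrC => /(_ _ s0)/wrap[].
    by near: h.
  rewrite fb fbh addrK => st.
  rewrite JE// -[v in v - _]scale1r -(mulVf h0) -scalerA.
  have Dl : linear (fun v => 'D_v f (b y)) := Ck1_linear oU (Cf 1%N) Uby.
  have -> : 'D_(h^-1 *: (b (h *: v + y) - b y)) f (b y) = h^-1 *: 'D_(b (h *: v + y) - b y) f (b y).
    have D0 : 'D_0 f (b y) = 0 by have := Dl (-1) 0 0; rewrite /= scaler0 addr0 scaleN1r addNr.
    by have := Dl h^-1 (b (h *: v + y) - b y) 0; rewrite /= addr0 D0 addr0.
  rewrite -scalerBr normrZ normfV.
  have hp : 0 < `|h| by rewrite normr_gt0.
  rewrite ler_pdivrMl// (le_trans st)//.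
  rewrite (@le_trans _ _ (r' * (2 * `|h *: v|)))//.
    apply: ler_wpM2l; first exact: ltW.
    by have := blip _ _ Bh By; rewrite addrK distrC.
  rewrite normrZ (_ : r' * (2 * (`|h| * `|v|)) = `|h| * (r' * (2 * `|v|))); last by ring.
  rewrite ler_wpM2l// /r' mulrAC ler_pdivrMr//; apply: ler_wpM2l; first exact: ltW.
  by rewrite ler_wpM2l// lerDl.
elim=> [|k ih]; first by split=> // y; exact: cb.
split; first by move=> y; exact: cb.
(* The derivative of [b] is a smooth expression in [b] itself, so each order of differentiability
   yields the next one. *)
exists (fun p => p.2 *m invmx (J (b p.1))); split; first by move=> y v; exact: db.
have oBT : open (B `*` [set: 'rV[R]_n]) by exact: openX_setT.
have Cb1 : Ck k (B `*` [set: 'rV[R]_n]) (fun p => b p.1).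
  rewrite -[X in Ck _ _ X]/(b \o fst).
  by apply: (Ck_comp oBT oB _ _ ih); [move=> p []|exact: Ck_fst].
apply: Ck_row => // j.
rewrite (_ : (fun p => _) = (fun p : 'rV[R]_n * 'rV[R]_n =>
    \sum_i (p.2 0 i : R^o) *: (invmx (J (b p.1)) i j : R^o))); last first.
  by apply/funext => p; rewrite !mxE.
apply: Ck_sum => // i; apply: Ck_scale => //.
  by apply: Ck_coord_comp => //; exact: Ck_snd.
apply: Ck_invmx => // [p [/hb[bd _] _]|a c]; first exact: uJ.
rewrite (_ : (fun p => _) = (fun p : 'rV[R]_n * 'rV[R]_n =>
    'D_(delta_mx 0 a) f (b p.1) 0 c : R^o)); last by apply/funext => p; rewrite mxE.
have /(CkS _ _ oU)[_ _ CD] := Cf k.+1.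
apply: Ck_coord_comp => //.
rewrite -[X in Ck _ _ X]/((fun p => 'D_p.2 f p.1) \o (fun p : 'rV[R]_n * 'rV[R]_n => (b p.1, delta_mx 0 a))).
apply: (Ck_comp oBT _ _ _ CD); first exact: openX_setT.
  by move=> p [/hb[bd _] _]; split=> //; exact: Ud.
by apply: Ck_pair => //; exact: Ck_cst.
Unshelve. all: by end_near. Qed.

End FiniteDimensionalCalculus.

(** * Smooth maps into manifolds and Lie groups *)

Lemma open_nearP (T : topologicalType) (U : set T) :
  open U <-> forall x, U x -> \forall y \near x, U y.
Proof. by rewrite openE; split=> oU x Ux; exact: oU. Qed.

Lemma open_setX (S T : topologicalType) (U : set S) (W : set T) :
  open U -> open W -> open (U `*` W).
Proof.
move=> oU oW; apply/open_nearP => -[x y] [/= Ux Wy].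
by exists (U, W) => //=; split; exact: open_nbhs_nbhs.
Qed.

Lemma open_preimage_within (S T : topologicalType) (U : set S) (W : set T) (f : S -> T) :
  open U -> (forall x, U x -> {for x, continuous f}) -> open W ->
  open (U `&` f @^-1` W).
Proof.
move=> oU cf oW; apply/open_nearP => x [Ux Wx].
have nW : \forall y \near x, W (f y) by apply: (cf x Ux); exact: open_nbhs_nbhs.
by apply: filterS2 (open_nbhs_nbhs (conj oU Ux)) nW => y.
Qed.

Section SmoothIntoManifold.
Variables (R : realType) (F : normedModType R) (M : choiceType) (A : atlas F M).
Hypothesis mA : is_manifold A.
Implicit Types (c d : chart F M) (E : normedModType R).

Lemma chart_coordK c x : A c -> chart_dom c x -> chart_coord c (c x) = x.
Proof. by move=> Ac cx; rewrite /chart_coord pinvKV ?inE//; exact: (chart_inj mA). Qed.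

Lemma chart_coordP c p : A c -> chart_cod c p ->
  chart_dom c (chart_coord c p) /\ c (chart_coord c p) = p.
Proof. by move=> Ac [x cx <-]; rewrite chart_coordK. Qed.

Lemma chart_cod_open c : A c -> open (chart_cod c : set (mfd A)).
Proof.
move=> Ac; rewrite open_mfdE => d Ad x dx cdx.
have := chart_overlap mA Ad Ac; rewrite openE => /(_ x (conj dx cdx)).
by apply: filterS => y [].
Qed.

Lemma chart_image_open c (O : set F) : A c -> open O -> O `<=` chart_dom c ->
  open (c @` O : set (mfd A)).
Proof.
move=> Ac oO Oc; rewrite open_mfdE => d Ad x dx [y Oy cy].
have oW := chart_overlap mA Ad Ac.
have Wx : (chart_dom d `&` d @^-1` chart_cod c) x.
  by split=> //; exists y => //; exact: Oc.
have ct := Ck_continuous (chart_transition mA Ad Ac 0%N) Wx.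
have nO : \forall z \near x, O (chart_coord c (d z)).
  apply: ct; apply: open_nbhs_nbhs; split=> //=.
  by rewrite -cy chart_coordK//; exact: Oc.
have nW : \forall z \near x, (chart_dom d `&` d @^-1` chart_cod c) z.
  exact: open_nbhs_nbhs.
apply: filterS2 nW nO => z [dz cdz] Oz _; exists (chart_coord c (d z)) => //.
by have [] := chart_coordP Ac cdz.
Qed.

Lemma chart_continuous c x : A c -> chart_dom c x -> {for x, continuous (c : F -> mfd A)}.
Proof.
move=> Ac cx; rewrite /prop_for /continuous_at => W; rewrite nbhsE => -[P [oP Pcx] PW].
have := oP; rewrite open_mfdE => /(_ c Ac x cx Pcx) nP.
have nc : \forall y \near x, chart_dom c y.
  by apply: open_nbhs_nbhs; split=> //; exact: (chart_open mA).
by apply: filterS2 nP nc => y Py cy; apply: PW; exact: Py.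
Qed.

(** The counterpart of [smooth_on] for a source that is a normed space, which spares the trivial
    atlas on the source. *)
Definition smooth_to E (U : set E) (f : E -> M) : Prop :=
  (forall x, U x -> {for x, continuous (f : E -> mfd A)}) /\
  forall d, A d -> Cinfty (U `&` [set x | chart_cod d (f x)]) (chart_coord d \o f).

Lemma smooth_to_preimage E (U : set E) (f : E -> M) (W : set (mfd A)) :
  open U -> smooth_to U f -> open W -> open (U `&` [set x | W (f x)]).
Proof.
by move=> oU [cf _] oW; exact: (@open_preimage_within _ (mfd A)).
Qed.

(** One chart around each value is enough: the transition maps carry smoothness to every other
    chart, and continuity follows because parametrizations are continuous. *)
Lemma smooth_to_chartwise E (U : set E) (f : E -> M) : open U ->
  (forall x, U x -> exists c W, [/\ A c, open W, W x,
    (forall y, W y -> chart_cod c (f y)) & Cinfty W (chart_coord c \o f)]) ->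
  smooth_to U f.
Proof.
move=> oU loc.
have cf x : U x -> {for x, continuous (f : E -> mfd A)}.
  move=> /loc[c [W [Ac oW Wx Wc Cf]]].
  have [dx ex] := chart_coordP Ac (Wc x Wx).
  apply: (@continuous_near_eq _ _ ((c : F -> mfd A) \o (chart_coord c \o f))).
    apply: filterS (open_nbhs_nbhs (conj oW Wx)) => y /Wc cfy /=.
    by have [] := chart_coordP Ac cfy.
  apply: continuous_comp; first exact: (Ck_continuous (Cf 0%N)).
  exact: chart_continuous.
split=> // d Ad k.
have oUd : open (U `&` [set x | chart_cod d (f x)]).
  exact: (@open_preimage_within _ (mfd A) _ _ _ oU cf (chart_cod_open Ad)).
apply: Ck_local => // x [Ux dfx]; have [c [W [Ac oW Wx Wc Cf]]] := loc x Ux.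
exists (W `&` (U `&` [set x | chart_cod d (f x)])).
have oW' : open (W `&` (U `&` [set x | chart_cod d (f x)])) by exact: openI.
split=> //.
apply: (@Ck_eq _ _ _ _ _ ((chart_coord d \o c) \o (chart_coord c \o f))) => //.
  by move=> y [Wy _] /=; have [_ ->] := chart_coordP Ac (Wc y Wy).
apply: (Ck_comp oW' _ _ _ (chart_transition mA Ac Ad k)); first exact: (chart_overlap mA).
  move=> y [Wy [Uy dy]] /=; have [cy ey] := chart_coordP Ac (Wc y Wy).
  by split=> //=; rewrite ey.
by apply: Ck_sub (Cf k) => y [].
Qed.

Lemma smooth_to_chart c : A c -> smooth_to (chart_dom c) c.
Proof.
move=> Ac; apply: smooth_to_chartwise; first exact: (chart_open mA).
move=> x cx; exists c, (chart_dom c); split=> //; first exact: (chart_open mA).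
  by move=> y cy; exists y.
move=> k; apply: Ck_eq (Ck_id k (chart_dom c)); first exact: (chart_open mA).
by move=> y cy /=; rewrite chart_coordK.
Qed.

Lemma smooth_to_cst E (U : set E) (p : M) : smooth_to U (fun=> p).
Proof.
split=> [x _|d Ad k]; first exact: cvg_cst.
exact: Ck_cst.
Qed.

Lemma smooth_to_sub E (U W : set E) (f : E -> M) : W `<=` U -> smooth_to U f -> smooth_to W f.
Proof.
move=> WU [cf Cf]; split=> [x /WU|d Ad k]; first exact: cf.
by apply: Ck_sub (Cf d Ad k) => x [/WU Ux dx].
Qed.

Lemma smooth_to_Cinfty E (U : set E) (f : E -> M) c : A c -> smooth_to U f ->
  (forall x, U x -> chart_cod c (f x)) -> Cinfty U (chart_coord c \o f).
Proof. by move=> Ac [_ Cf] Uc k; apply: Ck_sub (Cf c Ac k) => x Ux; split=> //; exact: Uc. Qed.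

Lemma smooth_to_local E (U : set E) (f : E -> M) : open U ->
  (forall x, U x -> exists W, [/\ open W, W x & smooth_to W f]) -> smooth_to U f.
Proof.
move=> oU loc; apply: smooth_to_chartwise => // x /loc[W [oW Wx sf]].
have [c Ac cfx] := chart_cover mA (f x).
exists c, (W `&` [set y | chart_cod c (f y)]); split=> //.
- by apply: smooth_to_preimage => //; exact: chart_cod_open.
- by move=> y [].
- by case: sf => _; apply.
Qed.

Lemma smooth_to_eq E (U : set E) (f g : E -> M) : open U ->
  (forall x, U x -> f x = g x) -> smooth_to U f -> smooth_to U g.
Proof.
move=> oU fg sf; apply: smooth_to_chartwise => // x Ux.
have [c Ac cfx] := chart_cover mA (f x).
have oW := smooth_to_preimage oU sf (chart_cod_open Ac).
exists c, (U `&` [set y | chart_cod c (f y)]); split=> //.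
  by move=> y [Uy]; rewrite /= fg.
case: sf => _ Cf k; apply: Ck_eq (Cf c Ac k) => // y [Uy _] /=.
by rewrite fg.
Qed.

Lemma smooth_to_comp E E' (U : set E) (W : set E') (f : E -> E') (g : E' -> M) :
  open U -> open W -> (forall x, U x -> W (f x)) -> Cinfty U f -> smooth_to W g ->
  smooth_to U (g \o f).
Proof.
move=> oU oW UW Cf sg; apply: smooth_to_chartwise => // x Ux.
have [c Ac cgx] := chart_cover mA (g (f x)).
have oWc := smooth_to_preimage oW sg (chart_cod_open Ac).
have oUc : open (U `&` f @^-1` (W `&` [set y | chart_cod c (g y)])).
  by apply: open_preimage_within => // z Uz; exact: Ck_continuous (Cf 0%N) Uz.
exists c, (U `&` f @^-1` (W `&` [set y | chart_cod c (g y)])); split=> //.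
- by split=> //; split=> //; exact: UW.
- by move=> y [_ []].
- move=> k; case: sg => _ Cg.
  rewrite -[X in Ck _ _ X]/((chart_coord c \o g) \o f).
  apply: (Ck_comp oUc oWc _ _ (Cg c Ac k)); first by move=> y [].
  by apply: Ck_sub (Cf k) => y [].
Qed.

End SmoothIntoManifold.
Arguments smooth_to {R F M} A {E} U f.

Section SmoothIntoLieGroup.
Variables (R : realType) (n : nat) (G : lieGroup 'rV[R]_n).
Let A := lie_atlas G.
Let mA : is_manifold A := lie_manifold G.
Implicit Types (E : normedModType R).

Lemma smooth_to_mul E (U : set E) (f g : E -> G) : open U ->
  smooth_to A U f -> smooth_to A U g -> smooth_to A U (fun x => f x * g x)%g.
Proof.
move=> oU sf sg; apply: (smooth_to_chartwise mA) => // x Ux.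
have [c Ac cfx] := chart_cover mA (f x).
have [d Ad dgx] := chart_cover mA (g x).
have [e Ae efg] := chart_cover mA (f x * g x)%g.
have [cm Cm] := lie_mul_smooth G.
pose mul := fun p : G * G => (p.1 * p.2)%g.
have Pcd : prod_atlas A A (prod_chart c d) by exists c => //; exists d.
pose S := [set z : 'rV[R]_n * 'rV[R]_n | [/\ chart_dom (prod_chart c d) z,
  setT (prod_chart c d z) & chart_cod e (mul (prod_chart c d z))]].
have oS : open S.
  rewrite openE => z [[cz dz] _ ez].
  have oe : open ([set p : mfd (prod_atlas A A) | chart_cod e (mul p)]).
    rewrite openE => p ep; apply: (cm p I).
    by apply: open_nbhs_nbhs; split=> //; exact: (chart_cod_open mA).
  move: oe; rewrite open_mfdE => /(_ _ Pcd z (conj cz dz) ez) ne.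
  have nc : \forall y \near z, chart_dom c y.1 /\ chart_dom d y.2.
    exists (chart_dom c, chart_dom d) => //=; split; apply: open_nbhs_nbhs; split=> //.
      exact: (chart_open mA).
    exact: (chart_open mA).
  apply: filterS2 nc ne => y [cy dy] ey; split=> //.
  by apply: ey; split.
have of_ := smooth_to_preimage oU sf (chart_cod_open mA Ac).
have og := smooth_to_preimage oU sg (chart_cod_open mA Ad).
pose W := (U `&` [set x | chart_cod c (f x)]) `&` (U `&` [set x | chart_cod d (g x)]).
have oW : open W by exact: openI.
pose h y := (chart_coord c (f y), chart_coord d (g y)).
have Ch : Cinfty W h.
  move=> k; apply: Ck_pair.
    by case: sf => _ Cf; apply: Ck_sub (Cf c Ac k) => y [].
  by case: sg => _ Cg; apply: Ck_sub (Cg d Ad k) => y [].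
have hE y : W y -> prod_chart c d (h y) = (f y, g y) /\ chart_dom (prod_chart c d) (h y).
  move=> [[_ cy] [_ dy]]; have [c1 c2] := chart_coordP mA Ac cy.
  have [d1 d2] := chart_coordP mA Ad dy.
  by rewrite /h /= c2 d2; split.
pose W' := W `&` h @^-1` S.
have oW' : open W'.
  by apply: (open_preimage_within oW _ oS) => z; exact: Ck_continuous (Ch 0%N).
exists e, W'; split=> //.
- have Wx : W x by [].
  split=> //; have [hx1 hx2] := hE x Wx; split=> //.
  by rewrite /= in hx1 *; rewrite hx1.
- by move=> y [Wy [_ _]]; have [-> _] := hE y Wy.
- move=> k; apply: (@Ck_eq _ _ _ _ _ ((chart_coord e \o mul \o prod_chart c d) \o h)) => //.
    by move=> y [Wy _] /=; have [/= -> _] := hE y Wy.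
  apply: (Ck_comp oW' oS _ _ (Cm _ _ Pcd Ae k)); first by move=> y [].
  by apply: Ck_sub (Ch k) => y [].
Qed.

Lemma smooth_to_inv E (U : set E) (f : E -> G) : open U ->
  smooth_to A U f -> smooth_to A U (fun x => (f x)^-1)%g.
Proof.
move=> oU sf; apply: (smooth_to_chartwise mA) => // x Ux.
have [c Ac cfx] := chart_cover mA (f x).
have [e Ae efg] := chart_cover mA (f x)^-1%g.
have [cm Cm] := lie_inv_smooth G.
pose inv := fun p : G => (p^-1)%g.
pose S := [set z : 'rV[R]_n | [/\ chart_dom c z, setT (c z) & chart_cod e (inv (c z))]].
have oS : open S.
  rewrite openE => z [cz _ ez].
  have oe : open ([set p : mfd A | chart_cod e (inv p)]).
    rewrite openE => p ep; apply: (cm p I).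
    by apply: open_nbhs_nbhs; split=> //; exact: (chart_cod_open mA).
  move: oe; rewrite open_mfdE => /(_ _ Ac z cz ez) ne.
  have nc : \forall y \near z, chart_dom c y.
    by apply: open_nbhs_nbhs; split=> //; exact: (chart_open mA).
  by apply: filterS2 nc ne => y cy ey; split=> //; exact: ey.
pose W := U `&` [set x | chart_cod c (f x)].
have oW : open W := smooth_to_preimage oU sf (chart_cod_open mA Ac).
pose h y := chart_coord c (f y).
have Ch : Cinfty W h by case: sf => _; apply.
have hE y : W y -> c (h y) = f y /\ chart_dom c (h y).
  by move=> [_ cy]; have [] := chart_coordP mA Ac cy.
pose W' := W `&` h @^-1` S.
have oW' : open W'.
  by apply: (open_preimage_within oW _ oS) => z; exact: Ck_continuous (Ch 0%N).
exists e, W'; split=> //.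
- have Wx : W x by [].
  by split=> //; have [hx1 hx2] := hE x Wx; split=> //; rewrite hx1.
- by move=> y [Wy [_ _]]; have [-> _] := hE y Wy.
- move=> k; apply: (@Ck_eq _ _ _ _ _ ((chart_coord e \o inv \o c) \o h)) => //.
    by move=> y [Wy _] /=; have [-> _] := hE y Wy.
  apply: (Ck_comp oW' oS _ _ (Cm _ _ Ac Ae k)); first by move=> y [].
  by apply: Ck_sub (Ch k) => y [].
Qed.

Lemma loops_smooth_to (g : fun_group (circle R) G) :
  loops G g <-> smooth_to A setT (g \o @circle_proj R : R^o -> G).
Proof.
have nE (x : R) (S : set R) : nbhs (x : mfd (line_atlas R)) S <-> nbhs (x : R^o) S.
  have oE (O : set R) : open (O : set (mfd (line_atlas R))) <-> open (O : set R^o).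
    rewrite open_mfdE openE; split=> oO.
      move=> y Oy; have := oO (Chart setT idfun) erefl y I Oy.
      by apply: filterS => z; apply.
    by move=> _ -> y _ /oO; apply: filterS => z.
  rewrite (nbhsE (x : mfd (line_atlas R))) (nbhsE (x : R^o)).
  by split=> -[P [oP Px] PS]; exists P => //; split=> //; apply/oE.
split=> -[cg Cg]; split.
- by move=> x _ W /(cg x I) /nE.
- move=> d Ad k; apply: Ck_sub (Cg (Chart setT idfun) d erefl Ad k).
  by move=> x [_ dx]; split.
- by move=> x _ W /(cg x I) /nE.
- move=> _ d -> Ad k; apply: Ck_sub (Cg d Ad k).
  by move=> x [_ _ dx]; split.
Qed.

End SmoothIntoLieGroup.

(** * The adjoint representation *)

Lemma rV_bilinear_continuous (R : realType) m n (F : normedModType R)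
    (B : 'rV[R]_m -> 'rV[R]_n -> F) :
  (forall y, linear (B^~ y)) -> (forall x, linear (B x)) ->
  continuous (fun p : 'rV[R]_m * 'rV[R]_n => B p.1 p.2).
Proof.
move=> lB rB; suff C k : Ck k setT (fun p : 'rV[R]_m * 'rV[R]_n => B p.1 p.2).
  by move=> p; exact: (Ck_continuous (C 0%N)).
rewrite (_ : (fun p => _) = (fun p : 'rV[R]_m * 'rV[R]_n =>
    \sum_i (p.1 0 i : R^o) *: B (delta_mx 0 i) p.2)); last first.
  by apply/funext => p; rewrite (rV_linear_sum (lB p.2)).
have oT : open [set: 'rV[R]_m * 'rV[R]_n] by exact: openT.
apply: (Ck_sum _ oT) => i; apply: (Ck_scale oT).
  exact: (Ck_coord_comp i oT (Ck_fst k setT)).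
rewrite -[X in Ck _ _ X]/(B (delta_mx 0 i) \o snd).
apply: (@Ck_comp _ _ _ _ _ _ setT _ _ oT openT _ (Ck_snd k setT)) => [//|].
by apply: (Ck_linear k setT (rB _)); exact: rV_linear_continuous.
Qed.

(** A subspace is closed, being the zero set of the continuous map v - [projv W v]. *)
Lemma vspace_cvg (R : realType) n (W : {vspace 'rV[R]_n}) (T : Type)
    (P : set_system T) (f : T -> 'rV[R]_n) l : ProperFilter P ->
  f x @[x --> P] --> l -> (\forall x \near P, f x \in W) -> l \in W.
Proof.
move=> FP fl fW; pose L (v : 'rV[R]_n) := v - projv W v.
have lL : linear L.
  by move=> a u v; rewrite /L linearP/= opprD addrACA scalerBr.
have cl := cvg_comp _ _ fl (@rV_linear_continuous _ _ _ _ lL l).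
have c0 : (L \o f) x @[x --> P] --> (0 : 'rV[R]_n).
  apply: cvg_near_cst.
  by apply: filterS fW => x fx /=; rewrite /L projv_id// subrr.
have e : L l = 0 by apply: (cvg_unique (@norm_hausdorff _ _) cl c0).
by move/eqP: e; rewrite /L subr_eq0 => /eqP ->; exact: memv_proj.
Qed.

Section LieAlgebraOfLieGroup.
Variables (R : realType) (n : nat) (G : lieGroup 'rV[R]_n).
Variables (c : chart 'rV[R]_n G) (x0 : 'rV[R]_n).
Local Notation A := (lie_atlas G).
Local Notation V := 'rV[R]_n.
Hypotheses (Ac : A c) (cx0 : chart_dom c x0) (c1 : c x0 = 1%g).
Let mA : is_manifold A := lie_manifold G.
Implicit Types (E : normedModType R) (g h : G).

Definition conj_chart g : V -> V := fun x => chart_coord c (g * c x * g^-1)%g.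

Definition conj_dom g : set V :=
  chart_dom c `&` [set x | chart_cod c (g * c x * g^-1)%g].

Lemma lie_AdE g Y : lie_Ad c x0 g Y = 'D_Y (conj_chart g) x0.
Proof. by []. Qed.

Lemma chart_cod1 : chart_cod c 1%g.
Proof. by exists x0. Qed.

Lemma coord1 : chart_coord c 1%g = x0.
Proof. by rewrite -c1 (chart_coordK mA). Qed.

Lemma dom_open : open (chart_dom c).
Proof. exact: (chart_open mA). Qed.

Lemma conj_smooth g :
  [/\ open (conj_dom g), conj_dom g x0, Cinfty (conj_dom g) (conj_chart g),
      conj_chart g x0 = x0 & forall x, conj_dom g x ->
        c (conj_chart g x) = (g * c x * g^-1)%g /\ chart_dom c (conj_chart g x)].
Proof.
have sg : smooth_to A (chart_dom c) (fun x => g * c x * g^-1)%g.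
  apply: smooth_to_mul; [exact: dom_open| |exact: smooth_to_cst].
  apply: smooth_to_mul; [exact: dom_open|exact: smooth_to_cst|].
  exact: smooth_to_chart.
have e1 : (g * c x0 * g^-1 = 1)%g by rewrite c1 mulg1 mulgV.
have oD := smooth_to_preimage dom_open sg (chart_cod_open mA Ac).
split=> //.
- by split=> //=; rewrite e1; exact: chart_cod1.
- by case: sg => _; apply.
- by rewrite /conj_chart e1 coord1.
- by move=> x [cx gx]; have [] := chart_coordP mA Ac gx.
Qed.

Lemma lie_Ad_linear g : linear (lie_Ad c x0 g).
Proof. by have [oD Dx0 Cg _ _] := conj_smooth g; exact: (Ck1_linear oD (Cg 1%N)). Qed.

Lemma lie_Ad0 g : lie_Ad c x0 g 0 = 0.
Proof. by have := lie_Ad_linear g (-1) 0 0; rewrite scaler0 addr0 scaleN1r addNr. Qed.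

Lemma lie_Ad1 Y : lie_Ad c x0 1%g Y = Y.
Proof.
have did : 'D_Y (fun x : V => x) x0 = Y by exact: derive_linear.
rewrite lie_AdE -[RHS]did.
apply/esym/derive_near_eq; last by exact: (Ck1_derivable Y openT (Ck_id 1 setT) I).
apply: filterS (open_nbhs_nbhs (conj dom_open cx0)) => x cx.
by rewrite /conj_chart mul1g invg1 mulg1 (chart_coordK mA).
Qed.

Lemma lie_AdM g h Y : lie_Ad c x0 (g * h)%g Y = lie_Ad c x0 g (lie_Ad c x0 h Y).
Proof.
have [og gx0 Cg g0 gE] := conj_smooth g; have [oh hx0 Ch h0 hE] := conj_smooth h.
have dh := Ck1_derivable Y oh (Ch 1%N) hx0.
have Wh : conj_dom g (conj_chart h x0) by rewrite h0.
have [dgh Dgh] := derive_chain og (Cg 1%N) Wh dh.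
rewrite h0 in Dgh; rewrite 3!lie_AdE -Dgh; apply/esym/derive_near_eq => //.
have := open_preimage_within oh (fun x => @Ck_continuous _ _ _ _ _ _ _ (Ch 0%N)) og.
move=> /open_nearP/(_ x0 (conj hx0 Wh)); apply: filterS => x [hx gx] /=.
by rewrite /conj_chart -/(conj_chart h x); have [-> _] := hE x hx; rewrite invgM !mulgA.
Qed.

Definition Ad_chart (p : V * V) : V := lie_Ad c x0 (c p.1) p.2.

(** Ad (c x) Y is the derivative of the single smooth map (x, y) |-> c x * c y * (c x)^-1 at (x, x0)
    in the direction (0, Y). This gives smoothness jointly in x and Y. *)
Lemma Ad_chart_smooth : Cinfty (chart_dom c `*` setT) Ad_chart.
Proof.
have oD2 : open (chart_dom c `*` chart_dom c : set (V * V)).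
  exact: open_setX dom_open dom_open.
pose k2 (p : V * V) := (c p.1 * c p.2 * (c p.1)^-1)%g.
have s1 : smooth_to A (chart_dom c `*` chart_dom c) (fun p : V * V => c p.1).
  apply: (smooth_to_comp mA oD2 dom_open _ _ (smooth_to_chart mA Ac)) => [p []//|k].
  exact: Ck_fst.
have s2 : smooth_to A (chart_dom c `*` chart_dom c) (fun p : V * V => c p.2).
  apply: (smooth_to_comp mA oD2 dom_open _ _ (smooth_to_chart mA Ac)) => [p []//|k].
  exact: Ck_snd.
have s3 : smooth_to A (chart_dom c `*` chart_dom c) k2.
  by apply: smooth_to_mul => //; [exact: smooth_to_mul|exact: smooth_to_inv].
pose D := (chart_dom c `*` chart_dom c : set (V * V)) `&` [set p | chart_cod c (k2 p)].
have oD : open D := smooth_to_preimage oD2 s3 (chart_cod_open mA Ac).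
have CK : Cinfty D (chart_coord c \o k2) by case: s3 => _; apply.
move=> k; have /(CkS _ _ oD)[_ _ CD] := CK k.+1.
pose j (p : V * V) : (V * V) * (V * V) := ((p.1, x0), (0, p.2)).
have oT : open (chart_dom c `*` [set: V]) by exact: (openX_setT dom_open).
apply: (@Ck_eq R k _ _ _ ((fun q => 'D_q.2 (chart_coord c \o k2) q.1) \o j) _ oT).
  move=> [x Y] [/= cx _]; rewrite /Ad_chart lie_AdE /=.
  have Dx : D (x, x0).
    by split=> //=; rewrite /k2 /= c1 mulg1 mulgV; exact: chart_cod1.
  have dK := Ck1_derivable (0, Y) oD (CK 1%N) Dx.
  have [|_ ->//] := @dquot_derivable R _ _ (conj_chart (c x)) x0 Y
    ('D_(0, Y) (chart_coord c \o k2) (x, x0)).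
  apply: cvg_trans (derivable_dquot dK); apply: near_eq_cvg; apply: nearW => h /=.
  by congr (_ *: (_ - _)); rewrite /conj_chart /k2 /= scaler0 add0r.
apply: (Ck_comp oT (openX_setT oD) _ _ CD).
  move=> [x Y] [/= cx _]; split=> //; split=> //=.
  by rewrite /k2 /= c1 mulg1 mulgV; exact: chart_cod1.
by apply: Ck_pair; apply: Ck_pair; (try exact: Ck_cst); [exact: Ck_fst|exact: Ck_snd].
Qed.

Lemma Ad_chart_dir_smooth Y : Cinfty (chart_dom c) (fun x => lie_Ad c x0 (c x) Y).
Proof.
move=> k; rewrite -[X in Ck _ _ X]/(Ad_chart \o (fun x => (x, Y))).
apply: (Ck_comp dom_open (openX_setT dom_open) _ _ (Ad_chart_smooth k)) => //.
by apply: Ck_pair; [exact: Ck_id|exact: Ck_cst].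
Qed.

Local Notation br := (lie_bracket c x0).

Lemma lie_bracket_linearl Y : linear (br^~ Y).
Proof. exact: (Ck1_linear dom_open (Ad_chart_dir_smooth Y 1%N) cx0). Qed.

Lemma lie_bracket_linearr X : linear (br X).
Proof.
move=> a Y Z; rewrite /lie_bracket.
have dd W := Ck1_derivable X dom_open (Ad_chart_dir_smooth W 1%N) cx0.
rewrite -deriveZ// -deriveD//; last exact: derivableZ.
by congr ('D_X _ x0); apply/funext => x; rewrite lie_Ad_linear.
Qed.

(** Obtained by differentiating Ad g (Ad (c x) Y) = Ad (g (c x) g^-1) (Ad g Y) at [x0] in the
    direction X. *)
Lemma lie_bracket_Ad g X Y :
  lie_Ad c x0 g (br X Y) = br (lie_Ad c x0 g X) (lie_Ad c x0 g Y).
Proof.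
have [og gx0 Cg g0 gE] := conj_smooth g.
have dY := Ck1_derivable X dom_open (Ad_chart_dir_smooth Y 1%N) cx0.
have lg := lie_Ad_linear g.
have C1 : Ck 1 setT (lie_Ad c x0 g).
  exact: (Ck_linear 1 setT lg (rV_linear_continuous lg)).
have [d1 D1] := derive_chain openT C1 I dY.
rewrite (derive_linear _ _ lg) in D1; rewrite -[LHS]D1.
have Cz := Ad_chart_dir_smooth (lie_Ad c x0 g Y) 1%N.
have dg := Ck1_derivable X og (Cg 1%N) gx0.
have cg0 : chart_dom c (conj_chart g x0) by rewrite g0.
have [d2 D2] := derive_chain dom_open Cz cg0 dg.
rewrite g0 in D2; rewrite -[RHS]D2; refine (derive_near_eq _ d1).
apply: filterS (open_nbhs_nbhs (conj og gx0)) => x gx /=.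
rewrite (proj1 (gE x gx)) -(lie_AdM g (c x) Y).
by rewrite -(lie_AdM (g * c x * g^-1)%g g Y) mulgVK.
Qed.

(** The derivative at [x0] of the fact that Ad (c x) respects the bracket, with the product rule for
    the bilinear map [br]. *)
Lemma lie_bracket_leibniz X Y Z : br X (br Y Z) = br (br X Y) Z + br Y (br X Z).
Proof.
rewrite {1}/lie_bracket.
have lB := lie_bracket_linearl; have rB := lie_bracket_linearr.
have cB := rV_bilinear_continuous lB rB.
rewrite (_ : (fun x => _) = (fun x => br (lie_Ad c x0 (c x) Y) (lie_Ad c x0 (c x) Z))); last first.
  by apply/funext => x /=; rewrite lie_bracket_Ad.
have CY := Ad_chart_dir_smooth Y 1%N; have CZ := Ad_chart_dir_smooth Z 1%N.
by rewrite (derive_bilinear X lB rB cB dom_open CY CZ cx0) c1 !lie_Ad1.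
Qed.

Hypothesis G_semisimple : semisimple G.

(* The brackets are limits of the vectors (Ad(c x) - 1) Y/h with x close to x0. *)
Lemma Ad_sub1_span (B : set V) : nbhs x0 B -> forall v, exists s : seq (V * V),
  (forall p, p \in s -> B p.1 /\ chart_dom c p.1) /\
  v = \sum_(p <- s) (lie_Ad c x0 (c p.1) p.2 - p.2).
Proof.
move=> nB.
have [W hW] : exists W : {vspace V}, forall v, v \in W <-> exists s : seq (V * V),
    (forall p, p \in s -> B p.1 /\ chart_dom c p.1) /\
    v = \sum_(p <- s) (lie_Ad c x0 (c p.1) p.2 - p.2).
  apply: exists_vspace => [|a u v [s [sB ->]] [t [tB ->]]].
    by exists [::]; rewrite big_nil.
  exists ([seq (p.1, a *: p.2) | p <- s] ++ t); split.
    move=> p; rewrite mem_cat => /orP[/mapP[q qs ->]|]; last exact: tB.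
    exact: (sB q).
  rewrite big_cat/= big_map/= scaler_sumr; congr (_ + _); apply: eq_bigr => p _.
  rewrite scalerBr; congr (_ - _).
  by have := lie_Ad_linear (c p.1) a p.2 0; rewrite lie_Ad0 !addr0.
have brW X Y : br X Y \in W.
  have dY := Ck1_derivable X dom_open (Ad_chart_dir_smooth Y 1%N) cx0.
  apply: (vspace_cvg _ (derivable_dquot dY)).
  have nc : \forall x \near x0, B x /\ chart_dom c x.
    by apply: filterS2 nB (open_nbhs_nbhs (conj dom_open cx0)).
  have : \forall h \near (0 : R)^', B (h *: X + x0) /\ chart_dom c (h *: X + x0).
    exact: (@dnbhs_shift _ _ x0 X _ nc).
  apply: filterS => h hB; rewrite c1 lie_Ad1; apply: memvZ; apply/hW.
  exists [:: (h *: X + x0, Y)]; rewrite big_seq1; split=> // p.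
  by rewrite inE => /eqP ->.
have /vspaceP full : derived_space br fullv = fullv.
  apply: semisimple_perfect => //; last exact: G_semisimple.
  - exact: lie_bracket_linearl.
  - exact: lie_bracket_linearr.
  - exact: lie_bracket_leibniz.
move=> v; apply/hW; have := full v; rewrite memvf.
suff /subvP sW : (derived_space br fullv <= W)%VS by move=> /sW.
by apply/span_subvP => _ /allpairsP[[x y] [/= _ _ ->]]; exact: brW.
Qed.

End LieAlgebraOfLieGroup.

Lemma pair_splitE (U W : zmodType) (a : U) (b : W) : (a, 0) + (0, b) = (a, b).
Proof. by congr (_, _); rewrite ?addr0 ?add0r. Qed.

(** * Commutator words as coordinates near the identity *)

Section DerivativeAtIdentity.
Variables (R : realType) (n : nat) (G : lieGroup 'rV[R]_n).
Variables (c : chart 'rV[R]_n G) (x0 : 'rV[R]_n).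
Local Notation A := (lie_atlas G).
Local Notation V := 'rV[R]_n.
Hypotheses (Ac : A c) (cx0 : chart_dom c x0) (c1 : c x0 = 1%g).
Let mA : is_manifold A := lie_manifold G.
Let oD : open (chart_dom c) := chart_open mA Ac.
Implicit Types (E : normedModType R).

Lemma derive_pair E (F1 F2 : normedModType R) (U : set E) (f : E -> F1) (g : E -> F2) x v :
  open U -> U x -> Ck 1 U f -> Ck 1 U g ->
  derivable (fun y => (f y, g y)) x v /\
  'D_v (fun y => (f y, g y)) x = ('D_v f x, 'D_v g x).
Proof.
move=> oU Ux Cf Cg; have Cp := Ck_pair Cf Cg.
have dp := Ck1_derivable v oU Cp Ux; split=> //.
have [_ d1] := derive_chain openT (Ck_fst 1 setT) I dp.
have [_ d2] := derive_chain openT (Ck_snd 1 setT) I dp.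
rewrite (derive_linear (f := fst)) in d1; last by move=> a y z.
rewrite (derive_linear (f := snd)) in d2; last by move=> a y z.
by rewrite [LHS]surjective_pairing -d1 -d2.
Qed.

(** Used only where f x = 1: there it is the differential of f, with the tangent space at 1 read
    through [c]. *)
Definition coord_deriv E (f : E -> G) (x v : E) : V := 'D_v (chart_coord c \o f) x.

Lemma near_cod1 E (U : set E) (f : E -> G) x : open U -> smooth_to A U f -> U x ->
  f x = 1%g -> exists W, [/\ open W, W x, W `<=` U, Cinfty W (chart_coord c \o f) &
    forall y, W y -> chart_cod c (f y)].
Proof.
move=> oU sf Ux fx; exists (U `&` [set y | chart_cod c (f y)]); split=> //.
- exact: (smooth_to_preimage oU sf (chart_cod_open mA Ac)).
- by split=> //=; rewrite fx; exact: chart_cod1 cx0 c1.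
- by case: sf => _; apply.
- by move=> y [].
Qed.

(** By linearity the differential of the multiplication at (1, 1) is determined on the two axes, and
    on each of them the multiplication is the identity. *)
Lemma coord_deriv_mul E (U : set E) (f g : E -> G) x v : open U ->
  smooth_to A U f -> smooth_to A U g -> U x -> f x = 1%g -> g x = 1%g ->
  coord_deriv (fun y => f y * g y)%g x v = coord_deriv f x v + coord_deriv g x v.
Proof.
move=> oU sf sg Ux fx gx.
have [W1 [oW1 W1x _ C1 cf]] := near_cod1 oU sf Ux fx.
have [W2 [oW2 W2x _ C2 cg]] := near_cod1 oU sg Ux gx.
have oD2 : open (chart_dom c `*` chart_dom c : set (V * V)).
  exact: open_setX.
pose m2 (p : V * V) := (c p.1 * c p.2)%g.
have sm : smooth_to A (chart_dom c `*` chart_dom c) m2.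
  apply: smooth_to_mul => //.
    apply: (smooth_to_comp mA oD2 oD _ _ (smooth_to_chart mA Ac)) => [p []//|k].
    exact: Ck_fst.
  apply: (smooth_to_comp mA oD2 oD _ _ (smooth_to_chart mA Ac)) => [p []//|k].
  exact: Ck_snd.
have e0 : m2 (x0, x0) = 1%g by rewrite /m2 /= c1 mulg1.
have D0 : (chart_dom c `*` chart_dom c) (x0, x0) by split.
have [M [oM M0 Mc CM cM]] := near_cod1 oD2 sm D0 e0.
pose h y := (chart_coord c (f y), chart_coord c (g y)).
have oW : open (W1 `&` W2) by exact: openI.
have [dh Dh] := derive_pair v oW (conj W1x W2x)
  (Ck_sub (@subIsetl _ _ _) (C1 1%N)) (Ck_sub (@subIsetr _ _ _) (C2 1%N)).
have hx : h x = (x0, x0) by rewrite /h fx gx (coord1 Ac cx0 c1).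
have Mh : M (h x) by rewrite hx.
have [d D] := derive_chain oM (CM 1%N) Mh dh.
rewrite Dh hx in D.
have lM := Ck1_linear oM (CM 1%N) M0.
have side (j1 j2 : V -> V) (a : V) : Ck 1 setT j1 -> Ck 1 setT j2 ->
    j1 x0 = x0 -> j2 x0 = x0 -> (forall y, chart_dom c y -> m2 (j1 y, j2 y) = c y) ->
    'D_('D_a j1 x0, 'D_a j2 x0) (chart_coord c \o m2) (x0, x0) = a.
  move=> Cj1 Cj2 e1 e2 mj.
  have [dj Dj] := @derive_pair V V V setT j1 j2 x0 a openT I Cj1 Cj2.
  pose j y := (j1 y, j2 y); have jx : j x0 = (x0, x0) by rewrite /j e1 e2.
  have Mj : M (j x0) by rewrite jx.
  have [d' D'] := derive_chain oM (CM 1%N) Mj dj.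
  rewrite jx Dj in D'; rewrite -D' -[RHS](derive_linear (f := id) x0); last by move=> ? ? ?.
  apply: derive_near_eq => //.
  apply: filterS (open_nbhs_nbhs (conj oD cx0)) => y cy /=.
  by rewrite mj// (chart_coordK mA).
have m10 y : chart_dom c y -> m2 (y, x0) = c y by rewrite /m2 /= c1 mulg1.
have m01 y : chart_dom c y -> m2 (x0, y) = c y by rewrite /m2 /= c1 mul1g.
have Did (a : V) : 'D_a (fun y : V => y) x0 = a by exact: derive_linear.
have Dcst (a : V) : 'D_a (fun=> x0 : V) x0 = 0 :> V by exact: derive_cst.
have S1 a := side _ _ a (Ck_id 1 setT) (Ck_cst 1 setT x0) erefl erefl m10.
have S2 a := side _ _ a (Ck_cst 1 setT x0) (Ck_id 1 setT) erefl erefl m01.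
have {}lM : 'D_('D_v (chart_coord c \o f) x, 'D_v (chart_coord c \o g) x)
    (chart_coord c \o m2) (x0, x0) =
    'D_v (chart_coord c \o f) x + 'D_v (chart_coord c \o g) x.
  have := lM 1 ('D_v (chart_coord c \o f) x, 0) (0, 'D_v (chart_coord c \o g) x).
  have := S1 ('D_v (chart_coord c \o f) x); rewrite Did Dcst => {}S1.
  have := S2 ('D_v (chart_coord c \o g) x); rewrite Did Dcst => {}S2.
  rewrite !scale1r S1 S2 => <-.
  by rewrite pair_splitE.
rewrite /coord_deriv -lM -D; apply/esym/derive_near_eq => //.
apply: filterS (open_nbhs_nbhs (conj oW (conj W1x W2x))) => y [W1y W2y] /=.
have [_ e1] := chart_coordP mA Ac (cf y W1y); have [_ e2] := chart_coordP mA Ac (cg y W2y).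
by rewrite /m2 /= e1 e2.
Qed.

Lemma coord_deriv_inv E (U : set E) (f : E -> G) x v : open U ->
  smooth_to A U f -> U x -> f x = 1%g ->
  coord_deriv (fun y => (f y)^-1)%g x v = - coord_deriv f x v.
Proof.
move=> oU sf Ux fx; apply/eqP; rewrite eq_sym -subr_eq0 -opprD oppr_eq0 addrC; apply/eqP.
rewrite addrC -(coord_deriv_mul v oU sf (smooth_to_inv oU sf) Ux fx); last by rewrite fx invg1.
rewrite /coord_deriv (_ : chart_coord c \o _ = cst (chart_coord c 1%g)) ?derive_cst//.
by apply/funext => y /=; rewrite mulgV.
Qed.

Lemma coord_deriv_conj E (U : set E) (f : E -> G) g x v : open U ->
  smooth_to A U f -> U x -> f x = 1%g ->
  coord_deriv (fun y => g * f y * g^-1)%g x v = lie_Ad c x0 g (coord_deriv f x v).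
Proof.
move=> oU sf Ux fx; have [og gx0 Cg g0 gE] := conj_smooth Ac cx0 c1 g.
have [W [oW Wx _ CW cf]] := near_cod1 oU sf Ux fx.
have df := Ck1_derivable v oW (CW 1%N) Wx.
have cx : (chart_coord c \o f) x = x0 by rewrite /= fx (coord1 Ac cx0 c1).
have Wg : conj_dom c g ((chart_coord c \o f) x) by rewrite cx.
have [d D] := derive_chain og (Cg 1%N) Wg df.
rewrite cx in D; rewrite lie_AdE /coord_deriv -D; apply/esym/derive_near_eq => //.
apply: filterS (open_nbhs_nbhs (conj oW Wx)) => y Wy /=.
by have [_ e1] := chart_coordP mA Ac (cf y Wy); rewrite /conj_chart e1.
Qed.

Lemma coord_deriv_chart E (f : E -> V) (U : set E) x v : open U -> U x -> Ck 1 U f ->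
  f x = x0 -> coord_deriv (c \o f) x v = 'D_v f x.
Proof.
move=> oU Ux Cf fx; apply/esym/derive_near_eq; last exact: Ck1_derivable Cf Ux.
have cf : {for x, continuous f} by exact: Ck_continuous Cf Ux.
have : \forall y \near x, chart_dom c (f y).
  by apply: cf; rewrite fx; exact: open_nbhs_nbhs.
by apply: filterS => y cy /=; rewrite (chart_coordK mA).
Qed.

(** As [~ a, b] is a^-1 b^-1 a b, the inverses turn each factor into a y a^-1 y^-1, whose derivative
    is Ad a Y - Y. An entry holds the coordinate of [z] that drives y, the chart coordinate of a,
    and the direction Y. *)
Definition commutator_word (L : seq ('I_n * (V * V))) (z : V) : G :=
  (\prod_(p <- L) [~ (c p.2.1)^-1, (c (x0 + z 0 p.1 *: p.2.2)%R)^-1])%g.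

Definition word_dom (L : seq ('I_n * (V * V))) : set V :=
  [set z | forall p, p \in L -> chart_dom c (x0 + z 0 p.1 *: p.2.2)].

Lemma commutator_word_smooth L :
  [/\ open (word_dom L), word_dom L 0, smooth_to A (word_dom L) (commutator_word L),
      commutator_word L 0 = 1%g &
      forall v, coord_deriv (commutator_word L) 0 v =
        \sum_(p <- L) v 0 p.1 *: (lie_Ad c x0 (c p.2.1) p.2.2 - p.2.2)].
Proof.
elim: L => [|p L [oL L0 sL L1 dL]].
  have e : commutator_word [::] = cst 1%g by apply/funext => z; rewrite /commutator_word big_nil.
  have eT : word_dom [::] = setT by apply/seteqP; split.
  rewrite e eT; split=> //; [exact: openT|exact: smooth_to_cst|].
  move=> v; rewrite big_nil /coord_deriv (_ : _ \o _ = cst (chart_coord c 1%g)) ?derive_cst//.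
pose y := fun z : V => x0 + z 0 p.1 *: p.2.2.
have Cy k U : open U -> Ck k U y.
  move=> oU; apply: Ck_add => //; first exact: Ck_cst.
  by apply: Ck_scale => //; [exact: Ck_coord|exact: Ck_cst].
have oY : open [set z | chart_dom c (y z)].
  have := open_preimage_within openT (fun x _ => Ck_continuous (Cy 0%N setT openT) (I : setT x)) oD.
  by rewrite setTI.
have Y0 : y 0 = x0 by rewrite /y mxE scale0r addr0.
have eU : word_dom (p :: L) = [set z | chart_dom c (y z)] `&` word_dom L.
  apply/seteqP; split=> z.
    by move=> h; split; [apply: h; rewrite mem_head|move=> q qL; apply: h; rewrite inE qL orbT].
  by move=> [h1 h2] q; rewrite inE => /orP[/eqP ->//|]; exact: h2.
set U := word_dom (p :: L).
have oU : open U by rewrite /U eU; exact: openI.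
have U0 : U 0 by rewrite /U eU; split=> //=; rewrite Y0.
have sy : smooth_to A U (c \o y).
  apply: (smooth_to_comp mA oU oD _ _ (smooth_to_chart mA Ac)); first by rewrite /U eU => z [].
  by move=> k; exact: Cy.
have cy0 : (c \o y) 0 = 1%g by rewrite /= Y0.
pose f z := (c p.2.1 * (c \o y) z * (c p.2.1)^-1)%g.
have sf : smooth_to A U f.
  by apply: smooth_to_mul => //; [apply: smooth_to_mul|]; rewrite //; exact: smooth_to_cst.
have f0 : f 0 = 1%g by rewrite /f cy0 mulg1 mulgV.
have si := smooth_to_inv oU sy.
have i0 : ((c \o y) 0)^-1%g = 1%g by rewrite cy0 invg1.
have sL' : smooth_to A U (commutator_word L).
  by apply: smooth_to_sub sL => z; rewrite /U eU => -[].
have e : commutator_word (p :: L) = (fun z => f z * ((c \o y) z)^-1 * commutator_word L z)%g.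
  by apply/funext => z; rewrite /commutator_word big_cons /f commgEl /conjg !invgK !mulgA.
have sfi := smooth_to_mul oU sf si.
have fi0 : (f 0 * ((c \o y) 0)^-1)%g = 1%g by rewrite f0 i0 mulg1.
split=> //.
- by rewrite e; exact: smooth_to_mul.
- by rewrite e L1 fi0 mulg1.
move=> v; rewrite e (coord_deriv_mul v oU sfi sL' U0 fi0 L1) (coord_deriv_mul v oU sf si U0 f0 i0).
rewrite (coord_deriv_inv v oU sy U0 cy0) (coord_deriv_conj _ v oU sy U0 cy0).
rewrite (coord_deriv_chart v oU U0 (Cy 1%N U oU) Y0) big_cons dL; congr (_ + _).
have -> : 'D_v y 0 = v 0 p.1 *: p.2.2.
  have [|_ ->//] := @dquot_derivable R _ _ y 0 v (v 0 p.1 *: p.2.2).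
  apply: cvg_near_cst; near=> h.
  rewrite /y !mxE addr0 scale0r addr0 addrAC subrr add0r !scalerA mulrA mulVf ?mul1r//.
  by near: h; exact: nbhs_dnbhs_neq.
rewrite -[v 0 p.1 *: p.2.2]addr0 (lie_Ad_linear Ac cx0 c1).
by rewrite (lie_Ad0 Ac cx0 c1) !addr0 scalerBr.
Unshelve. all: by end_near. Qed.

Hypothesis G_semisimple : semisimple G.

(* The words of [commutator_word] have derivative Sum_i v_i e_i = v at 0 when the
   entries with first component i are taken from a decomposition of the basis
   vector e_i by [Ad_sub1_span]. *)
Lemma chart_commutator_word (r : R) : 0 < r -> exists e : R, exists b : V -> V, exists L,
  [/\ 0 < e, b x0 = 0, Cinfty (ball x0 e) b,
      forall p, p \in L -> ball x0 r p.2.1 &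
      forall y, ball x0 e y -> word_dom L (b y) /\ c y = commutator_word L (b y)].
Proof.
move=> r0; have nB : nbhs x0 (ball x0 r) by exact: nbhsx_ballx.
have /choice[s sP] := fun i : 'I_n => Ad_sub1_span Ac cx0 c1 G_semisimple nB (delta_mx 0 i).
pose L := [seq (i, p) | i <- enum 'I_n, p <- s i].
have [oL L0 sL L1 dL] := commutator_word_smooth L.
have dL1 v : coord_deriv (commutator_word L) 0 v = v.
  rewrite dL big_allpairs_dep/= big_enum/= [RHS]row_sum_delta; apply: eq_bigr => i _.
  by rewrite -scaler_sumr -(proj2 (sP i)).
have [W [oW W0 WL CW cW]] := near_cod1 oL sL L0 L1.
have [e e0 [b [b0 bE Cb]]] := local_inverse oW CW W0 dL1.
have F0 : (chart_coord c \o commutator_word L) 0 = x0 by rewrite /= L1 (coord1 Ac cx0 c1).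
rewrite F0 in b0 bE Cb.
have nx : \forall y \near x0, chart_dom c y by exact: open_nbhs_nbhs.
have [d d0 dD] : exists2 d : R, 0 < d & ball x0 d `<=` chart_dom c by apply/nbhs_ballP.
have be y : ball x0 (Num.min e d) y -> `|y - x0| < e /\ chart_dom c y.
  rewrite -ball_normE/= lt_min distrC => /andP[ye yd]; split=> //.
  by apply: dD; rewrite -ball_normE/= distrC.
exists (Num.min e d), b, L; split.
- by rewrite lt_min e0.
- exact: b0.
- by move=> k; apply: Ck_sub (Cb k) => y /be[].
- by move=> p /allpairsPdep[i [q [_ qs ->]]] /=; have [/(_ q qs)[]] := sP i.
- move=> y /be[ye cy]; have [/WL ? bb] := bE y ye; split=> //.
  rewrite -[in LHS]bb /=; have [Wb _] := bE y ye.
  by have [_ ->] := chart_coordP mA Ac (cW _ Wb).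
Qed.

End DerivativeAtIdentity.

(** * Functions on the line *)

Section SmoothStep.
Variable R : realType.

(** The powers of 1/x are included to close the family under differentiation, so that smoothness is
    proved for all k at once. *)
Definition theta k (x : R) : R := if 0 < x then x^-1 ^+ k * expR (- x^-1) else 0.

Lemma theta_le0 k x : x <= 0 -> theta k x = 0.
Proof. by move=> x0; rewrite /theta ltNge x0. Qed.

Lemma theta_gt0 k x : 0 < x -> 0 < theta k x.
Proof. by move=> x0; rewrite /theta x0 mulr_gt0 ?expR_gt0// exprn_gt0// invr_gt0. Qed.

Lemma theta_ge0 k x : 0 <= theta k x.
Proof. by case: (ltP 0 x) => [/(theta_gt0 k)/ltW|/(theta_le0 k) ->]. Qed.

(** From e^y >= y^(k+1) / (k+1)! with y = 1/x. For k + 1 it bounds the difference quotient of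
    [theta k] at 0. *)
Lemma theta_norm_le k x : `|theta k x| <= k.+1`!%:R * `|x|.
Proof.
case: (ltP 0 x) => [x0|/(theta_le0 k) ->]; last by rewrite normr0 mulr_ge0.
rewrite ger0_norm ?theta_ge0// /theta x0 (gtr0_norm x0).
have y0 : 0 < x^-1 by rewrite invr_gt0.
have := expR_ge1Dxn k (ltW y0); set f := k.+1`!%:R => h.
have f0 : 0 < f :> R by rewrite ltr0n fact_gt0.
rewrite expRN ler_pdivrMr ?expR_gt0//.
have {}h : x^-1 ^+ k.+1 / f <= expR x^-1 by apply: le_trans h; rewrite lerDr.
apply: le_trans (ler_wpM2l (ltW (mulr_gt0 f0 x0)) h).
have fn : f != 0 by rewrite gt_eqF.
have xn : x != 0 by rewrite gt_eqF.
by rewrite exprS (_ : f * x * _ = (x * x^-1) * (f / f) * x^-1 ^+ k); [rewrite !divff// !mul1r|ring].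
Qed.

Lemma is_derive_theta k (x : R) :
  is_derive x 1 (theta k) (- (k%:R * theta k.+1 x) + theta k.+2 x).
Proof.
have [x0|x0|->] := ltgtP x 0.
- rewrite !(theta_le0 _ (ltW x0)) mulr0 oppr0 addr0.
  have d0 : is_derive x 1 (cst 0 : R -> R) 0 := is_derive_cst 0 x 1.
  apply: near_eq_is_derive d0.
  by near=> y; rewrite theta_le0//; apply/ltW; near: y; exact: lt_nbhsl.
- have xn : x != 0 by rewrite gt_eqF.
  have dV : is_derive x 1 (fun y : R => y^-1) (- x ^- 2 *: 1) by exact: is_deriveV.
  have dN : is_derive x 1 (fun y : R => - y^-1) (- (- x ^- 2 *: 1)) by exact: is_deriveN.
  have dE := @is_derive1_comp R expR (fun y : R => - y^-1) x _ _ (is_derive_expR (- x^-1)) dN.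
  have dX := is_deriveX k dV; have dM := is_deriveM dX dE.
  have {}dM : is_derive x 1 ((fun y : R => y^-1) ^+ k * (expR \o (fun y : R => - y^-1)))
      (- (k%:R * theta k.+1 x) + theta k.+2 x).
    apply: is_derive_eq dM _; rewrite /theta x0 /=.
    rewrite exprfctE /= /GRing.scale /=.
    by case: (k) => [|m]; rewrite /= ?expr0 !exprS; field.
  apply: near_eq_is_derive dM.
  have : \forall y \near x, 0 < y by exact: lt_nbhsr.
  by apply: filterS => y y0; rewrite /theta y0 /= mulrfctE exprfctE.
- rewrite !theta_le0// mulr0 oppr0 addr0; apply: is_derive_dquot.
  have b (h : R) : h != 0 -> `|h^-1 *: (theta k (h + 0) - theta k 0)| <= k.+2`!%:R * `|h|.
    move=> h0; rewrite addr0 (theta_le0 _ (lexx 0)) subr0.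
    case: (ltP 0 h) => [hp|hn]; last by rewrite theta_le0// scaler0 normr0 mulr_ge0.
    by apply: le_trans (theta_norm_le k.+1 h); rewrite /theta hp exprS -mulrA.
  apply/cvgr0Pnorm_lt => e e0; near=> h.
  apply: (le_lt_trans (b h _)); first by near: h; exact: nbhs_dnbhs_neq.
  rewrite mulrC -ltr_pdivlMr ?ltr0n ?fact_gt0//; near: h.
  by apply: dnbhs0_lt; rewrite divr_gt0// ltr0n fact_gt0.
Unshelve. all: by end_near. Qed.

Lemma Ck_theta k m : Ck m setT (theta k : R^o -> R^o).
Proof.
elim: m k => [|m ih] k.
  by split=> // x _; apply/differentiable_continuous/derivable1_diffP; case: (is_derive_theta k x).
split; first by move=> x _; apply/differentiable_continuous/derivable1_diffP; case: (is_derive_theta k x).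
exists (fun p => p.2 *: (- (k%:R * theta k.+1 p.1) + theta k.+2 p.1)); split.
  move=> t v _ /=; have [d D] := is_derive_theta k t.
  have c := dquot_scale (c := v) (derivable_dquot d).
  have e : v *: (1 : R) = v := mulr1 v.
  by rewrite e D in c; exact: c.
rewrite setXTT; have oT : open [set: R^o * R^o] by exact: openT.
have Cth j : Ck m setT (fun p : R^o * R^o => theta j p.1 : R^o).
  rewrite -[X in Ck _ _ X]/((theta j : R^o -> R^o) \o fst).
  by apply: (@Ck_comp _ _ _ _ _ _ setT) => //; [exact: openT|exact: Ck_fst].
apply: Ck_scale => //; first exact: Ck_snd.
apply: Ck_add => //; apply: (@Ck_eq _ _ _ _ _ (fun p : R^o * R^o => (- k%:R : R^o) *: theta k.+1 p.1)) => //.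
  by move=> p _; rewrite scaleNr.
by apply: Ck_scale => //; exact: Ck_cst.
Qed.

Definition step (x : R) : R := theta 0 x / (theta 0 x + theta 0 (1 - x)).

Lemma step_den_gt0 x : 0 < theta 0 x + theta 0 (1 - x).
Proof.
case: (ltP 0 x) => x0; first by rewrite ltr_pwDl ?theta_gt0 ?theta_ge0.
by rewrite ltr_wpDl ?theta_ge0// theta_gt0// subr_gt0 (le_lt_trans x0).
Qed.

Lemma step_le0 x : x <= 0 -> step x = 0.
Proof. by move=> x0; rewrite /step theta_le0// mul0r. Qed.

Lemma step_ge1 x : 1 <= x -> step x = 1.
Proof.
move=> x1; rewrite /step (@theta_le0 0 (1 - x)) ?subr_le0// addr0 divff// gt_eqF// theta_gt0//.
exact: lt_le_trans x1.
Qed.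

Lemma step_ge0 x : 0 <= step x.
Proof. by rewrite divr_ge0 ?theta_ge0// ltW// step_den_gt0. Qed.

Lemma step_le1 x : step x <= 1.
Proof. by rewrite ler_pdivrMr ?step_den_gt0// mul1r lerDl theta_ge0. Qed.

Lemma Ck_affine m (a b : R) : Ck m setT (fun x : R^o => a * x + b : R^o).
Proof.
have oT : open [set: R^o] by exact: openT.
apply: Ck_add => //; last exact: Ck_cst.
by apply: (@Ck_scale _ _ _ _ _ (fun=> a : R^o) (fun x : R^o => x : R^o)) => //; [exact: Ck_cst|exact: Ck_id].
Qed.

Lemma Ck_step m : Ck m setT (step : R^o -> R^o).
Proof.
have oT : open [set: R^o] by exact: openT.
pose den (x : R^o) : R^o := theta 0 x + theta 0 (1 - x).
have C1 : Ck m setT (fun x : R^o => theta 0 (1 - x) : R^o).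
  apply: (@Ck_eq _ _ _ _ _ ((theta 0 : R^o -> R^o) \o (fun x : R^o => (- 1) * x + 1 : R^o))) => //.
    by move=> x _ /=; rewrite mulN1r addrC.
  apply: (@Ck_comp _ _ _ _ _ _ setT) => //; [exact: Ck_affine|exact: Ck_theta].
have Cd : Ck m setT den by apply: Ck_add => //; exact: Ck_theta.
apply: (@Ck_scale _ _ _ _ _ (theta 0 : R^o -> R^o) (fun x : R^o => (den x)^-1 : R^o)) => //.
  exact: Ck_theta.
rewrite -[X in Ck _ _ X]/((fun y : R^o => y^-1 : R^o) \o den).
apply: (Ck_comp oT (@open_neq0 R) _ Cd (@Ck_inv R m)) => x _ /=.
by rewrite gt_eqF// step_den_gt0.
Qed.

Lemma Ck_step_affine m (f : R -> R) (a b : R) : (forall t, f t = a * t + b) ->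
  Ck m setT ((fun t => step (f t)) : R^o -> R^o).
Proof.
have oT : open [set: R^o] by exact: openT.
move=> /funext ->; rewrite -[X in Ck _ _ X]/((step : R^o -> R^o) \o (fun t : R^o => a * t + b : R^o)).
by apply: (Ck_comp oT oT _ (@Ck_affine _ _ _) (@Ck_step _)).
Qed.

End SmoothStep.

(** * Cutting functions along the complement of an open set *)

Section LineCalculus.
Variables (R : realType) (F : normedModType R).
Implicit Types (f g h : R -> F) (U V P : set R).

Lemma derive1n_eq_on U f g : open U -> (forall t, U t -> f t = g t) ->
  forall k t, U t -> derive1n k f t = derive1n k g t.
Proof.
move=> oU fg; elim=> [//|k ih] t Ut; rewrite !derive1nS !derive1E.
by apply: near_eq_derive; apply: filterS (open_nbhs_nbhs (conj oU Ut)) => s; exact: ih.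
Qed.

Lemma derive1n_addl k f (e : F) t : derive1n k.+1 (fun s => e + f s) t = derive1n k.+1 f t.
Proof.
have eE (a b : F) : (e + a) - (e + b) = a - b by rewrite opprD addrACA subrr add0r.
rewrite !derive1Sn; congr (derive1n k _ t); apply/funext => s; rewrite !derive1E /derive.
have -> : (fun h : R => h^-1 *: (((fun s => e + f s) \o shift s) (h *: 1) - (e + f s))) =
  (fun h : R => h^-1 *: ((f \o shift s) (h *: 1) - f s)) by apply/funext => h /=; rewrite eE.
by [].
Qed.

Lemma derive1n_affine k f (a b t : R) : Cinfty setT (f : R^o -> F) ->
  derive1n k (fun s => f (a * s + b)) t = a ^+ k *: derive1n k f (a * t + b).
Proof.
move=> Cf; have oT : open [set: R^o] by exact: openT.
have Ca := @Ck_affine R 1 a b.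
have da s : 'D_1 (fun s : R^o => a * s + b : R^o) s = a.
  have [|_ ->//] := @dquot_derivable R _ _ (fun s : R^o => a * s + b : R^o) s 1 a.
  apply: cvg_near_cst; near=> h.
  rewrite (_ : h^-1 *: _ = (h^-1 * h) * a); last by rewrite /GRing.scale /= mulr1; ring.
  by rewrite mulVf ?mul1r//; near: h; exact: nbhs_dnbhs_neq.
elim: k t => [|k ih] t; first by rewrite scale1r.
rewrite derive1nS derive1E (_ : derive1n k _ = fun s => a ^+ k *: derive1n k f (a * s + b)); last first.
  by apply/funext => s; exact: ih.
have Cg := Cinfty_iter_derive1 k oT Cf 1%N.
have [d D] := derive_chain oT Cg I (Ck1_derivable (1 : R^o) oT Ca (I : setT (t : R^o))).
rewrite da in D; rewrite deriveZ//= exprSr -scalerA; congr (_ *: _).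
transitivity ('D_a (derive1n k f : R^o -> F) (a * t + b : R^o)); first exact: D.
rewrite derive1E.
have := Ck1_linear oT Cg (I : setT (a * t + b : R^o)) a 1 0.
have l0 : 'D_0 (derive1n k f : R^o -> F) (a * t + b : R^o) = 0.
  by have := Ck1_linear oT Cg (I : setT (a * t + b : R^o)) (-1) 0 0; rewrite scaler0 addr0 scaleN1r addNr.
have e1 : a *: (1 : R^o) = a := mulr1 a.
by rewrite l0 !addr0 e1.
Unshelve. all: by end_near. Qed.

Definition cut (X : Type) (e : X) P (f : R -> X) : R -> X :=
  fun t => if `[< P t >] then f t else e.

(* P is a union of connected components of the complement of V, up to points of V *)
Definition saturated V P := forall s t, P s ->
  (forall u, Num.min s t <= u <= Num.max s t -> ~ V u) -> P t.

Lemma saturated_setC V P : saturated V P -> saturated V (~` P).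
Proof. by move=> sP s t Ps h Pt; apply: Ps; apply: (sP t) => // u; rewrite minC maxC; exact: h. Qed.

Lemma cut_near V P t (e : R) : saturated V P -> 0 < e -> (forall v, V v -> e <= `|v - t|) ->
  forall s, `|s - t| < e -> P s <-> P t.
Proof.
move=> sP e0 he s st.
have h u : Num.min s t <= u <= Num.max s t -> ~ V u.
  move=> /andP[u1 u2] /he; apply/negP; rewrite -ltNge; apply: le_lt_trans st.
  by case: (leP s t) u1 u2 => st u1 u2; [rewrite !ler0_norm ?subr_le0// lerN2 lerB|rewrite !ger0_norm ?subr_ge0 ?lerB// ltW].
by split=> Ps; apply: sP Ps _ => // u; rewrite minC maxC; exact: h.
Qed.

Definition adherent V t := forall e : R, 0 < e -> exists2 v, V v & `|v - t| < e.

Lemma not_adherent V t : ~ adherent V t -> exists2 e, 0 < e & forall v, V v -> e <= `|v - t|.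
Proof.
move=> h; apply: contrapT => k; apply: h => e e0; apply: contrapT => h; apply: k.
by exists e => // v Vv; rewrite leNgt; apply/negP => ve; apply: h; exists v.
Qed.

Lemma adherent_near V t (Q : set R) : adherent V t -> (\forall s \near t, Q s) -> exists2 v, V v & Q v.
Proof.
move=> aV /nbhs_ballP[e e0 eQ]; have [v Vv vt] := aV e e0; exists v => //.
by apply: eQ; rewrite -ball_normE/= distrC.
Qed.

Lemma adherent_eq0 V U h t : open U -> U t -> adherent V t ->
  (forall s, U s -> V s -> h s = 0) -> {for t, continuous h} -> h t = 0.
Proof.
move=> oU Ut aV h0 ch; apply/eqP; rewrite -normr_le0; apply/ler_addgt0Pr => e e0.
have : \forall s \near t, U s /\ `|h t - h s| < e.
  have /cvgrPdist_lt/(_ e e0) he := ch.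
  by apply: filterS2 (open_nbhs_nbhs (conj oU Ut)) he => s.
by move=> /(adherent_near aV)[v Vv [Uv]]; rewrite (h0 v)// subr0 add0r => /ltW.
Qed.

Lemma derive1n_adherent_eq0 V U f k t : open V -> open U -> U t -> adherent V t ->
  (forall j s, U s -> derivable (derive1n j f) s 1) -> (forall s, U s -> V s -> f s = 0) ->
  derive1n k f t = 0.
Proof.
move=> oV oU Ut aV df f0; apply: (adherent_eq0 oU Ut aV) => [s Us Vs|]; last first.
  exact/differentiable_continuous/derivable1_diffP/df.
have -> : derive1n k f s = derive1n k (cst 0) s.
  by apply: (derive1n_eq_on (openI oU oV)) => // u [Uu Vu]; rewrite f0.
by elim: (k) s {Us Vs} => // m im s; rewrite derive1nS derive1E (funext im) derive_cst.
Qed.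

(** At a point adherent to V both h and its derivative vanish, and cutting only decreases the norm
    of the difference quotient. Near any other point membership in P is constant, so the cut
    function is locally h or 0. *)
Lemma cut_is_derive V P U h t : open V -> saturated V P -> open U -> U t ->
  (forall s, U s -> derivable h s 1) -> (forall s, U s -> derivable (derive1 h) s 1) ->
  (forall s, U s -> V s -> h s = 0) -> is_derive t 1 (cut 0 P h) (cut 0 P (derive1 h) t).
Proof.
move=> oV sP oU Ut dh dh' h0.
have [aV|/not_adherent[e e0 he]] := pselect (adherent V t); last first.
  have near_ball : \forall s \near t, `|s - t| < e.
    by apply/nbhs_ballP; exists e => // s; rewrite -ball_normE/= distrC.
  have [Pt|nPt] := pselect (P t).
    have -> : cut 0 P (derive1 h) t = (derive1 h) t by rewrite /cut asboolT.
    have d : is_derive t 1 h ((derive1 h) t) by rewrite derive1E; apply: DeriveDef => //; exact: dh.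
    apply: near_eq_is_derive d; apply: filterS near_ball => s /(cut_near sP e0 he) PP.
    by rewrite /cut asboolT//; apply/PP.
  have -> : cut 0 P (derive1 h) t = 0 by rewrite /cut asboolF.
  have d : is_derive t 1 (cst 0 : R -> F) 0 := is_derive_cst 0 t 1.
  apply: near_eq_is_derive d; apply: filterS near_ball => s /(cut_near sP e0 he) PP.
  by rewrite /cut asboolF// => /PP.
have ch : {for t, continuous h} by apply/differentiable_continuous/derivable1_diffP/dh.
have ch' : {for t, continuous (derive1 h)} by apply/differentiable_continuous/derivable1_diffP/dh'.
have ht : h t = 0 by exact: (adherent_eq0 oU Ut aV h0).
have ht' : (derive1 h) t = 0.
  apply: (adherent_eq0 oU Ut aV _ ch') => s Us Vs; rewrite derive1E.
  rewrite -[RHS](derive_cst (0 : F) s 1); apply: near_eq_derive.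
  apply: filterS2 (open_nbhs_nbhs (conj oU Us)) (open_nbhs_nbhs (conj oV Vs)) => u Uu Vu.
  by rewrite h0.
have c0 : cut 0 P h t = 0 by rewrite /cut ht; case: ifP.
have -> : cut 0 P (derive1 h) t = 0 by rewrite /cut ht'; case: ifP.
apply: is_derive_dquot; apply/cvgr0Pnorm_lt => e e0.
have := derivable_dquot (dh t Ut); rewrite -derive1E ht' => /cvgr0Pnorm_lt/(_ e e0).
apply: filterS => s; apply: le_lt_trans; rewrite c0 ht !subr0 !normrZ ler_wpM2l//.
by rewrite /cut /GRing.scale /= mulr1; case: ifP => // _; rewrite normr0.
Qed.

Lemma cut_derive1n V P U f : open V -> saturated V P -> open U ->
  (forall k t, U t -> derivable (derive1n k f) t 1) -> (forall t, U t -> V t -> f t = 0) ->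
  forall k t, U t -> derivable (derive1n k (cut 0 P f)) t 1 /\
    derive1n k (cut 0 P f) t = cut 0 P (derive1n k f) t.
Proof.
move=> oV sP oU df f0.
have f0k k t : U t -> V t -> derive1n k f t = 0.
  move=> Ut Vt; apply: (derive1n_adherent_eq0 k oV oU Ut _ df f0) => e e0.
  by exists t; rewrite ?subrr ?normr0.
have step1 k t : U t -> is_derive t 1 (cut 0 P (derive1n k f)) (cut 0 P (derive1n k.+1 f) t).
  move=> Ut; rewrite derive1nS; apply: (cut_is_derive oV sP oU Ut) => s Us.
  - exact: df.
  - by rewrite -derive1nS; exact: df.
  - by move=> Vs; exact: f0k.
have E k : forall t, U t -> derive1n k (cut 0 P f) t = cut 0 P (derive1n k f) t.
  elim: k => // k ih t Ut; rewrite derive1nS derive1E.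
  rewrite (_ : 'D_1 _ t = 'D_1 (cut 0 P (derive1n k f)) t); first by case: (step1 k t Ut).
  by apply: near_eq_derive; apply: filterS (open_nbhs_nbhs (conj oU Ut)) => s; exact: ih.
move=> k t Ut; split; last exact: E.
have [d _] := step1 k t Ut; apply: near_eq_derivable d.
by apply: filterS (open_nbhs_nbhs (conj oU Ut)) => s Us; rewrite E.
Qed.

Lemma Cinfty_cut V P U f : open V -> saturated V P -> open (U : set R^o) ->
  Cinfty (U : set R^o) (f : R^o -> F) -> (forall t, U t -> V t -> f t = 0) ->
  Cinfty (U : set R^o) (cut 0 P f : R^o -> F).
Proof.
move=> oV sP oU Cf f0; apply/(Cinfty_derive1n _ oU) => k t Ut.
by have [] := cut_derive1n oV sP oU (proj2 (Cinfty_derive1n f oU) Cf) f0 k Ut.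
Qed.

Lemma near_forall_le (T : Type) (S : set_system T) (Q : nat -> T -> Prop) k : Filter S ->
  (forall j, \forall x \near S, Q j x) -> \forall x \near S, forall j, (j <= k)%N -> Q j x.
Proof.
move=> FS Qj; elim: k => [|k ih].
  by apply: filterS (Qj 0%N) => x Qx j; rewrite leqn0 => /eqP ->.
apply: filterS2 ih (Qj k.+1) => x h1 h2 j; rewrite leq_eqVlt => /orP[/eqP ->//|]; exact: h1.
Qed.

Lemma Ck_exp k (E : normedModType R) (U : set E) (a : E -> R^o) j : open U -> Ck k U a ->
  Ck k U (fun x => a x ^+ j : R^o).
Proof.
move=> oU Ca; elim: j => [|j ih]; first exact: (Ck_cst k U (1 : R^o)).
by apply: (@Ck_eq _ _ _ _ _ (fun x => a x *: (a x ^+ j : R^o))) (Ck_scale oU Ca ih) => // x _; rewrite exprS.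
Qed.

(** The difference of the derivatives is continuous in (t, l) and vanishes at l = 1; compactness of
    [a, b] makes it uniformly small for l close to 1. *)
Lemma dilation_close f (a b m : R) k e : Cinfty setT (f : R^o -> F) ->
  (forall t, ~ (a < t < b) -> f t = 0) -> a <= m <= b -> 0 < e ->
  \forall l \near (1 : R)^'+, forall j, (j <= k)%N -> forall t,
    `|derive1n j (fun s => f (l * s + (1 - l) * m)) t - derive1n j f t| < e.
Proof.
move=> Cf f0 /andP[am mb] e0; apply: near_forall_le => j.
have oT : open [set: R^o] by exact: openT.
have oT2 : open [set: R^o * R^o] by exact: openT.
set g := derive1n j f; have Cg : Cinfty setT (g : R^o -> F) := Cinfty_iter_derive1 j oT Cf.
have g0 t : ~ (a <= t <= b) -> g t = 0.
  move=> tab; have oU : open [set s : R | ~ (a <= s <= b)].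
    rewrite (_ : [set s | _] = ~` `[a, b]%classic); first exact/closed_openC/itv_closed.
    by apply/seteqP; split=> s /=; rewrite in_itv.
  have -> : g t = derive1n j (cst 0) t.
    apply: (derive1n_eq_on oU) => // s /= sab; apply: f0 => /andP[h1 h2].
    by apply: sab; rewrite !ltW.
  by elim: (j) t {tab} => // i ih t; rewrite derive1nS derive1E (funext ih) derive_cst.
pose phi (p : R^o * R^o) : F := p.2 ^+ j *: g (p.2 * p.1 + (1 - p.2) * m) - g p.1.
have cphi : continuous phi.
  move=> p; apply: (@Ck_continuous R 0 _ _ setT) => //; move: 0%N => i.
  apply: Ck_add => //.
    apply: Ck_scale => //; first by apply: Ck_exp => //; exact: Ck_snd.
    rewrite -[X in Ck _ _ X]/((g : R^o -> F) \o (fun p : R^o * R^o => p.2 * p.1 + (1 - p.2) * m : R^o)).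
    apply: (Ck_comp oT2 oT _ _ (Cg i)) => //.
    apply: Ck_add => //; first exact: (Ck_scale oT2 (Ck_snd i setT) (Ck_fst i setT)).
    apply: (@Ck_scale _ _ _ _ _ (fun p : R^o * R^o => 1 - p.2 : R^o) (fun=> m : R^o)) => //; last exact: Ck_cst.
    apply: Ck_add => //; first exact: Ck_cst.
    apply: (@Ck_eq _ _ _ _ _ (fun p : R^o * R^o => (- 1 : R^o) *: p.2)) => //.
      by move=> q _; rewrite scaleN1r.
    by apply: Ck_scale => //; [exact: Ck_cst|exact: Ck_snd].
  apply: (@Ck_eq _ _ _ _ _ (fun p : R^o * R^o => (- 1 : R^o) *: (g : R^o -> F) p.1)) => //.
    by move=> q _; rewrite scaleN1r.
  apply: Ck_scale => //; first exact: Ck_cst.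
  rewrite -[X in Ck _ _ X]/((g : R^o -> F) \o fst).
  by apply: (Ck_comp oT2 oT _ _ (Cg i)) => //; exact: Ck_fst.
have /compact_near_coveringP/(_ _ _ (fun l t => `|phi (t, l)| < e)) cK := @segment_compact R a b.
have {}cK : \forall l \near (1 : R)^'+, `[a, b]%classic `<=` (fun t => `|phi (t, l)| < e).
  apply: cK => t _.
  have p1 : phi (t, 1) = 0 by rewrite /phi /= expr1n scale1r mul1r subrr mul0r addr0 subrr.
  have /cvgr0Pnorm_lt/(_ e e0) : phi p @[p --> ((t, 1) : R^o * R^o)] --> 0 by rewrite -p1; exact: cphi.
  move=> [[A B] /= [nA nB] AB]; exists (A, B) => //=; first by split=> //; exact: cvg_within.
apply: filterS2 cK (nbhs_right_gt 1) => l cK l1 t.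
rewrite (derive1n_affine j l ((1 - l) * m) t Cf) -/g.
have [tab|tab] := pselect (a <= t <= b).
  by have := cK t; rewrite /phi /=; apply; rewrite /= in_itv.
have g0t := g0 _ tab; rewrite g0t subr0 g0 ?scaler0 ?normr0//.
(* A dilation about [m] with l > 1 moves a point outside [a, b] further out, so that both terms are
   0 there. *)
have E : l * t + (1 - l) * m = t + (l - 1) * (t - m) by ring.
have l0 : 0 <= l - 1 by rewrite subr_ge0 ltW.
rewrite E; move=> /andP[h1 h2]; apply: tab; apply/andP; split.
  rewrite leNgt; apply/negP => ta; have : (l - 1) * (t - m) <= 0.
    by rewrite mulr_ge0_le0// subr_le0 (le_trans (ltW ta)).
  by move=> h; move: h1; rewrite leNgt => /negP; apply; rewrite -[a]addr0 ltr_leD.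
rewrite leNgt; apply/negP => bt; have : 0 <= (l - 1) * (t - m).
  by rewrite mulr_ge0// subr_ge0 (le_trans mb)// ltW.
by move=> h; move: h2; rewrite leNgt => /negP; apply; rewrite -[b]addr0 ltr_leD.
Qed.

(** Every point of the segment is either adherent to V, where Q holds nearby, or at positive
    distance from V; compactness makes the distance uniform. The bound is the mesh of a grid, so
    that a point where Q fails shares its component with a grid point. *)
Lemma near_adherent_segment V (Q : set R) (a b : R) :
  (forall t, adherent V t -> \forall s \near t, Q s) ->
  \forall N \near \oo, forall t, a <= t <= b ->
    Q t \/ forall v, V v -> (b - a) / N.+1%:R < `|v - t|.
Proof.
move=> VQ; pose S N t := Q t \/ forall v, V v -> (b - a) / N.+1%:R < `|v - t|.
have /compact_near_coveringP/(_ _ _ S) cK := @segment_compact R a b.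
have {}cK : \forall N \near \oo, `[a, b]%classic `<=` S N.
  apply: cK => t _; have [aV|/not_adherent[e e0 he]] := pselect (adherent V t).
    exists (Q, setT) => /=; first by split; [exact: VQ|exact: filterT].
    by move=> [s N] [/= Qs _]; left.
  exists ([set s | `|s - t| < e / 2], [set N | (b - a) / N.+1%:R < e / 2]) => /=.
    split; first by apply/nbhs_ballP; exists (e / 2); rewrite /= ?divr_gt0// => s; rewrite -ball_normE/= distrC.
    have e2 : 0 < e / 2 by rewrite divr_gt0.
    have [M hM] : exists M : nat, (b - a) / (e / 2) < M%:R.
      by exists (Num.bound `|(b - a) / (e / 2)|); exact: le_lt_trans (ler_norm _) (archi_boundP (normr_ge0 _)).
    exists M => // N /= MN; rewrite ltr_pdivrMr ?ltr0n// mulrC -ltr_pdivrMr//.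
    by apply: lt_le_trans hM _; rewrite ler_nat leqW.
  move=> [s N] [/= st hN]; right=> v Vv; apply: lt_trans hN _.
  have h := le_trans (he v Vv) (ler_distD s v t).
  by move: h st; set x := `|v - s|; set y := `|s - t| => h st; lra.
by apply: filterS cK => N h t /andP[at' tb]; apply: h; rewrite /= in_itv/= at' tb.
Qed.

Lemma saturated_bigU (S : seq R) (Q : R -> set R) V : (forall s, s \in S -> saturated V (Q s)) ->
  saturated V [set t | exists2 s, s \in S & Q s t].
Proof. by move=> sQ t u [s sS Qt] h; exists s => //; exact: (sQ s sS t). Qed.

Definition interval_comp V s : set R :=
  [set t | forall u, Num.min s t <= u <= Num.max s t -> ~ V u].

Lemma saturated_comp V s : saturated V (interval_comp V s).
Proof.
move=> t t' h h' u /andP[u1 u2].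
have [hu|hu] := pselect (Num.min s t <= u <= Num.max s t); first exact: h.
apply: h'; apply/andP; move: u1 u2 hu.
by case: (leP s t) => ?; case: (leP s t') => ?; case: (leP t t') => ? ? ? hu; split; rewrite leNgt; apply/negP => ?; apply: hu; apply/andP; split; lra.
Qed.

(** The left end of the component of s, found as the supremum of the points of V below s. *)
Lemma left_adherent V s w : V w -> w <= s -> ~ V s -> exists a, [/\ a <= s,
  forall u, a < u <= s -> ~ V u & forall e : R, 0 < e -> exists v, [/\ V v, a - e < v & v <= a]].
Proof.
move=> Vw ws nVs; pose E := V `&` [set x | x <= s].
have hE : has_sup E by split; [exists w|exists s => x []].
exists (sup E); split.
- by apply: ge_sup => [|x []//]; exists w.
- move=> u /andP[su us] Vu; have : u <= sup E by apply: (sup_upper_bound hE).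
  by rewrite leNgt su.
- move=> e e0; have [v [Vv vs] hv] := sup_adherent e0 hE.
  by exists v; split=> //; apply: (sup_upper_bound hE).
Qed.

Lemma right_adherent V s w : V w -> s <= w -> ~ V s -> exists b, [/\ s <= b,
  forall u, s <= u < b -> ~ V u & forall e : R, 0 < e -> exists v, [/\ V v, v < b + e & b <= v]].
Proof.
move=> Vw sw nVs; have := @left_adherent [set x | V (- x)] (- s) (- w).
rewrite /= !opprK lerN2 => /(_ Vw sw nVs)[a [as_ nV aV]]; exists (- a); split.
- by rewrite lerNr.
- by move=> u /andP[su ub]; have := nV (- u); rewrite /= opprK; apply; rewrite lerN2 su andbT ltrNr.
- move=> e e0; have [v [Vv h1 h2]] := aV e e0; exists (- v); split=> //.
    by lra.
  by rewrite lerN2.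
Qed.

End LineCalculus.

(** * Smooth paths in a Lie group *)

Definition plateau (R : realType) (a a' b' b t : R) : R :=
  step ((t - a) / (a' - a)) * step ((b - t) / (b - b')).

Section Plateau.
Variables (R : realType) (a a' b' b : R).
Hypotheses (aa' : a < a') (bb' : b' < b).

Lemma Ck_plateau k : Ck k setT (plateau a a' b' b : R^o -> R^o).
Proof.
have oT : open [set: R^o] by exact: openT.
apply: (@Ck_scale _ _ _ _ _ (fun t : R^o => step ((t - a) / (a' - a)) : R^o)
    (fun t : R^o => step ((b - t) / (b - b')) : R^o)) => //.
  by apply: (Ck_step_affine _ (a := (a' - a)^-1) (b := - a / (a' - a))) => t; ring.
by apply: (Ck_step_affine _ (a := - (b - b')^-1) (b := b / (b - b'))) => t; ring.
Qed.

Lemma plateau_out t : ~ (a < t < b) -> plateau a a' b' b t = 0.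
Proof.
move=> h; rewrite /plateau; have [ta|a_t] := leP t a.
  by rewrite step_le0 ?mul0r// mulr_le0_ge0// ?invr_ge0 ?subr_le0// subr_ge0 ltW.
have [bt|tb] := leP b t; last by case: h; rewrite a_t tb.
by rewrite (@step_le0 _ ((b - t) / _)) ?mulr0// mulr_le0_ge0// ?invr_ge0 ?subr_le0// subr_ge0 ltW.
Qed.

Lemma plateau_in t : a' <= t <= b' -> plateau a a' b' b t = 1.
Proof.
move=> /andP[h1 h2]; rewrite /plateau !step_ge1 ?mulr1//.
  by rewrite ler_pdivlMr ?subr_gt0// mul1r lerB.
by rewrite ler_pdivlMr ?subr_gt0// mul1r lerB.
Qed.

Lemma plateau_01 t : 0 <= plateau a a' b' b t <= 1.
Proof. by rewrite mulr_ge0 ?step_ge0//= mulr_ile1 ?step_ge0 ?step_le1. Qed.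

End Plateau.

(** * Good paths among the paths trivial on V *)

Section CommutingPaths.
Variables (R : realType) (n : nat) (G : lieGroup 'rV[R]_n).
Variables (c : chart 'rV[R]_n G) (x0 : 'rV[R]_n).
Local Notation A := (lie_atlas G).
Local Notation E := 'rV[R]_n.
Hypotheses (Ac : A c) (cx0 : chart_dom c x0) (c1 : c x0 = 1%g).
Hypothesis G_semisimple : semisimple G.
Variable V : set R.
Hypothesis oV : open V.
(** Kept abstract, so that only closure under the group operations, commutators and limits is used.
    It will consist of the paths whose periodization has all its lifts commuting with a fixed
    element. *)
Variable good : set (fun_group R G).
Implicit Types (f : R -> E) (X : fun_group R G) (t : R).
Let mA : is_manifold A := lie_manifold G.
Let oT : open [set: R^o] := openT.

Definition trivial_on X := smooth_to A setT (X : R^o -> G) /\ forall t, V t -> X t = 1%g.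

(** A path in the chart is given by its displacement from [x0], so that being 1 on V becomes the
    linear condition of vanishing there. *)
Definition small_path f := [/\ Cinfty setT (f : R^o -> E),
  forall t, V t -> f t = 0 & forall t, chart_dom c (x0 + f t)].

Definition path_of f : fun_group R G := fun t => c (x0 + f t).

Hypothesis good1 : good 1%g.
Hypothesis goodM : forall X Y, good X -> good Y -> good (X * Y)%g.
Hypothesis goodV : forall X, good X -> good X^-1%g.
Hypothesis goodR : forall X Y, trivial_on X -> trivial_on Y -> good [~ X, Y]%g.
Hypothesis goodL : forall f, small_path f ->
  (forall k (e : R), 0 < e -> exists f', [/\ small_path f', good (path_of f') &
    forall j, (j <= k)%N -> forall t, `|derive1n j f' t - derive1n j f t| < e]) ->
  good (path_of f).

Lemma Ck_shift k f : Ck k setT (f : R^o -> E) ->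
  Ck k setT ((fun t => x0 + f t) : R^o -> E).
Proof. by move=> Cf; apply: Ck_add => //; exact: Ck_cst. Qed.

Lemma path_of_trivial f : small_path f -> trivial_on (path_of f).
Proof.
move=> [Cf f0 df]; split; last by move=> t Vt; rewrite /path_of f0// addr0.
apply: (smooth_to_comp mA oT (chart_open mA Ac) _ _ (smooth_to_chart mA Ac)) => [t _|k]; first exact: df.
exact: (Ck_shift (Cf k)).
Qed.

Lemma trivial_onV X : trivial_on X -> trivial_on X^-1%g.
Proof.
move=> [sX X1]; split; first exact: smooth_to_inv.
by move=> t Vt; rewrite -[LHS]/((X t)^-1)%g X1// invg1.
Qed.

Lemma good_prod (I : eqType) (s : seq I) (X : I -> fun_group R G) :
  (forall p, p \in s -> good (X p)) -> good (\prod_(p <- s) X p)%g.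
Proof.
elim: s => [|p s ih] h; first by rewrite big_nil.
rewrite big_cons; apply: goodM; first by apply: h; rewrite mem_head.
by apply: ih => q qs; apply: h; rewrite inE qs orbT.
Qed.

Lemma fun_prodE (I : Type) (s : seq I) (X : I -> fun_group R G) t :
  ((\prod_(p <- s) X p) t = \prod_(p <- s) X p t)%g.
Proof. by elim: s => [|p s ih]; rewrite ?big_nil// !big_cons -ih. Qed.

(* A constant factor c a of a commutator word may be replaced by a path that is
   supported in ]a, b[ and takes the value c a on the support of f. This needs a
   compact support, which is obtained by dilating f about the midpoint of ]a, b[. *)
Lemma small_supported_good : exists2 e : R, 0 < e & ball x0 e `<=` chart_dom c /\
  forall f, Cinfty setT (f : R^o -> E) -> (forall t, ball x0 e (x0 + f t)) ->
  forall a b, (forall t, a < t < b -> ~ V t) -> (forall t, ~ (a < t < b) -> f t = 0) ->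
  good (path_of f).
Proof.
have oD := chart_open mA Ac.
have [r r0 rD] : exists2 r : R, 0 < r & ball x0 r `<=` chart_dom c.
  by apply/nbhs_ballP; exact: open_nbhs_nbhs.
have [e [b [L [e0 b0 Cb Lr bE]]]] := chart_commutator_word Ac cx0 c1 G_semisimple r0.
pose e1 := Num.min e r.
have e10 : 0 < e1 by rewrite lt_min e0.
have se y : ball x0 e1 y -> ball x0 e y /\ ball x0 r y.
  by rewrite -!ball_normE /= lt_min => /andP.
exists e1 => //; split; first by move=> y /se[_]; exact: rD.
have oB : open (ball x0 e) by exact: ball_open.
have compact_case f a a' b' b_ : Cinfty setT (f : R^o -> E) ->
    (forall t, ball x0 e1 (x0 + f t)) -> a < a' -> b' < b_ -> (forall t, a < t < b_ -> ~ V t) ->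
    (forall t, ~ (a' < t < b') -> f t = 0) -> good (path_of f).
  move=> Cf fe aa bb nV f0.
  pose chi := plateau a a' b' b_.
  have chiV t : V t -> chi t = 0 by move=> Vt; apply: plateau_out => // /nV.
  have fV t : V t -> f t = 0.
    move=> Vt; apply: f0 => /andP[h1 h2]; apply: (nV t) => //.
    by rewrite (lt_trans aa h1) (lt_trans h2 bb).
  pose u (p : 'I_n * (E * E)) t : E := chi t *: (p.2.1 - x0).
  pose w (p : 'I_n * (E * E)) t : E := b (x0 + f t) 0 p.1 *: p.2.2.
  have su p : p \in L -> small_path (u p).
    move=> pL; split.
    - move=> k; apply: (@Ck_scale _ _ _ _ _ (chi : R^o -> R^o) (fun=> p.2.1 - x0)) => //.
        exact: Ck_plateau.
      exact: Ck_cst.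
    - by move=> t Vt; rewrite /u chiV// scale0r.
    - move=> t; apply: rD; have := Lr p pL; rewrite -!ball_normE /= => pr.
      rewrite opprD addNKr normrN normrZ; have /andP[h1 h2] := plateau_01 a a' b' b_ t.
      rewrite (ger0_norm h1); apply: le_lt_trans pr.
      by rewrite -normrN opprB; apply: ler_piMl.
  have sw p : p \in L -> small_path (w p).
    move=> pL; split.
    - move=> k; apply: (@Ck_scale _ _ _ _ _ (fun t : R^o => b (x0 + f t) 0 p.1 : R^o) (fun=> p.2.2)) => //; last exact: Ck_cst.
      apply: Ck_coord_comp => //.
      rewrite -[X in Ck _ _ X]/(b \o (fun t : R^o => x0 + f t)).
      apply: (Ck_comp oT oB _ (Ck_shift (Cf k)) (Cb k)) => t _.
      by have [] := se _ (fe t).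
    - by move=> t Vt; rewrite /w fV// addr0 b0 mxE scale0r.
    - by move=> t; have [h _] := bE _ (proj1 (se _ (fe t))); exact: h.
  rewrite (_ : path_of f = \prod_(p <- L) [~ (path_of (u p))^-1, (path_of (w p))^-1])%g; last first.
    apply/funext => t; rewrite fun_prodE /path_of.
    have [_ ->] := bE _ (proj1 (se _ (fe t))); rewrite /commutator_word.
    apply: eq_bigr => p _.
    rewrite -[RHS]/([~ (c (x0 + u p t)%R)^-1, (c (x0 + w p t)%R)^-1])%g.
    (* Outside ]a', b'[ the second entry is 1, which makes the commutator trivial whatever the
       cutoff does to the first entry. *)
    have [ht|ht] := pselect (a' < t < b').
      have ch1 : chi t = 1 by apply: plateau_in => //; case/andP: ht => h1 h2; rewrite !ltW.
      by have -> : x0 + u p t = p.2.1 by rewrite /u ch1 scale1r addrC subrK.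
    by rewrite /w f0// addr0 b0 mxE scale0r addr0 c1 invg1 !commg1.
  apply: good_prod => p pL; apply: goodR; apply: trivial_onV; apply: path_of_trivial.
    exact: su.
  exact: sw.
move=> f Cf fe a b_ nV f0; have [ba|ab] := leP b_ a.
  rewrite (_ : path_of f = 1%g) //; apply/funext => t; rewrite /path_of f0 ?addr0 ?c1//.
  by move=> /andP[h1 h2]; have := lt_trans h1 h2; rewrite ltNge ba.
pose m := (a + b_) / 2.
have am : a < m by rewrite /m; lra.
have mb : m < b_ by rewrite /m; lra.
have fV t : V t -> f t = 0 by move=> Vt; apply: f0 => /nV.
have fD t : chart_dom c (x0 + f t) by apply/rD; have [] := se _ (fe t).
apply: goodL => // k d d0.
have := dilation_close k Cf f0 (introT andP (conj (ltW am) (ltW mb))) d0.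
have := nbhs_right_gt (1 : R) => h1 h2.
have [l [l1 hl]] := filter_ex (filterI h1 h2).
have l0 : 0 < l by apply: lt_trans l1.
exists (fun s => f (l * s + (1 - l) * m)).
have aa : a < (a - (1 - l) * m) / l by rewrite ltr_pdivlMr//; nra.
have bb : (b_ - (1 - l) * m) / l < b_ by rewrite ltr_pdivrMr//; nra.
have Cg : Cinfty setT ((fun s => f (l * s + (1 - l) * m)) : R^o -> E).
  move=> i; rewrite -[X in Ck _ _ X]/((f : R^o -> E) \o (fun s : R^o => l * s + (1 - l) * m : R^o)).
  by apply: (Ck_comp oT oT _ _ (Cf i)) => //; exact: Ck_affine.
have g0 t : ~ ((a - (1 - l) * m) / l < t < (b_ - (1 - l) * m) / l) -> f (l * t + (1 - l) * m) = 0.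
  move=> h; apply: f0 => /andP[h3 h4]; apply: h; rewrite ltr_pdivrMr// ltr_pdivlMr//.
  by apply/andP; split; lra.
have gV t : V t -> f (l * t + (1 - l) * m) = 0.
  move=> Vt; apply: g0 => /andP[h3 h4]; apply: (nV t) => //.
  by rewrite (lt_trans aa h3) (lt_trans h4 bb).
by split=> //; apply: (compact_case _ _ _ _ _ Cg _ aa bb).
Qed.

Lemma small_valued_good : exists2 O : set (mfd A), open O /\ O 1%g &
  forall X a b, smooth_to A setT (X : R^o -> G) -> (forall t, O (X t)) ->
  (forall t, a < t < b -> ~ V t) -> (forall t, ~ (a < t < b) -> X t = 1%g) -> good X.
Proof.
have [e e0 [eD eG]] := small_supported_good.
exists (c @` ball x0 e).
  by split; [apply: (chart_image_open mA Ac) => //; exact: ball_open|exists x0 => //; exact: ballxx].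
move=> X a b sX XO nV X1; pose f t := chart_coord c (X t) - x0.
have fE t : x0 + f t = chart_coord c (X t) by rewrite addrC subrK.
have Xc t : chart_cod c (X t) by have [y ye <-] := XO t; exists y => //; exact: eD.
have Cf : Cinfty setT (f : R^o -> E).
  move=> k; apply: Ck_add => //; last exact: Ck_cst.
  by apply: (smooth_to_Cinfty Ac sX) => t _; exact: Xc.
have XE : X = path_of f.
  by apply/funext => t; rewrite /path_of fE; have [_ ->] := chart_coordP mA Ac (Xc t).
rewrite XE; apply: (eG f Cf _ a b nV).
  by move=> t; rewrite fE; have [y ye <-] := XO t; rewrite (chart_coordK mA)//; exact: eD.
by move=> t /X1 Xt; rewrite /f Xt (coord1 Ac cx0 c1) subrr.
Qed.

Lemma open_lmul (g : G) (W : set (mfd A)) : open W -> open ([set h | W (g * h)%g] : set (mfd A)).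
Proof.
move=> oW; rewrite open_mfdE => d Ad x dx Wx.
have od := chart_open mA Ad.
have sg : smooth_to A (chart_dom d) (fun y => g * d y)%g.
  by apply: smooth_to_mul => //; [exact: smooth_to_cst|exact: smooth_to_chart].
have := open_nbhs_nbhs (conj (smooth_to_preimage od sg oW) (conj dx Wx)).
by apply: filterS => y [].
Qed.

(** The shape is that of the quotient of two neighbouring rows of a grid: (k c x)^-1 (k' c z), where
    k^-1 k' = c y. *)
Lemma near1_mul (O : set (mfd A)) : open O -> O 1%g -> exists2 r : R, 0 < r &
  ball x0 r `<=` chart_dom c /\
  forall x y z, ball x0 r x -> ball x0 r y -> ball x0 r z -> O ((c x)^-1 * c y * c z)%g.
Proof.
move=> oO O1; have oD := chart_open mA Ac.
pose D : set (E * E * E) := chart_dom c `*` chart_dom c `*` chart_dom c.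
have oDC : open (chart_dom c `*` chart_dom c : set (E * E)) by exact: open_setX.
have oDD : open D by exact: open_setX.
have sc (q : E * E * E -> E) : (forall k, Ck k D q) ->
    (forall p, D p -> chart_dom c (q p)) -> smooth_to A D (fun p => c (q p)).
  by move=> Cq qD; apply: (smooth_to_comp mA oDD oD qD Cq (smooth_to_chart mA Ac)).
have C1 k : Ck k D (fun p : E * E * E => p.1) := Ck_fst k D.
have C11 k : Ck k D (fun p : E * E * E => p.1.1).
  exact: (@Ck_comp _ _ _ _ _ D _ _ fst oDD oDC (fun p h => proj1 h) (C1 k) (Ck_fst k _)).
have C12 k : Ck k D (fun p : E * E * E => p.1.2).
  exact: (@Ck_comp _ _ _ _ _ D _ _ snd oDD oDC (fun p h => proj1 h) (C1 k) (Ck_snd k _)).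
have s1 := sc _ C11 (fun p h => proj1 (proj1 h)).
have s2 := sc _ C12 (fun p h => proj2 (proj1 h)).
have s3 := sc _ (fun k => Ck_snd k D) (fun p h => proj2 h).
have sm := smooth_to_mul oDD (smooth_to_mul oDD (smooth_to_inv oDD s1) s2) s3.
have oS := smooth_to_preimage oDD sm oO.
have : nbhs (x0, x0, x0) (D `&` [set p | O ((c p.1.1)^-1 * c p.1.2 * c p.2)%g]).
  by apply: open_nbhs_nbhs; split=> //; split=> //=; rewrite c1 invg1 !mulg1.
move=> /nbhs_ballP[r r0 rS]; exists r => //; split.
  by move=> x xr; have [] := rS (x, x0, x0) (conj (conj xr (ballxx _ r0)) (ballxx _ r0)); case=> -[].
by move=> x y z xr yr zr; have [] := rS (x, y, z) (conj (conj xr yr) zr).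
Qed.

Hypothesis G_simply_connected : simply_connected R (mfd A).

(** Uniform continuity on the compact square, measured by left quotients; the scale is 1 / (N + 1)
    because it becomes the mesh of the grid. *)
Lemma homotopy_uniform (K : R * R -> mfd A) (r : R) : 0 < r -> ball x0 r `<=` chart_dom c ->
  {within `[0, 1] `*` `[0, 1], continuous K} ->
  exists N : nat, forall s t s' t' : R, 0 <= s <= 1 -> 0 <= t <= 1 -> 0 <= s' <= 1 -> 0 <= t' <= 1 ->
    `|s - s'| <= N.+1%:R^-1 -> `|t - t'| <= N.+1%:R^-1 ->
    (c @` ball x0 r) ((K (s, t) : G)^-1 * (K (s', t') : G))%g.
Proof.
move=> r0 rD /subspace_continuousP cK.
pose B : set (mfd A) := c @` ball x0 r.
have oB : open B by apply: (chart_image_open mA Ac) => //; exact: ball_open.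
have B1 : B 1%g by exists x0 => //; exact: ballxx.
have [r1 r10 [r1D r1B]] := near1_mul oB B1.
pose S := (`[0, 1] `*` `[0, 1] : set (R * R))%classic.
have cS : compact S by apply: compact_setX; exact: segment_compact.
pose P (d : R) (p : R * R) := forall q, S q -> ball p d q ->
  B ((K p : G)^-1 * (K q : G))%g.
have /near_covering_withinP/(_ _ _ P) cP := proj1 (compact_near_coveringP S) cS.
have {}cP : \forall d \near (0 : R)^'+, S `<=` P d.
  apply: cP => p Sp.
  have nO : nbhs (K p) ([set h | (c @` ball x0 r1) ((K p : G)^-1 * h)%g] : set (mfd A)).
    apply: open_nbhs_nbhs; split.
      by apply: open_lmul; apply: (chart_image_open mA Ac) => //; exact: ball_open.
    by exists x0; [exact: ballxx|rewrite c1 mulVg].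
  have : \forall q \near p, S q -> (c @` ball x0 r1) ((K p : G)^-1 * (K q : G))%g := cK p Sp _ nO.
  move=> /nbhs_ballP[d d0 dK].
  exists (ball p (d / 2), [set x | x < d / 2]) => /=.
    split; first by apply: nbhsx_ballx; rewrite divr_gt0.
    by apply: nbhs_right_lt; rewrite divr_gt0.
  move=> [p1 d1] [/= pp1 dd1] Sp1 q Sq p1q.
  have p1d : ball p d p1 by apply: le_ball pp1; have : 0 < d := d0; lra.
  have qd : ball p d q.
    by rewrite [d]splitr; apply: ball_triangle pp1 _; apply: le_ball p1q; exact: ltW.
  have [x xr xE] := dK _ p1d Sp1; have [y yr yE] := dK _ qd Sq.
  have := r1B x y x0 xr yr (ballxx _ r10); rewrite xE yE c1 mulg1.
  by rewrite invgM invgK mulgA mulgK.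
have [d [d0 dP]] := filter_ex (filterI (nbhs_right_gt (0 : R)) cP).
have [N hN] : exists N : nat, N.+1%:R^-1 < d.
  exists (Num.bound d^-1); rewrite invf_plt ?posrE//.
  by apply: lt_le_trans (archi_boundP _) _; rewrite ?ler_nat// invr_ge0 ltW.
exists N => s t s' t' s01 t01 s01' t01' ss tt.
by apply: dP => //; split=> /=; rewrite -?ball_normE /=; apply: le_lt_trans hN.
Qed.

Lemma prod_telescope (k : nat -> G) m : (\prod_(0 <= i < m) ((k i)^-1 * k i.+1) = (k 0)^-1 * k m)%g.
Proof.
elim: m => [|m ih]; first by rewrite big_nil mulVg.
by rewrite big_nat_recr//= ih mulgA mulgK.
Qed.

(** Factor i moves from 1 to its final value while N x runs from i to i + 1. If c (x0 + v i) = (k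
    i)^-1 k i.+1, the product telescopes to (k 0)^-1 k m at x = m / N. As every factor is smooth on
    the whole line, nothing has to be glued at the grid points. *)
Definition grid_row (N : nat) (v : nat -> E) (x : R) : G :=
  (\prod_(0 <= i < N) c (x0 + step (N%:R * x - i%:R) *: v i)%R)%g.

Lemma grid_row_le0 N v x : x <= 0 -> grid_row N v x = 1%g.
Proof.
move=> x_le0; rewrite /grid_row big1// => i _; rewrite step_le0 ?scale0r ?addr0//.
by rewrite subr_le0 (@le_trans _ _ 0)// mulr_ge0_le0.
Qed.

Lemma grid_row_prefix N v (k : nat -> G) x m : (m <= N)%N ->
  (forall i, (i < N)%N -> c (x0 + v i) = (k i)^-1 * k i.+1)%g -> m%:R <= N%:R * x ->
  (\prod_(0 <= i < m) c (x0 + step (N%:R * x - i%:R) *: v i)%R = (k 0)^-1 * k m)%g.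
Proof.
move=> mN vk mx; rewrite -prod_telescope; apply: eq_big_nat => i /andP[_ im].
rewrite -vk ?(leq_trans im)// step_ge1 ?scale1r// lerBrDr.
by apply: le_trans mx; rewrite addrC natr1 ler_nat.
Qed.

Lemma grid_row_ge1 N v (k : nat -> G) x : 1 <= x ->
  (forall i, (i < N)%N -> c (x0 + v i) = (k i)^-1 * k i.+1)%g ->
  grid_row N v x = ((k 0)^-1 * k N)%g.
Proof. by move=> x1 vk; apply: grid_row_prefix => //; rewrite ler_peMr. Qed.

Lemma grid_row_mid N v (k : nat -> G) x m : (m < N)%N ->
  (forall i, (i < N)%N -> c (x0 + v i) = (k i)^-1 * k i.+1)%g -> m%:R <= N%:R * x <= m.+1%:R ->
  grid_row N v x = ((k 0)^-1 * k m * c (x0 + step (N%:R * x - m%:R) *: v m)%R)%g.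
Proof.
move=> mN vk /andP[mx xm]; rewrite /grid_row (@big_cat_nat _ _ _ m)//=; last exact: ltnW.
rewrite (grid_row_prefix (ltnW mN) vk mx) big_ltn// [X in (_ * (_ * X))%g](_ : _ = 1%g) ?mulg1//.
rewrite big_nat_cond big1// => i /andP[/andP[mi _] _].
by rewrite step_le0 ?scale0r ?addr0// subr_le0 (le_trans xm)// ler_nat.
Qed.

Lemma grid_row_smooth N v (a b : R) : (forall i, (i < N)%N -> forall s : R, 0 <= s <= 1 ->
  chart_dom c (x0 + s *: v i)) ->
  smooth_to A setT ((fun t => grid_row N v ((t - a) / (b - a))) : R^o -> G).
Proof.
move=> vD; have oD := chart_open mA Ac.
have sv i : (i < N)%N -> smooth_to A setT
    ((fun t => c (x0 + step (N%:R * ((t - a) / (b - a)) - i%:R) *: v i)) : R^o -> G).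
  move=> iN; pose f t := step (N%:R * ((t - a) / (b - a)) - i%:R) *: v i.
  rewrite -[X in smooth_to _ _ X]/(c \o (fun t : R^o => x0 + f t)).
  apply: (smooth_to_comp mA oT oD _ _ (smooth_to_chart mA Ac)) => [t _|k].
    by apply: vD => //; rewrite step_ge0 step_le1.
  apply: Ck_shift; apply: (@Ck_scale _ _ _ _ _ (fun t : R^o => step (N%:R * ((t - a) / (b - a)) - i%:R) : R^o) (fun=> v i)) => //; last exact: Ck_cst.
  by apply: (Ck_step_affine _ (a := N%:R / (b - a)) (b := - a * N%:R / (b - a) - i%:R)) => t; ring.
suff : forall m, (m <= N)%N -> smooth_to A setT ((fun t =>
    \prod_(0 <= i < m) c (x0 + step (N%:R * ((t - a) / (b - a)) - i%:R) *: v i)%R)%g : R^o -> G).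
  by move/(_ N (leqnn N)).
elim=> [_|m ih mN].
  rewrite (_ : (fun t => _) = (fun=> 1%g)); first exact: smooth_to_cst.
  by apply/funext => t; rewrite big_nil.
refine (eq_ind _ (smooth_to A setT) (smooth_to_mul oT (ih (ltnW mN)) (sv m mN)) _ _).
by apply/funext => t; rewrite [RHS]big_nat_recr.
Qed.

(* The rows of a fine grid on a null homotopy of X are interpolated to smooth
   paths; consecutive rows differ by a path with values close to 1. *)
Lemma supported_good X a b : trivial_on X -> (forall t, a < t < b -> ~ V t) ->
  (forall t, ~ (a < t < b) -> X t = 1%g) -> good X.
Proof.
move=> [sX _] nV X1; have [ba|ab] := leP b a.
  rewrite (_ : X = 1%g) //; apply/funext => t; rewrite X1//.
  by move=> /andP[h1 h2]; have := lt_trans h1 h2; rewrite ltNge ba.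
have ba0 : 0 < b - a by rewrite subr_gt0.
have [W [oW W1] Wgood] := small_valued_good.
have [r r0 [rD rW]] := near1_mul oW W1.
pose tau t := (t - a) / (b - a).
pose f (x : R) : mfd A := X (a + x * (b - a)).
have fc : {within `[0, 1], continuous f}.
  apply: continuous_subspaceT => x; apply: (@continuous_comp _ _ _ (fun x : R => a + x * (b - a) : R) (X : R -> mfd A)).
    by apply: cvgD; [exact: cvg_cst|apply: cvgM; [exact: cvg_id|exact: cvg_cst]].
  by case: sX => cX _; exact: cX.
have f0 : f 0 = 1%g by rewrite /f mul0r addr0 X1// ltxx.
have f1 : f 1 = 1%g by rewrite /f mul1r addrC subrK X1// ltxx andbF.
have [K [cK K0 K1 Ks]] := G_simply_connected.2 f fc (etrans f0 (esym f1)).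
have [N hN] := homotopy_uniform r0 rD cK.
have N0 : 0 < N.+1%:R :> R by rewrite ltr0n.
pose k j i : G := K (j%:R / N.+1%:R, i%:R / N.+1%:R).
have kc j j' i i' : (j <= N.+1)%N -> (i <= N.+1)%N -> (j' <= N.+1)%N -> (i' <= N.+1)%N ->
    (j' <= j.+1)%N -> (j <= j')%N -> (i' <= i.+1)%N -> (i <= i')%N ->
    (c @` ball x0 r) ((k j i)^-1 * k j' i')%g.
  move=> jN iN jN' iN' jj1 jj2 ii1 ii2.
  have q01 m : (m <= N.+1)%N -> 0 <= (m%:R / N.+1%:R : R) <= 1.
    by move=> mN; rewrite divr_ge0//= ler_pdivrMr// mul1r ler_nat.
  have qd m m' : (m' <= m.+1)%N -> (m <= m')%N -> `|m%:R / N.+1%:R - m'%:R / N.+1%:R : R| <= N.+1%:R^-1.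
    move=> m1 m2; rewrite -mulrBl normrM (ger0_norm (x := N.+1%:R^-1)) ?invr_ge0//.
    rewrite ler_piMl ?invr_ge0// distrC ger0_norm ?subr_ge0 ?ler_nat//.
    by rewrite lerBlDr addrC natr1 ler_nat.
  by apply: hN; rewrite ?q01 ?qd.
pose v j i := chart_coord c ((k j i)^-1 * k j i.+1)%g - x0.
have vE j i : (j <= N.+1)%N -> (i < N.+1)%N ->
    ball x0 r (x0 + v j i) /\ c (x0 + v j i) = ((k j i)^-1 * k j i.+1)%g.
  move=> jN iN; have [x xr xE] := kc j j i i.+1 jN (ltnW iN) jN iN (leqnSn _) (leqnn _) (leqnn _) (leqnSn _).
  by rewrite /v -xE (chart_coordK mA Ac (rD _ xr)) addrC subrK.
have k0 j : (j <= N.+1)%N -> k j 0%N = 1%g /\ k j N.+1 = 1%g.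
  move=> jN; rewrite /k mul0r divff ?gt_eqF//; rewrite -f0; apply: Ks.
  by rewrite in_itv/= divr_ge0//= ler_pdivrMr// mul1r ler_nat.
pose row j : fun_group R G := fun t => grid_row N.+1 (v j) (tau t).
have vball j i (s : R) : (j <= N.+1)%N -> (i < N.+1)%N -> 0 <= s <= 1 -> ball x0 r (x0 + s *: v j i).
  move=> jN iN /andP[s0 s1]; have [vr _] := vE j i jN iN.
  move: (v j i) vr => w; rewrite -!ball_normE /= !opprD !addNKr !normrN normrZ (ger0_norm s0).
  by apply: le_lt_trans; apply: ler_piMl.
have row_s j : (j <= N.+1)%N -> smooth_to A setT (row j : R^o -> G).
  by move=> jN; apply: grid_row_smooth => i iN s s01; apply: rD; exact: vball.
have row_out j t : (j <= N.+1)%N -> ~ (a < t < b) -> row j t = 1%g.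
  move=> jN h; rewrite /row; have [ta|a_t] := leP t a.
    by rewrite grid_row_le0// mulr_le0_ge0 ?subr_le0// invr_ge0 ltW.
  rewrite (grid_row_ge1 (k := k j)).
  - by have [-> ->] := k0 j jN; rewrite invg1 mulg1.
  - rewrite ler_pdivlMr// mul1r lerB// leNgt; apply/negP => tb; apply: h.
    by rewrite a_t tb.
  - by move=> i iN; have [] := vE j i jN iN.
have cell t : a < t < b -> exists m, [/\ (m < N.+1)%N, m%:R <= N.+1%:R * tau t <= m.+1%:R &
    forall j, (j <= N.+1)%N -> exists2 x, ball x0 r x & row j t = (k j m * c x)%g].
  move=> /andP[a_t tb]; have t0 : 0 < tau t by rewrite divr_gt0// subr_gt0.
  have t1 : tau t < 1 by rewrite ltr_pdivrMr// mul1r ltrD2r.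
  have Nt0 : 0 <= N.+1%:R * tau t by rewrite mulr_ge0// ltW.
  have mN : (Num.truncn (N.+1%:R * tau t) < N.+1)%N by rewrite truncn_lt_nat// gtr_pMr.
  have mm : (Num.truncn (N.+1%:R * tau t))%:R <= N.+1%:R * tau t <= (Num.truncn (N.+1%:R * tau t)).+1%:R.
    by have /andP[-> h] := truncn_itv Nt0; exact: ltW.
  exists (Num.truncn (N.+1%:R * tau t)); split=> // j jN.
  set m := Num.truncn _ in mN mm *.
  exists (x0 + step (N.+1%:R * tau t - m%:R) *: v j m).
    by apply: vball => //; rewrite step_ge0 step_le1.
  rewrite /row (grid_row_mid (k := k j) mN _ mm); last by move=> i iN; have [] := vE j i jN iN.
  by have [-> _] := k0 j jN; rewrite invg1 mul1g.
have B0 : ball x0 r x0 by exact: ballxx.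
have row_step j : (j < N.+1)%N -> good ((row j)^-1 * row j.+1)%g.
  move=> jN; apply: (Wgood _ a b _ _ nV).
  - exact: (smooth_to_mul oT (smooth_to_inv oT (row_s j (ltnW jN))) (row_s j.+1 jN)).
  - move=> t; rewrite -[X in W X]/((row j t)^-1 * row j.+1 t)%g.
    have [h|h] := pselect (a < t < b); last by rewrite !row_out ?invg1 ?mulg1 ?(ltnW jN).
    have [m [mN _ hm]] := cell t h.
    have [x xr ->] := hm j (ltnW jN); have [y yr ->] := hm j.+1 jN.
    have [z zr zE] := kc j j.+1 m m (ltnW jN) (ltnW mN) jN (ltnW mN) (leqnn _) (leqnSn _) (leqnSn _) (leqnn _).
    by have := rW x z y xr zr yr; rewrite zE invgM !mulgA.
  - by move=> t h; rewrite -[LHS]/((row j t)^-1 * row j.+1 t)%g !row_out ?invg1 ?mulg1 ?(ltnW jN).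
have rowN : row N.+1 = 1%g.
  have kN i : (i <= N.+1)%N -> k N.+1 i = 1%g.
    move=> iN; rewrite /k divff ?gt_eqF// K1// ?f0//.
    by rewrite in_itv/= divr_ge0//= ler_pdivrMr// mul1r ler_nat.
  apply/funext => t; rewrite /row /grid_row big_nat_cond big1// => i /andP[/andP[_ iN] _].
  have -> : v N.+1 i = 0 by rewrite /v !kN ?(ltnW iN)// invg1 mulg1 (coord1 Ac cx0 c1) subrr.
  by rewrite scaler0 addr0.
(* Upwards in [m] from the trivial last row: a row is the next row times the inverse of their good
   quotient. *)
have good_row m : (m <= N.+1)%N -> good (row (N.+1 - m)%N).
  elim: m => [|m ih] mN; first by rewrite subn0 rowN.
  have e : (N.+1 - m = (N.+1 - m.+1).+1)%N by rewrite subnSK.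
  have jN : (N.+1 - m.+1 < N.+1)%N by rewrite subSS ltnS leq_subr.
  have := goodM (ih (ltnW mN)) (goodV (row_step _ jN)).
  by rewrite e invgM invgK mulgA mulgV mul1g.
(* Row 0 agrees with [X] at the grid points only; inside a cell both are close to the same grid
   value, so the quotient is again close to 1. *)
have X0 : good ((row 0)^-1 * X)%g.
  apply: (Wgood _ a b _ _ nV).
  - exact: (smooth_to_mul oT (smooth_to_inv oT (row_s 0%N (leq0n _))) sX).
  - move=> t; rewrite -[X in W X]/((row 0 t)^-1 * X t)%g.
    have [h|h] := pselect (a < t < b); last by rewrite row_out// X1// invg1 mulg1.
    have [m [mN /andP[m1 m2] hm]] := cell t h.
    have [x xr ->] := hm 0%N (leq0n _).
    have t01 : 0 <= tau t <= 1.
      case/andP: h => h1 h2; apply/andP; split; first by rewrite divr_ge0// subr_ge0 ltW.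
      by rewrite ler_pdivrMr// mul1r lerB// ltW.
    have XK : X t = K (0, tau t).
      by rewrite K0 ?in_itv//= /f divfK ?gt_eqF// addrC subrK.
    have [z zr zE] : (c @` ball x0 r) ((k 0%N m)^-1 * X t)%g.
      rewrite XK /k mul0r; apply: hN; rewrite ?lexx ?ler01 ?t01//.
      - by rewrite divr_ge0//= ler_pdivrMr// mul1r ler_nat ltnW.
      - by rewrite subrr normr0 invr_ge0.
      - have e : m%:R / N.+1%:R - tau t = (m%:R - N.+1%:R * tau t) / N.+1%:R.
          by field; rewrite gt_eqF.
        rewrite e normrM (ger0_norm (x := N.+1%:R^-1)) ?invr_ge0// ler_piMl ?invr_ge0//.
        by move: m2; rewrite -natr1 => m2; rewrite ler_norml; apply/andP; split; lra.
    by have := rW x z x0 xr zr B0; rewrite zE c1 mulg1 invgM !mulgA.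
  - by move=> t h; rewrite -[LHS]/((row 0 t)^-1 * X t)%g row_out// X1// invg1 mulg1.
have := good_row N.+1 (leqnn _); rewrite subnn => g0.
by have := goodM g0 X0; rewrite mulgA mulgV mul1g.
Qed.

Definition cutg (P : set R) X : fun_group R G := cut 1%g P X.

Lemma adherent_eq1 X t : trivial_on X -> adherent V t -> X t = 1%g.
Proof.
move=> [[cX _] X1] aV; apply: (manifold_hausdorff mA) => B C nB nC.
have : \forall s \near t, B (X s) by exact: (cX t I B nB).
move=> /(adherent_near aV)[v Vv Bv]; exists (X v); split=> //.
by rewrite X1//; exact: (nbhs_singleton nC).
Qed.

Lemma cut_coord (P : set R) X (U : set R) : (forall t, U t -> chart_cod c (X t)) ->
  forall t, U t -> cutg P X t = c (x0 + cut 0 P (fun s => chart_coord c (X s) - x0) t).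
Proof.
move=> UX t Ut; rewrite /cutg /cut; case: ifP => _; last by rewrite addr0 c1.
by rewrite addrC subrK; have [_ ->] := chart_coordP mA Ac (UX t Ut).
Qed.

(** Near a point adherent to V the path stays in the chart at 1 and [Cinfty_cut] applies to its
    coordinates; near any other point the cut path is [X] or constant. *)
Lemma trivial_on_cut X P : trivial_on X -> saturated V P -> trivial_on (cutg P X).
Proof.
move=> tX sP; have [sX X1] := tX; split; last by move=> t Vt; rewrite /cutg /cutg /cut X1//; case: ifP.
apply: (smooth_to_local mA oT) => t _.
have [aV|/not_adherent[e e0 he]] := pselect (adherent V t).
  pose U := setT `&` [set s : R^o | chart_cod c (X s)].
  have oU : open U := smooth_to_preimage oT sX (chart_cod_open mA Ac).
  have UX (s : R) : U s -> chart_cod c (X s) by case.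
  exists U; split=> //; first by split=> //=; rewrite (adherent_eq1 tX aV); exact: (chart_cod1 cx0 c1).
  pose f (s : R) := chart_coord c (X s) - x0.
  have Cf : Cinfty U (f : R^o -> E).
    move=> k; apply: Ck_add => //; last exact: Ck_cst.
    by case: sX => _; apply.
  have f0 t' : U t' -> V t' -> f t' = 0 by move=> _ Vt; rewrite /f X1// (coord1 Ac cx0 c1) subrr.
  have Cc := Cinfty_cut oV sP oU Cf f0.
  apply: (smooth_to_eq mA oU (f := c \o (fun s : R^o => x0 + cut 0 P f s))).
    by move=> s Us; rewrite (cut_coord P UX Us).
  apply: (smooth_to_comp mA oU (chart_open mA Ac) _ _ (smooth_to_chart mA Ac)) => [s Us|k].
    rewrite /cut; case: ifP => _; last by rewrite addr0.
    by rewrite addrC subrK; have [] := chart_coordP mA Ac (UX s Us).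
  by apply: Ck_add => //; first exact: Ck_cst.
have oB : open (ball (t : R^o) e) by exact: ball_open.
exists (ball (t : R^o) e); split=> //; first exact: ballxx.
have PP s : ball (t : R^o) e s -> P s <-> P t.
  by rewrite -ball_normE/= distrC; exact: (cut_near sP e0 he).
have [Pt|Pt] := pselect (P t).
  apply: (smooth_to_eq mA oB (f := X : R^o -> G)); last exact: smooth_to_sub sX.
  by move=> s /PP Ps; rewrite /cutg /cut asboolT//; apply/Ps.
apply: (smooth_to_eq mA oB (f := fun=> 1%g)); last exact: smooth_to_cst.
by move=> s /PP Ps; rewrite /cutg /cut asboolF// => /Ps.
Qed.

Variables (al be : R).
Hypothesis V_out : forall t, ~ (al < t < be) -> V t.

Lemma comp_good X s : trivial_on X -> good (cutg (interval_comp V s) X).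
Proof.
move=> tX; have [Vs|nVs] := pselect (V s).
  rewrite (_ : cutg _ _ = 1%g) //; apply/funext => t; rewrite /cutg /cut asboolF// => /(_ s); apply=> //.
  by rewrite ge_min le_max lexx.
have as_ : al <= s by rewrite leNgt; apply/negP => sa; apply/nVs/V_out => /andP[]; rewrite ltNge ltW.
have sb : s <= be by rewrite leNgt; apply/negP => bs; apply/nVs/V_out => /andP[_]; rewrite ltNge ltW.
have Va : V al by apply: V_out; rewrite ltxx.
have Vb : V be by apply: V_out; rewrite ltxx andbF.
have [a [a_s na aA]] := left_adherent Va as_ nVs.
have [b [s_b nb bA]] := right_adherent Vb sb nVs.
apply: (supported_good (a := a) (b := b)); first by apply: trivial_on_cut => //; exact: saturated_comp.
  move=> t /andP[a_t tb]; have [ts|st] := leP t s; first by apply: na; rewrite a_t.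
  by apply: nb; rewrite tb ltW.
(* A point of the component that is not in ]a, b[ can only be an end point, hence is adherent to V,
   and [X] is 1 there. *)
move=> t h; rewrite /cutg /cut; case: asboolP => // ht.
apply: (adherent_eq1 tX) => e e0.
have [ta|a_t] := leP t a.
  have [v [Vv v1 v2]] := aA e e0; exists v => //; have [tv|vt] := leP t v.
    by exfalso; apply: (ht v) => //; rewrite ge_min le_max tv (le_trans v2 a_s) orbT.
  by rewrite ltr0_norm ?subr_lt0//; lra.
have [tb|bt] := ltP t b; first by case: h; rewrite a_t tb.
have [v [Vv v1 v2]] := bA e e0; exists v => //; have [vt|tv] := leP v t.
  by exfalso; apply: (ht v) => //; rewrite ge_min le_max vt (le_trans s_b v2) orbT.
by rewrite gtr0_norm ?subr_gt0//; lra.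
Qed.

Lemma finite_comps_good (S : seq R) X : trivial_on X ->
  good (cutg [set t | exists2 s, s \in S & interval_comp V s t] X).
Proof.
elim: S X => [|s S ih] X tX.
  by rewrite (_ : cutg _ _ = 1%g) //; apply/funext => t; rewrite /cutg /cut asboolF// => -[].
have sC := @saturated_comp R V s.
have := goodM (comp_good s tX) (ih _ (trivial_on_cut tX (saturated_setC sC))).
congr good; apply/funext => t.
rewrite -[LHS]/(cutg (interval_comp V s) X t * cutg [set t | exists2 s, s \in S & interval_comp V s t]
  (cutg (~` interval_comp V s) X) t)%g /cutg /cut.
case: (asboolP (interval_comp V s t)) => h1.
  rewrite (asboolF (P := (~` _) t)); last by move/(_ h1).
  rewrite [in RHS]asboolT; last by exists s => //; rewrite mem_head.
  by case: ifP; rewrite mulg1.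
rewrite mul1g (asboolT (P := (~` _) t))//; congr (if _ then _ else _).
apply: asbool_equiv_eq; split=> -[s' hs hc]; exists s' => //; first by rewrite inE hs orbT.
by move: hs; rewrite inE => /orP[/eqP e|//]; case: h1; rewrite -e.
Qed.

(** The components that contain one of the N + 2 equidistant points from [al] to [be]: finitely
    many, and among them every component that is longer than the mesh. *)
Definition grid_comps N : set R := [set t | exists2 s,
  s \in [seq al + (be - al) * i%:R / N.+1%:R | i <- iota 0 N.+2] & interval_comp V s t].

Lemma saturated_grid_comps N : saturated V (grid_comps N).
Proof. by apply: saturated_bigU => s _; exact: saturated_comp. Qed.

(** The last grid point up to t is less than one mesh away, so no point of V separates it from t. *)
Lemma grid_comps_far N t : al <= t <= be ->
  (forall v, V v -> (be - al) / N.+1%:R < `|v - t|) -> grid_comps N t.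
Proof.
move=> /andP[at_ tb] far; have [ab|ba] := ltP al be; last first.
  have e : t = al by apply/eqP; rewrite eq_le at_ (le_trans tb ba).
  have Vt : V t by apply: V_out; rewrite e ltxx.
  have := far t Vt; rewrite subrr normr0 ltNge divr_ge0// subr_ge0.
  exact: le_trans tb.
have ba0 : 0 < be - al by rewrite subr_gt0.
have N0 : 0 < N.+1%:R :> R by rewrite ltr0n.
pose x := (t - al) / (be - al) * N.+1%:R.
have x0' : 0 <= x by rewrite mulr_ge0// divr_ge0 ?subr_ge0// ltW.
have /andP[ix xi] := truncn_itv x0'; set i := Num.truncn x in ix xi.
have xN : x <= N.+1%:R.
  by rewrite /x ler_piMl// ler_pdivrMr// mul1r lerB.
have iN : (i < N.+2)%N by rewrite -(ltr_nat R) (le_lt_trans ix)// (le_lt_trans xN)// ltr_nat.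
have tE : t = al + (be - al) * x / N.+1%:R.
  by rewrite /x; field; rewrite !gt_eqF.
exists (al + (be - al) * i%:R / N.+1%:R); first by apply/mapP; exists i; rewrite ?mem_iota.
have st : al + (be - al) * i%:R / N.+1%:R <= t.
  by rewrite [leRHS]tE lerD2l ler_pM2r ?invr_gt0// ler_pM2l.
have ts : t - (be - al) / N.+1%:R < al + (be - al) * i%:R / N.+1%:R.
  rewrite {1}tE -addrA ltrD2l -mulrBl ltr_pM2r ?invr_gt0// -{2}[be - al]mulr1 -mulrBr ltr_pM2l//.
  by rewrite ltrBlDr natr1.
move=> u; rewrite (min_l st) (max_r st) => /andP[u1 u2] Vu.
have := far u Vu; rewrite ler0_norm ?subr_le0// ltNge => /negP; apply.
by move: st ts u1 u2; set w := (be - al) / _; set z := al + _; lra.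
Qed.

Lemma grid_comps_near (Q : nat -> set R) k :
  (forall j t, adherent V t -> \forall s \near t, Q j s) ->
  \forall N \near \oo, forall j, (j <= k)%N -> forall t, Q j t \/ grid_comps N t.
Proof.
move=> VQ; apply: near_forall_le => j.
apply: filterS (near_adherent_segment al be (VQ j)) => N h t.
have [tab|tab] := pselect (al <= t <= be).
  by have [|far] := h t tab; [left|right; exact: grid_comps_far].
have Vt : V t by apply: V_out => /andP[h1 h2]; apply: tab; rewrite !ltW.
left; have : adherent V t by move=> e e0; exists t; rewrite ?subrr ?normr0.
by move=> /(VQ j)/nbhs_singleton.
Qed.

(* The long components of the complement of V are finitely many. What is left of X
   on the short ones has a coordinate function f, and the restrictions of f to
   shorter and shorter components tend to 0 with all derivatives, because f
   vanishes to infinite order on the closure of V. *)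
Lemma trivial_on_good X : trivial_on X -> good X.
Proof.
move=> tX.
(* The index [j] is a dummy that gives this single condition the form expected by
   [grid_comps_near]. *)
have V1 (j : nat) t : adherent V t -> \forall s \near t, chart_cod c (X s).
  move=> aV; have [[cX _] _] := tX; apply: (cX t I).
  rewrite (adherent_eq1 tX aV); apply: open_nbhs_nbhs.
  by split; [exact: (chart_cod_open mA Ac)|exact: (chart_cod1 cx0 c1)].
have [N hN] := filter_ex (grid_comps_near 0 V1).
pose Z := cutg (~` grid_comps N) X.
have sQ := @saturated_grid_comps N.
have tZ : trivial_on Z by apply: trivial_on_cut => //; exact: saturated_setC.
have -> : X = (cutg (grid_comps N) X * Z)%g.
  apply/funext => t; rewrite -[RHS]/(cutg (grid_comps N) X t * Z t)%g /Z /cutg /cut.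
  case: (asboolP (grid_comps N t)) => h; last by rewrite asboolT// mul1g.
  by rewrite asboolF ?mulg1// => /(_ h).
apply: goodM; first exact: finite_comps_good.
have Zc t : chart_cod c (Z t).
  rewrite /Z /cutg /cut; case: asboolP => h; last exact: (chart_cod1 cx0 c1).
  by have [//|/h] := hN 0%N (leqnn _) t.
pose f t := chart_coord c (Z t) - x0.
have fE t : x0 + f t = chart_coord c (Z t) by rewrite addrC subrK.
have Cf : Cinfty setT (f : R^o -> E).
  move=> k; apply: Ck_add => //; last exact: Ck_cst.
  by apply: (smooth_to_Cinfty Ac tZ.1) => t _; exact: Zc.
have f0 t : V t -> f t = 0 by move=> Vt; rewrite /f tZ.2// (coord1 Ac cx0 c1) subrr.
have fD t : chart_dom c (x0 + f t) by rewrite fE; have [] := chart_coordP mA Ac (Zc t).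
have ZE : Z = path_of f.
  by apply/funext => t; rewrite /path_of fE; have [_ ->] := chart_coordP mA Ac (Zc t).
rewrite ZE; apply: goodL => // k e e0.
have df := proj2 (Cinfty_derive1n f oT) Cf.
have V2 j t : adherent V t -> \forall s \near t, `|derive1n j f s| < e.
  move=> aV.
  have f0t : derive1n j f t = 0.
    by apply: (derive1n_adherent_eq0 j oV (U := setT) openT I aV) => [i s _|s _]; [exact: df|exact: f0].
  have cj : {for t, continuous (derive1n j f)} by apply/differentiable_continuous/derivable1_diffP/df.
  by have /cvgr0Pnorm_lt/(_ e e0) : derive1n j f s @[s --> t] --> 0 by rewrite -f0t; exact: cj.
have [M hM] := filter_ex (grid_comps_near k V2).
have sM := @saturated_grid_comps M.
have f0' t : setT t -> V t -> f t = 0 by move=> _; exact: f0.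
exists (cut 0 (grid_comps M) f); split.
- split.
  + exact: (Cinfty_cut oV sM oT Cf f0').
  + by move=> t Vt; rewrite /cut f0//; case: ifP.
  + by move=> t; rewrite /cut; case: ifP => // _; rewrite addr0.
- rewrite (_ : path_of _ = cutg (grid_comps M) Z); first exact: finite_comps_good.
  apply/funext => t; rewrite (cut_coord (grid_comps M) (U := setT) (fun s _ => Zc s) I).
  by rewrite /path_of.
- move=> j jk t; have [_ ->] := @cut_derive1n R _ V (grid_comps M) setT f oV sM openT df f0' j t I.
  rewrite /cut; case: asboolP => h; first by rewrite subrr normr0.
  by rewrite sub0r normrN; have [|/h] := hM j jk t.
Qed.

End CommutingPaths.

(** * Loops and the central extension *)

Section Periodization.
Variables (R : realType) (t0 d : R).
Hypothesis d0 : 0 < d.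
Local Notation tp := (2 * pi : R).

(** The representative of z in [t0, t0 + 2 pi[; thus [periodize] sees only one period of a function
    on the line. *)
Definition circle_rep (z : circle R) : R :=
  repr z - (Num.floor ((repr z - t0) / tp))%:~R * tp.

Definition periodize (X : Type) (f : R -> X) : circle R -> X := fun z => f (circle_rep z).

Let tp0 : 0 < tp. Proof. by rewrite mulr_gt0// pi_gt0. Qed.

Lemma circle_rep_itv z : t0 <= circle_rep z < t0 + tp.
Proof.
rewrite /circle_rep; set r := repr z; set m := Num.floor _.
have /andP[h1 h2] := floor_itv ((r - t0) / tp); rewrite -/m in h1 h2.
rewrite ler_pdivlMr// in h1; rewrite ltr_pdivrMr// intrD mulrDl mul1r in h2.
by apply/andP; split; lra.
Qed.

Lemma circle_proj_rep z : circle_proj (circle_rep z) = z.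
Proof.
rewrite -[RHS]reprK -/(circle_proj _); apply/circle_projE.
rewrite /circle_rep addrAC subrr add0r -mulNr mulfK ?gt_eqF//.
by rewrite rpredN; exact: intr_int.
Qed.

Lemma circle_rep_proj s : exists m : int, circle_rep (circle_proj s) = s + m%:~R * tp.
Proof.
have /circle_projE/intrP[m hm] : circle_proj (circle_rep (circle_proj s)) = circle_proj s.
  exact: circle_proj_rep.
exists m; have := congr1 ( *%R^~ tp) hm; rewrite divfK ?gt_eqF// => e.
by rewrite -e; ring.
Qed.

Lemma int_shift_le (m : int) : m < 0 -> (m%:~R : R) * tp <= - tp.
Proof.
move=> m0; rewrite -[leRHS]mulN1r ler_pM2r//.
by have : (m <= -1)%R by []; rewrite -(ler_int R).
Qed.

Lemma int_shift_ge (m : int) : 0 < m -> tp <= (m%:~R : R) * tp.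
Proof. by move=> m0; rewrite -[leLHS]mul1r ler_pM2r// -[1]/(1%:~R) ler_int. Qed.

(* The seam of the circle is invisible to a function that is constant near t0 and t0 + 2 pi. *)
Lemma periodize_local (X : Type) (e : X) (f : R -> X) :
  (forall s, ~ (t0 + d < s < t0 + tp - d) -> f s = e) ->
  forall t s, `|s - t| < d ->
  periodize f (circle_proj s) = f (s + (circle_rep (circle_proj t) - t)).
Proof.
move=> fe t s st; rewrite /periodize.
have [m hm] := circle_rep_proj t; have [k hk] := circle_rep_proj s.
have /andP[t1 t2] := circle_rep_itv (circle_proj t).
have /andP[s1 s2] := circle_rep_itv (circle_proj s).
move: st; rewrite ltr_norml => /andP[st1 st2].
have e1 : circle_rep (circle_proj s) = s + (circle_rep (circle_proj t) - t) + (k - m)%:~R * tp.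
  by rewrite hk hm intrB; ring.
set r := circle_rep (circle_proj t) in t1 t2 e1 *.
set r' := circle_rep (circle_proj s) in s1 s2 e1 *.
have [km|km|km] := ltgtP (k - m) 0.
- have := int_shift_le km; set u := _ * tp => h; rewrite -/u in e1.
  by rewrite !fe// => /andP[h1 h2]; lra.
- have := int_shift_ge km; set u := _ * tp => h; rewrite -/u in e1.
  by rewrite !fe// => /andP[h1 h2]; lra.
- by rewrite e1 km mul0r addr0.
Qed.

Lemma periodize_Cinfty (F : normedModType R) (e : F) (f : R -> F) :
  (forall s, ~ (t0 + d < s < t0 + tp - d) -> f s = e) ->
  Cinfty setT (f : R^o -> F) -> Cinfty setT (periodize f \o @circle_proj R : R^o -> F).
Proof.
move=> fe Cf k; have oT : open [set: R^o] by exact: openT.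
apply: Ck_local => // t _; exists (ball (t : R^o) d); split; [exact: ball_open|exact: ballxx|].
apply: (@Ck_eq _ _ _ _ _ ((f : R^o -> F) \o (fun s : R^o => 1 * s + (circle_rep (circle_proj t) - t) : R^o))).
- exact: ball_open.
- move=> s; rewrite -ball_normE/= distrC => st.
  by rewrite (periodize_local fe st) mul1r.
apply: (Ck_comp (ball_open _ _) oT _ _ (Cf k)) => //; last by apply: Ck_sub (@Ck_affine _ k _ _).
Qed.

Lemma periodize_derive (F : normedModType R) (e : F) (f : R -> F) :
  (forall s, ~ (t0 + d < s < t0 + tp - d) -> f s = e) ->
  Cinfty setT (f : R^o -> F) -> forall k t,
  circle_deriv k (periodize f) t = derive1n k f (circle_rep (circle_proj t)).
Proof.
move=> fe Cf k t; rewrite /circle_deriv.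
rewrite (@derive1n_eq_on _ _ (ball t d) _ (fun s => f (1 * s + (circle_rep (circle_proj t) - t)))).
- by rewrite derive1n_affine// expr1n scale1r mul1r addrC subrK.
- exact: ball_open.
- by move=> s; rewrite -ball_normE/= distrC => st; rewrite (periodize_local fe st) mul1r.
- exact: ballxx.
Qed.

Lemma periodize_circle_smooth (F : normedModType R) (e : F) (f : R -> F) :
  (forall s, ~ (t0 + d < s < t0 + tp - d) -> f s = e) ->
  Cinfty setT (f : R^o -> F) -> periodize f \in @circle_smooth R F.
Proof.
move=> fe Cf; have oT : open [set: R^o] by exact: openT.
apply/circle_smoothP => k t.
exact: (proj2 (Cinfty_derive1n _ oT) (periodize_Cinfty fe Cf)).
Qed.

Lemma periodize_loop (n : nat) (G : lieGroup 'rV[R]_n) (X : fun_group R G) :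
  (forall s, ~ (t0 + d < s < t0 + tp - d) -> X s = 1%g) ->
  smooth_to (lie_atlas G) setT (X : R^o -> G) -> loops G (periodize X).
Proof.
move=> X1 sX; have oT : open [set: R^o] by exact: openT.
have mA := lie_manifold G.
apply/loops_smooth_to; apply: (smooth_to_local mA oT) => t _.
exists (ball (t : R^o) d); split; [exact: ball_open|exact: ballxx|].
apply: (smooth_to_eq mA (ball_open _ _) (f := (X : R^o -> G) \o
    (fun s : R^o => 1 * s + (circle_rep (circle_proj t) - t) : R^o))).
  move=> s; rewrite -ball_normE/= distrC => st.
  by rewrite (periodize_local X1 st) mul1r.
apply: (smooth_to_comp mA (ball_open _ _) oT _ _ sX) => // k.
by apply: Ck_sub (@Ck_affine _ k _ _).
Qed.

End Periodization.

Section ProductAtlas.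
Variables (R : realType) (E F : tvsType R) (M N : choiceType).
Variables (A : atlas E M) (B : atlas F N).

Lemma pair_continuous_l (b : N) : (exists2 d, B d & chart_cod d b) ->
  continuous ((fun x => (x, b)) : mfd A -> mfd (prod_atlas A B)).
Proof.
move=> [d Bd [w dw wb]]; apply/continuousP => O oO.
rewrite open_mfdE => c Ac y cy Oy.
have cd : prod_atlas A B (prod_chart c d) by exists c => //; exists d.
have dom : chart_dom (prod_chart c d) (y, w) by [].
have Oyw : O (prod_chart c d (y, w)) by rewrite /= wb.
have [[P Q] [/= nP nQ] PQ] := oO _ cd _ dom Oyw.
apply: filterS nP => z Pz cz; have := PQ (z, w) (conj Pz (nbhs_singleton nQ)).
by rewrite /= wb; apply.
Qed.

Lemma pair_continuous_r (a : M) : (exists2 c, A c & chart_cod c a) ->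
  continuous ((fun y => (a, y)) : mfd B -> mfd (prod_atlas A B)).
Proof.
move=> [c Ac [w cw wa]]; apply/continuousP => O oO.
rewrite open_mfdE => d Bd y dy Oy.
have cd : prod_atlas A B (prod_chart c d) by exists c => //; exists d.
have dom : chart_dom (prod_chart c d) (w, y) by [].
have Owy : O (prod_chart c d (w, y)) by rewrite /= wa.
have [[P Q] [/= nP nQ] PQ] := oO _ cd _ dom Owy.
apply: filterS nQ => z Qz dz; have := PQ (w, z) (conj (nbhs_singleton nP) Qz).
by rewrite /= wa; apply.
Qed.

End ProductAtlas.

Section LieGroupTopology.
Variables (R : realType) (E : tvsType R) (H : lieGroup E).
Local Notation T := (mfd (lie_atlas H)).

Lemma mulg_continuous_r (k : H) : continuous ((fun h => h * k)%g : T -> T).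
Proof.
move=> h; have [cm _] := lie_mul_smooth H.
apply: (@continuous_comp T (mfd (prod_atlas (lie_atlas H) (lie_atlas H))) T (fun h => (h, k)) (fun x => (x.1 * x.2)%g : H)).
  by apply: pair_continuous_l; exact: chart_cover (lie_manifold H) k.
exact: cm.
Qed.

Lemma mulg_continuous_l (k : H) : continuous ((fun h => k * h)%g : T -> T).
Proof.
move=> h; have [cm _] := lie_mul_smooth H.
apply: (@continuous_comp T (mfd (prod_atlas (lie_atlas H) (lie_atlas H))) T (fun h => (k, h)) (fun x => (x.1 * x.2)%g : H)).
  by apply: pair_continuous_r; exact: chart_cover (lie_manifold H) k.
exact: cm.
Qed.

End LieGroupTopology.

Lemma U1_chart1 (R : realType) : exists2 d, U1_atlas R d & chart_cod d 1%g.
Proof.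
exists (Chart `]0 - pi, 0 + pi[ (@U1_exp R)); first by exists 0.
exists 0; first by rewrite /= in_itv/= sub0r add0r oppr_lt0 pi_gt0.
by apply: val_inj; rewrite /= cos0 sin0.
Qed.

Lemma morphism_mul1 (K K' : groupType) (f : {multiplicative K -> K'}) : f 1%g = 1%g.
Proof. by apply: (mulgI (f 1%g)); rewrite -gmulfM !mulg1. Qed.

Lemma morphism_mulV (K K' : groupType) (f : {multiplicative K -> K'}) x : f x^-1%g = (f x)^-1%g.
Proof. by apply: (mulgI (f x)); rewrite -gmulfM !mulgV morphism_mul1. Qed.

Lemma commg_mul_central (K : groupType) (x y a b : K) :
  (forall g, a * g = g * a)%g -> (forall g, b * g = g * b)%g -> [~ x * a, y * b]%g = [~ x, y]%g.
Proof.
move=> ca cb; have conjc (g u : K) : (forall v, g * v = v * g)%g -> (u ^ g = u)%g.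
  by move=> cg; rewrite /conjg -cg mulKg.
rewrite !commgEl conjgM (conjc b _ cb) conjMg [(a ^ y)%g]/conjg ca mulKg invgM.
by rewrite -[RHS](conjc a _ ca) /conjg !mulgA.
Qed.

(** * Loops whose lifts commute with a given element *)

Section CentralExtension.
Variables (R : realType) (n : nat) (G : lieGroup 'rV[R]_n).
Variables (F : tvsType R) (H : lieGroup F) (i : {multiplicative U1 R -> H}).
Variable p : {multiplicative H -> fun_group (circle R) G}.
Hypothesis ext : central_extension (loops G) (loop_atlas G) i p.
Implicit Types (h k : H) (x : fun_group (circle R) G).

Lemma fiber_central h h' : p h = p h' -> exists z, h = (h' * i z)%g.
Proof.
move=> e; have : [set h | p h = 1%g] (h'^-1 * h)%g by rewrite /= gmulfM morphism_mulV e mulVg.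
by rewrite (ext_exact ext) => -[z _ zE]; exists z; rewrite zE mulVKg.
Qed.

Lemma lift_exists x : loops G x -> exists h, p h = x.
Proof. by rewrite -(ext_proj_range ext) => -[h _ <-]; exists h. Qed.

Definition commutes_over k x : Prop :=
  loops G x /\ forall h, p h = x -> (h * k = k * h)%g.

(** Two lifts differ by a central factor, so one lift decides for all of them. *)
Lemma commutes_over_lift k x h : p h = x -> (h * k = k * h)%g -> commutes_over k x.
Proof.
move=> hx hk; split; first by rewrite -(ext_proj_range ext) -hx; exists h.
move=> h'; rewrite -hx => /fiber_central[z ->].
by rewrite -mulgA (ext_central ext) mulgA hk -mulgA.
Qed.

Lemma commutes_over1 k : commutes_over k 1%g.
Proof. by apply: (@commutes_over_lift k _ 1%g); rewrite ?morphism_mul1// mul1g mulg1. Qed.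

Lemma commutes_overM k x y : commutes_over k x -> commutes_over k y -> commutes_over k (x * y)%g.
Proof.
move=> [/lift_exists[h hx] kx] [/lift_exists[h' hy] ky].
apply: (@commutes_over_lift k _ (h * h')%g); first by rewrite gmulfM hx hy.
by rewrite -mulgA ky// mulgA kx// mulgA.
Qed.

Lemma commutes_overV k x : commutes_over k x -> commutes_over k x^-1%g.
Proof.
move=> [/lift_exists[h hx] kx].
apply: (@commutes_over_lift k _ h^-1%g); first by rewrite morphism_mulV hx.
by apply: (mulgI h); rewrite mulVKg mulgA kx// mulgK.
Qed.

(* The commutators of the lifts of x and y with k are central, hence disappear in
   the commutator of the two lifts. *)
Lemma commutes_overR k x y : loops G x -> loops G y ->
  (x * p k = p k * x)%g -> (y * p k = p k * y)%g -> commutes_over k [~ x, y]%g.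
Proof.
move=> /lift_exists[h hx] /lift_exists[h' hy] xk yk.
have [z zE] : exists z, (h ^ k = h * i z)%g.
  by apply: fiber_central; rewrite /conjg !gmulfM morphism_mulV hx xk mulKg.
have [w wE] : exists w, (h' ^ k = h' * i w)%g.
  by apply: fiber_central; rewrite /conjg !gmulfM morphism_mulV hy yk mulKg.
apply: (@commutes_over_lift k _ [~ h, h']%g).
  by rewrite /commg /conjg !gmulfM !morphism_mulV hx hy.
suff e : ([~ h, h'] ^ k = [~ h, h'])%g by rewrite -{2}e /conjg mulVKg.
by rewrite conjRg zE wE commg_mul_central//; exact: (ext_central ext).
Qed.

(** A local trivialization provides a continuous section y |-> s (y, 1) near the loop. Its left and
    right products with k depend continuously on y and agree at good y arbitrarily close to the
    loop, so they agree at the loop because the extension is Hausdorff. *)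
Lemma commutes_over_closed k c (f : smooth_space 'rV[R]_n) :
  lie_atlas G c -> chart_cod c 1%g -> chart_dom (loop_chart (1%g : fun_group (circle R) G) c) f ->
  loops G (loop_chart 1%g c f) ->
  (forall B : set (smooth_space 'rV[R]_n), nbhs f B -> exists2 f', B f' &
    chart_dom (loop_chart (1%g : fun_group (circle R) G) c) f' /\
    commutes_over k (loop_chart 1%g c f')) ->
  commutes_over k (loop_chart 1%g c f).
Proof.
move=> Ac c1 df Lx approx; set x := loop_chart 1%g c f; set lc := loop_chart _ c in df Lx approx x *.
have lcA : loop_atlas G lc.
  exists 1%g; last by exists c.
  apply/loops_smooth_to; exact: smooth_to_cst.
have [W [oW Wx WL [s [r [[cs _] _ srE _ _]]]]] := ext_loc_trivial ext Lx.
have ps y : W y -> p (s (y, 1%g)) = y by move=> Wy; have [] := srE y 1%g Wy.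
suff sk : (s (x, 1%g) * k = k * s (x, 1%g))%g by exact: (commutes_over_lift (ps x Wx) sk).
have cS : {for x, continuous ((fun y => s (y, 1%g)) : mfd (loop_atlas G) -> mfd (lie_atlas H))}.
  apply: (@continuous_comp (mfd (loop_atlas G)) (mfd (prod_atlas (loop_atlas G) (U1_atlas R)))
    (mfd (lie_atlas H)) (fun y => (y, 1%g)) s).
    by apply: pair_continuous_l; exact: U1_chart1.
  exact: cs.
have near_f (Q : set (mfd (loop_atlas G))) : nbhs (x : mfd (loop_atlas G)) Q ->
    \forall f' \near f, chart_dom lc f' -> Q (lc f').
  rewrite nbhsE => -[S [oS Sx] SQ]; have := oS lc lcA f df Sx.
  by apply: filterS => f' h /h /SQ.
apply: (manifold_hausdorff (lie_manifold H)) => B C nB nC.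
have nW : nbhs (x : mfd (loop_atlas G)) W by exact: open_nbhs_nbhs.
have nB' : nbhs (x : mfd (loop_atlas G)) [set y | B (s (y, 1%g) * k)%g].
  exact: (cS _ (@mulg_continuous_r _ _ H k (s (x, 1%g)) B nB)).
have nC' : nbhs (x : mfd (loop_atlas G)) [set y | C (k * s (y, 1%g))%g].
  exact: (cS _ (@mulg_continuous_l _ _ H k (s (x, 1%g)) C nC)).
have [f' hf' [df' [_ cf']]] := approx _ (near_f _ (filterI nW (filterI nB' nC'))).
have [Wf' [Bf' Cf']] := hf' df'.
exists (s (lc f', 1%g) * k)%g; split=> //.
by rewrite (cf' _ (ps _ Wf')).
Qed.

End CentralExtension.

Theorem theorem1p1 (R : realType) (n : nat) (G : lieGroup 'rV[R]_n)
    (G_semisimple : semisimple G)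
    (G_simply_connected : simply_connected R (mfd (lie_atlas G)))
    (F : tvsType R) (F_frechet : frechet_space F) (H : lieGroup F)
    (i : {multiplicative U1 R -> H})
    (p : {multiplicative H -> fun_group (circle R) G}) :
  central_extension (loops G) (loop_atlas G) i p ->
  disjoint_commutative p.
Proof.
move=> ext I J IJ h k [gL gI] [qL qJ].
(* If q is trivial, k is central. Otherwise the circle can be cut open at a point where q is not
   1. *)
have [q1|/existsNP[z0 qz0]] := pselect (forall z, p k z = 1%g).
  have [z ->] : exists z, k = (1 * i z)%g.
    by apply: (fiber_central ext); rewrite morphism_mul1; apply/funext.
  by rewrite mul1g (ext_central ext).
have mA := lie_manifold G; have oT : open [set: R^o] by exact: openT.
have [t0 t0z] := circle_proj_surj z0.
pose q (s : R) : G := p k (circle_proj s).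
have qp s : q (s + 2 * pi) = q s.
  rewrite /q (_ : circle_proj (s + 2 * pi) = circle_proj s)//; apply/circle_projE.
  by rewrite addrC addKr divff ?gt_eqF ?mulr_gt0 ?pi_gt0// rpred1.
pose V0 : set R := [set s | q s <> 1%g].
have oV0 : open V0.
  have sq := proj1 (loops_smooth_to _) qL.
  have o1 : open (~` [set 1%g] : set (mfd (lie_atlas G))).
    exact/closed_openC/accessible_closed_set1/hausdorff_accessible/manifold_hausdorff.
  by have := smooth_to_preimage oT sq o1; rewrite setTI.
have V0t0 : V0 t0 by rewrite /V0 /q /= t0z.
have [d d0 dV] : exists2 d : R, 0 < d & ball t0 d `<=` V0.
  by apply/nbhs_ballP; exact: open_nbhs_nbhs.
(* Half of [d] is left as a margin around the seam, as [periodize] requires; the points [al] and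
   [be] still lie in [V0]. *)
pose al := t0 + d / 2; pose be := t0 + 2 * pi - d / 2.
(* The two half-lines force paths trivial on V to live in one period, so that they close up to
   loops. They cost nothing, since q is not 1 on the adjacent part of that period. *)
pose V : set R := [set s | V0 s \/ (s < al \/ be < s)].
have oV : open V.
  apply: openU => //; apply: openU; [exact: open_lt|exact: open_gt].
have V0_left s : `|s - t0| < d -> V0 s.
  by move=> sd; apply: dV; rewrite -ball_normE/= distrC.
have V0_right s : `|s - (t0 + 2 * pi)| < d -> V0 s.
  by move=> sd; rewrite /V0 /= -(subrK (2 * pi) s) qp; apply: V0_left; rewrite -addrA -opprD (addrC _ t0).
have V_out s : ~ (al < s < be) -> V s.
  move=> hs; have [sa|as_] := ltP s al; first by right; left.
  have [bs|sb] := ltP be s; first by right; right.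
  left; move: as_; rewrite le_eqVlt => /orP[/eqP <-|a_s].
    by apply: V0_left; rewrite /al addrAC subrr add0r gtr0_norm ?divr_gt0//; lra.
  move: sb; rewrite le_eqVlt => /orP[/eqP ->|sb]; last by case: hs; rewrite a_s sb.
  by apply: V0_right; rewrite /be addrAC subrr add0r normrN gtr0_norm ?divr_gt0//; lra.
have d20 : 0 < d / 2 by rewrite divr_gt0.
have [c Ac [x0 cx0 c1]] := chart_cover mA 1%g.
have V_rep z : p k z <> 1%g -> V (circle_rep t0 z).
  by move=> qz; left; rewrite /V0 /q /= circle_proj_rep.
pose per (X : fun_group R G) : fun_group (circle R) G := periodize t0 X.
have triv_loop X : trivial_on V X -> loops G (per X).
  move=> [sX X1]; apply: (periodize_loop d20) => // s hs.
  by apply/X1/V_out; rewrite /al /be.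
have triv_comm X : trivial_on V X -> (per X * p k = p k * per X)%g.
  move=> [sX X1]; apply/funext => z.
  rewrite -[LHS]/(X (circle_rep t0 z) * p k z)%g -[RHS]/(p k z * X (circle_rep t0 z))%g.
  have [->|/V_rep Vz] := pselect (p k z = 1%g); first by rewrite mulg1 mul1g.
  by rewrite X1// mulg1 mul1g.
have good : forall X, trivial_on V X -> commutes_over p k (per X).
  apply: (trivial_on_good Ac cx0 c1 G_semisimple oV
    (good := fun X => commutes_over p k (per X)) _ _ _ _ _ G_simply_connected V_out).
  - exact: (commutes_over1 ext).
  - by move=> X Y kX kY; exact: (commutes_overM ext kX kY).
  - by move=> X kX; exact: (commutes_overV ext kX).
  - move=> X Y tX tY.
    exact: (commutes_overR ext (triv_loop _ tX) (triv_loop _ tY) (triv_comm _ tX) (triv_comm _ tY)).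
  - move=> f sf approx.
    have out g s : small_path c x0 V g -> ~ (t0 + d / 2 < s < t0 + 2 * pi - d / 2) -> x0 + g s = x0.
      by move=> [_ g0 _] hs; rewrite g0 ?addr0//; exact: V_out.
    have Cg g : small_path c x0 V g -> Cinfty setT ((fun s => x0 + g s) : R^o -> 'rV[R]_n).
      by move=> [Cg _ _] m; exact: Ck_shift.
    pose sp g (sg : small_path c x0 V g) : smooth_space 'rV[R]_n :=
      SmoothSpace (periodize_circle_smooth d20 (out g ^~ sg) (Cg g sg)).
    have spE g sg m t : circle_deriv m (sp g sg) t =
        derive1n m (fun s => x0 + g s) (circle_rep t0 (circle_proj t)).
      exact: (periodize_derive d20 (out g ^~ sg) (Cg g sg)).
    have lE g sg : loop_chart (1%g : fun_group (circle R) G) c (sp g sg) =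
        per (path_of c x0 g).
      by apply/funext => z; rewrite /= /per /periodize /path_of -[RHS]mul1g.
    have dom g sg : chart_dom (loop_chart (1%g : fun_group (circle R) G) c) (sp g sg).
      by move=> z; have [_ _ gD] := sg; exact: gD.
    rewrite -(lE f sf); apply: (commutes_over_closed ext Ac).
    + by exists x0.
    + exact: dom.
    + by rewrite lE; apply: triv_loop; exact: path_of_trivial.
    + move=> B [m [e [e0 sB]]]; have [f' [sf' gf' close]] := approx m e e0.
      exists (sp f' sf'); last by rewrite lE; split=> //; exact: dom.
      (* The constant [x0] cancels in the difference of order 0 and disappears from all derivatives
         of positive order. *)
      apply: sB => j t jm; rewrite !spE; case: j jm => [|j] jm.
        by rewrite /= opprD addrACA subrr add0r; exact: (close 0%N).
      by rewrite !derive1n_addl; exact: close.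
(* One period of g, continued by 1. No jump occurs at the seam, because q is not 1 near it and so g
   is 1 there. *)
pose X : fun_group R G := fun s => if t0 <= s < t0 + 2 * pi then p h (circle_proj s) else 1%g.
have V0X s : V0 s -> X s = 1%g.
  move=> V0s; rewrite /X; case: ifP => // _; apply: gI => Is.
  have nJ : ~ J (circle_proj s) by move=> Js; have : (I `&` J) (circle_proj s) by []; rewrite IJ.
  by apply: V0s; exact: qJ.
have XV s : V s -> X s = 1%g.
  move=> [|[sa|bs]]; first exact: V0X.
    have [ts|st] := leP t0 s; last by rewrite /X leNgt st.
    by apply/V0X/V0_left; move: sa; rewrite /al => sa; rewrite ger0_norm ?subr_ge0//; lra.
  have [ts|st] := leP (t0 + 2 * pi) s; first by rewrite /X [s < _]ltNge ts andbF.
  by apply/V0X/V0_right; move: bs; rewrite /be => bs; rewrite ltr0_norm ?subr_lt0//; lra.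
have tX : trivial_on V X.
  split=> //; apply: (smooth_to_local mA oT) => s _.
  have [Vs|nVs] := pselect (V s).
    exists V; split=> //; apply: (smooth_to_eq mA oV _ (smooth_to_cst _ V 1%g)) => u Vu.
    by rewrite XV.
  have oU : open (`]al, be[%classic : set R^o) by exact: interval_open.
  exists `]al, be[%classic; split=> //.
    by rewrite /= in_itv/=; apply: contrapT => /V_out.
  apply: (smooth_to_eq mA oU _ (smooth_to_sub (@subsetT _ _) (proj1 (loops_smooth_to _) gL))) => u.
  rewrite /= in_itv/= /al /be => /andP[u1 u2]; rewrite /X ifT//.
  by apply/andP; split; lra.
have [_] := good X tX; apply.
apply/funext => z; rewrite /per /periodize /X ifT ?circle_proj_rep//.
exact: circle_rep_itv.
Qed.
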